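(* Let $0<\underline\sigma\le\overline\sigma<\infty$ and let $X,X_1,X_2,\dots$ be random variables in a sub-linear expectation space $(\Omega,\mathscr H,\hat{\mathbb E})$ such that $\{X_n\}$ is independent, $X_n\overset d=X$ for all $n$, and $X\sim N(0,[\underline\sigma^2,\overline\sigma^2])$ under $\hat{\mathbb E}$. Let $S_n=\sum_{i=1}^nX_i$, $V_n^2=\sum_{i=1}^nX_i^2$. Suppose that $\mathbb V$ is continuous. Then $$\mathcal V\left(\left\{\frac{S_n}{V_n\sqrt{2\log\log n}}\right\}\twoheadrightarrow[-1,1]\right)=1.$$
   Context: Sub-linear expectation space: $\mathscr H$ is a linear space of real functions on a measurable space $(\Omega,\mathcal F)$, closed under $\varphi(X_1,\dots,X_n)$ for $\varphi$ bounded continuous or locally Lipschitz with polynomial growth ($|\varphi(x)-\varphi(y)|\le C(1+|x|^m+|y|^m)|x-y|$); $\hat{\mathbb E}:\mathscr H\to[-\infty,\infty]$ is monotone, constant preserving, sub-additive and positively homogeneous. Capacities: $\mathbb V(A)=\inf\{\hat{\mathbb E}[\xi]:I_A\le\xi,\xi\in\mathscr H\}$, $\mathcal V(A)=1-\mathbb V(A^c)$. $\mathbb V$ is continuous if $\mathbb V(A_n)\uparrow\mathbb V(A)$ whenever $A_n\uparrow A$ and $\mathbb V(A_n)\downarrow\mathbb V(A)$ whenever $A_n\downarrow A$. Independence: $\mathbf Y$ is independent of $\mathbf X$ if $\hat{\mathbb E}[\varphi(\mathbf X,\mathbf Y)]=\hat{\mathbb E}[\hat{\mathbb E}[\varphi(\mathbf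 x,\mathbf Y)]|_{\mathbf x=\mathbf X}]$ for all locally Lipschitz $\varphi$ of polynomial growth (whenever the relevant expectations are finite); $\{X_n\}$ is independent if $X_{i+1}$ is independent of $(X_1,\dots,X_i)$ for each $i$. $X_n\overset d=X$ means $\hat{\mathbb E}[\varphi(X_n)]=\hat{\mathbb E}[\varphi(X)]$ for all such $\varphi$. $G$-normal: with $G(\alpha)=\frac12(\overline\sigma^2\alpha^+-\underline\sigma^2\alpha^-)$, $X\sim N(0,[\underline\sigma^2,\overline\sigma^2])$ means that for every bounded Lipschitz $\varphi$, the function $u(t,x)=\hat{\mathbb E}[\varphi(x+\sqrt tX)]$ ($x\in\mathbb R,t\ge0$) is the unique viscosity solution of $\partial_tu-G(\partial^2_{xx}u)=0$, $u(0,x)=\varphi(x)$. For a real sequence $\{x_n\}$, $\{x_n\}\twoheadrightarrow A$ means $\inf_{y\in A}|x_n-y|\to0$ and the set of limit points of $\{x_n\}$ equals $A$. *)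

(* Defs.v *)
From Stdlib Require Import Reals ClassicalEpsilon.
From Coquelicot Require Import Coquelicot.
Open Scope R_scope.

(* ---------- points of R^n, encoded as functions nat -> R (only the
   first n coordinates are relevant) ---------- *)
Fixpoint sumsq (n : nat) (v : nat -> R) : R :=
  match n with O => 0 | S k => sumsq k v + v k ^ 2 end.
Definition normn (n : nat) (v : nat -> R) : R := sqrt (sumsq n v).
Definition vsub (v w : nat -> R) : nat -> R := fun j => v j - w j.

(* phi : R^n -> R is locally Lipschitz with polynomial growth:
   |phi x - phi y| <= C (1 + |x|^m + |y|^m) |x - y|.
   (This forces phi to depend only on the first n coordinates.) *)
Definition lip_poly (n : nat) (phi : (nat -> R) -> R) : Prop :=
  exists (C : R) (m : nat), forall x y,
    Rabs (phi x - phi y) <=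
      C * (1 + normn n x ^ m + normn n y ^ m) * normn n (vsub x y).

Definition bdd_cont (n : nat) (phi : (nat -> R) -> R) : Prop :=
  (exists M, forall x, Rabs (phi x) <= M) /\
  (forall x eps, 0 < eps -> exists delta, 0 < delta /\
     forall y, normn n (vsub x y) < delta -> Rabs (phi x - phi y) < eps).

Definition lip_poly1 (phi : R -> R) : Prop :=
  exists (C : R) (m : nat), forall x y,
    Rabs (phi x - phi y) <= C * (1 + Rabs x ^ m + Rabs y ^ m) * Rabs (x - y).
Definition bdd_lip1 (phi : R -> R) : Prop :=
  (exists M, forall x, Rabs (phi x) <= M) /\
  (exists L, forall x y, Rabs (phi x - phi y) <= L * Rabs (x - y)).

Definition sigma_algebra {Omega : Type} (F : (Omega -> Prop) -> Prop) : Prop :=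
  F (fun _ => True) /\
  (forall A, F A -> F (fun w => ~ A w)) /\
  (forall A : nat -> Omega -> Prop, (forall n, F (A n)) ->
     F (fun w => exists n, A n w)).

Record sublinear_space {Omega : Type} (F : (Omega -> Prop) -> Prop)
    (H : (Omega -> R) -> Prop) (E : (Omega -> R) -> Rbar) : Prop := {
  sl_sigma : sigma_algebra F;
  sl_meas : forall X, H X -> forall a, F (fun w => X w <= a);
  sl_zero : H (fun _ => 0);
  sl_add : forall X Y, H X -> H Y -> H (fun w => X w + Y w);
  sl_scal : forall (c : R) X, H X -> H (fun w => c * X w);
  sl_closed_bc : forall (n : nat) (phi : (nat -> R) -> R) (Xs : nat -> Omega -> R),
      (forall i, (i < n)%nat -> H (Xs i)) -> bdd_cont n phi ->
      H (fun w => phi (fun i => Xs i w));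
  sl_closed_lip : forall (n : nat) (phi : (nat -> R) -> R) (Xs : nat -> Omega -> R),
      (forall i, (i < n)%nat -> H (Xs i)) -> lip_poly n phi ->
      H (fun w => phi (fun i => Xs i w));
  sl_mono : forall X Y, H X -> H Y -> (forall w, X w <= Y w) ->
      Rbar_le (E X) (E Y);
  sl_const : forall c : R, E (fun _ => c) = Finite c;
  sl_subadd : forall X Y, H X -> H Y -> ex_Rbar_plus (E X) (E Y) ->
      Rbar_le (E (fun w => X w + Y w)) (Rbar_plus (E X) (E Y));
  sl_poshom : forall (l : R) X, H X -> 0 < l ->
      E (fun w => l * X w) = Rbar_mult (Finite l) (E X)
}.

Definition indic {Omega : Type} (A : Omega -> Prop) (w : Omega) : R :=
  if excluded_middle_informative (A w) then 1 else 0.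

(* V(A) = inf { E[xi] : I_A <= xi, xi in H }  (an element of [0,1],
   hence we take its real part) *)
Definition Vcap {Omega : Type} (H : (Omega -> R) -> Prop) (E : (Omega -> R) -> Rbar)
    (A : Omega -> Prop) : R :=
  real (Rbar_glb (fun y => exists xi, H xi /\ (forall w, indic A w <= xi w) /\ E xi = y)).

Definition lVcap {Omega : Type} (H : (Omega -> R) -> Prop) (E : (Omega -> R) -> Rbar)
    (A : Omega -> Prop) : R :=
  1 - Vcap H E (fun w => ~ A w).

Definition Vcap_continuous {Omega : Type} (F : (Omega -> Prop) -> Prop)
    (H : (Omega -> R) -> Prop) (E : (Omega -> R) -> Rbar) : Prop :=
  (forall (An : nat -> Omega -> Prop) (A : Omega -> Prop),
     (forall n, F (An n)) -> F A ->
     (forall n w, An n w -> An (S n) w) -> (forall w, A w <-> exists n, An n w) ->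
     is_lim_seq (fun n => Vcap H E (An n)) (Vcap H E A)) /\
  (forall (An : nat -> Omega -> Prop) (A : Omega -> Prop),
     (forall n, F (An n)) -> F A ->
     (forall n w, An (S n) w -> An n w) -> (forall w, A w <-> forall n, An n w) ->
     is_lim_seq (fun n => Vcap H E (An n)) (Vcap H E A)).

Definition indep_next {Omega : Type} (E : (Omega -> R) -> Rbar)
    (X : nat -> Omega -> R) (i : nat) : Prop :=
  forall phi : (nat -> R) -> R, lip_poly (S i) phi ->
    let psi := fun x : nat -> R =>
      E (fun w' => phi (fun j => if (j <? i)%nat then x j else X i w')) in
    (forall x, is_finite (psi x)) ->
    E (fun w => phi (fun j => X j w)) = E (fun w => real (psi (fun j => X j w))).

(* the sequence X_1, X_2, ... (here X 0, X 1, ...) is independent *)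
Definition indep_seq {Omega : Type} (E : (Omega -> R) -> Rbar)
    (X : nat -> Omega -> R) : Prop :=
  forall i, (1 <= i)%nat -> indep_next E X i.

Definition same_dist {Omega : Type} (E : (Omega -> R) -> Rbar) (Y Z : Omega -> R) : Prop :=
  forall phi, lip_poly1 phi -> E (fun w => phi (Y w)) = E (fun w => phi (Z w)).

Definition Gfun (sl2 su2 a : R) : R :=
  / 2 * (su2 * Rmax a 0 - sl2 * Rmax (- a) 0).

Definition test_fun (psi pt pxx : R -> R -> R) : Prop :=
  exists px : R -> R -> R,
  (forall t x, is_derive (fun s => psi s x) t (pt t x)) /\
  (forall t x, is_derive (fun y => psi t y) x (px t x)) /\
  (forall t x, is_derive (fun y => px t y) x (pxx t x)) /\
  (forall t x, continuous (fun p : R * R => pt (fst p) (snd p)) (t, x)) /\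
  (forall t x, continuous (fun p : R * R => px (fst p) (snd p)) (t, x)) /\
  (forall t x, continuous (fun p : R * R => pxx (fst p) (snd p)) (t, x)).

Definition visc_sol (sl2 su2 : R) (phi : R -> R) (u : R -> R -> R) : Prop :=
  (forall t x, 0 <= t -> forall eps, 0 < eps -> exists delta, 0 < delta /\
     forall s y, 0 <= s -> Rabs (s - t) < delta -> Rabs (y - x) < delta ->
       Rabs (u s y - u t x) < eps) /\
  (forall x, u 0 x = phi x) /\
  (forall t x psi pt pxx, 0 < t -> test_fun psi pt pxx -> psi t x = u t x ->
     (exists r, 0 < r /\ forall s y, 0 < s -> Rabs (s - t) < r -> Rabs (y - x) < r ->
        u s y <= psi s y) ->
     pt t x - Gfun sl2 su2 (pxx t x) <= 0) /\
  (forall t x psi pt pxx, 0 < t -> test_fun psi pt pxx -> psi t x = u t x ->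
     (exists r, 0 < r /\ forall s y, 0 < s -> Rabs (s - t) < r -> Rabs (y - x) < r ->
        psi s y <= u s y) ->
     pt t x - Gfun sl2 su2 (pxx t x) >= 0).

Definition G_normal {Omega : Type} (E : (Omega -> R) -> Rbar) (sl2 su2 : R)
    (X : Omega -> R) : Prop :=
  forall phi, bdd_lip1 phi ->
    let u := fun t x => real (E (fun w => phi (x + sqrt t * X w))) in
    visc_sol sl2 su2 phi u /\
    (forall v, visc_sol sl2 su2 phi v ->
       (exists (C : R) (k : nat), forall t x, 0 <= t -> Rabs (v t x) <= C * (1 + Rabs x ^ k)) ->
       forall t x, 0 <= t -> v t x = u t x).

Definition limit_point (x : nat -> R) (c : R) : Prop :=
  forall eps, 0 < eps -> forall N, exists n, (N <= n)%nat /\ Rabs (x n - c) < eps.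

Definition cluster_to (x : nat -> R) (a b : R) : Prop :=
  is_lim_seq (fun n => real (Glb_Rbar (fun d => exists y, a <= y <= b /\ d = Rabs (x n - y)))) 0 /\
  (forall c, limit_point x c <-> a <= c <= b).

Fixpoint psum (f : nat -> R) (n : nat) : R :=
  match n with O => 0 | S k => psum f k + f k end.

(* S_n = X_1 + ... + X_n and V_n^2 = X_1^2 + ... + X_n^2, where X_i := X (i-1) *)
Definition Sn {Omega : Type} (X : nat -> Omega -> R) (n : nat) (w : Omega) : R :=
  psum (fun i => X i w) n.
Definition Vn {Omega : Type} (X : nat -> Omega -> R) (n : nat) (w : Omega) : R :=
  sqrt (psum (fun i => X i w ^ 2) n).

(* Main.v *)
(** Continuity of the capacity forces the sub-linear expectation to be linear on bounded Lipschitz functions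
    of the sequence. Suppose the upper and the lower mean of [f X] differ. Cut the sequence into independent blocks of growing
    length; a block average can be kept near the upper mean, or near the lower mean, with capacity close to 1.
    The events "some block after the n-th is high, and eventually all blocks are low" decrease to the empty set,
    yet each has capacity at least 1/2, because the n-th block may be high and all later ones low.

    Linearity makes [u(t,x) = E cos (x + sqrt t X)] equal to [C(t) cos x].  Testing the G-heat equation where
    [cos] is 1 and where it is -1 gives [C' = - sl^2 C / 2] and [C' = - su^2 C / 2] in the viscosity sense, so [sl = su], and
    [X] acts as a centred Gaussian on Gaussian test functions, by uniqueness for the heat equation.

    What remains is the classical law of the iterated logarithm.  A Gaussian test function centred far away
    and very flat replaces the exponential, which is not bounded; as a function of the partial sums it is a martingale, and this
    gives the maximal inequality behind the upper bound.  The lower bound comes from independent blocks ending at powers of a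
    large integer, and [V_n^2 / n -> sl^2] from exponential bounds. *)

Require Import Defs.
From Stdlib Require Import Reals Lra Lia Classical ClassicalEpsilon FunctionalExtensionality PropExtensionality.
From Coquelicot Require Import Coquelicot.
Open Scope R_scope.

(** * Capacities and null sets *)

(** [Vcap] is only sub-additive and independence speaks of functions, so independence is never
    applied to events. Each upper bound on a capacity that rests on the law comes from a bounded
    Lipschitz majorant of an indicator, each such lower bound from a minorant, and independence acts
    on products of nonnegative functions of consecutive blocks.

    Boundedness shapes the test functions: [E] may be infinite on others, and [G_normal] speaks of
    bounded Lipschitz data. Hence Gaussians stand in for exponentials,
    [2 d (1 - exp (- x^2 / (2 d)))] for [x^2], and squares are truncated before their exponential is
    taken. Lipschitz regularity forces a smoothed stopping rule in the maximal inequality and bumps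
    in place of windows.

    A lower bound on [V_n^2] is needed at all times, since it bounds the ratio from above; an upper
    bound is needed only at the times where the lower half of the law is realised. These are powers
    of [b ^ 8], so that the truncation level, the eighth root of the time, is itself a power of
    [b]. *)

Lemma indic_bounds {Omega : Type} (A : Omega -> Prop) w : 0 <= indic A w <= 1.
Proof. unfold indic; destruct excluded_middle_informative; lra. Qed.

Lemma indic_true {Omega : Type} (A : Omega -> Prop) w : A w -> indic A w = 1.
Proof. unfold indic; destruct excluded_middle_informative; tauto. Qed.

Lemma indic_false {Omega : Type} (A : Omega -> Prop) w : ~ A w -> indic A w = 0.
Proof. unfold indic; destruct excluded_middle_informative; tauto. Qed.

Lemma indic_le {Omega : Type} (A : Omega -> Prop) w r : 0 <= r -> (A w -> 1 <= r) -> indic A w <= r.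
Proof. unfold indic; destruct excluded_middle_informative; auto. Qed.

Lemma le_indic {Omega : Type} (A : Omega -> Prop) w r : r <= 1 -> (~ A w -> r <= 0) -> r <= indic A w.
Proof. unfold indic; destruct excluded_middle_informative; auto. Qed.

Lemma psum_split a m n : psum a (m + n) = psum a m + psum (fun k => a (m + k)%nat) n.
Proof.
  induction n; [rewrite Nat.add_0_r; simpl; lra|]. rewrite <- plus_n_Sm; simpl; lra.
Qed.

Lemma psum_ext f g n : (forall j, (j < n)%nat -> f j = g j) -> psum f n = psum g n.
Proof. induction n; intros h; simpl; auto. rewrite IHn; auto. rewrite h; auto. Qed.

Lemma psum_nonneg f n : (forall j, (j < n)%nat -> 0 <= f j) -> 0 <= psum f n.
Proof. induction n; intros h; simpl; [lra|]. apply Rplus_le_le_0_compat; auto. Qed.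

(** Past an index where the partial sum is within [eps] of the supremum, no stretch of terms can add
    more than [eps]. *)
Lemma psum_tail a C eps : 0 < eps -> (forall k, 0 <= a k) -> (forall n, psum a n <= C) ->
  exists N, forall m n, (N <= m)%nat -> psum (fun k => a (m + k)%nat) n <= eps.
Proof.
  intros he ha hC.
  destruct (completeness (fun x => exists n, x = psum a n)) as [s [hs1 hs2]].
  - exists C. intros x [n ->]; auto.
  - exists (psum a 0), O; auto.
  - assert (hN : exists N, s - eps < psum a N).
    { apply NNPP; intros hn. assert (s <= s - eps); [|lra].
      apply hs2. intros x [n ->]. apply Rnot_lt_le; intros hl; apply hn; exists n; auto. }
    destruct hN as [N hN]. exists N. intros m n hm.
    assert (h1 := psum_split a m n).
    assert (h2 := psum_split a N (m - N)). replace (N + (m - N))%nat with m in h2 by lia.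
    assert (0 <= psum (fun k => a (N + k)%nat) (m - N)) by (apply psum_nonneg; auto).
    assert (psum a (m + n) <= s) by (apply hs1; eexists; eauto). lra.
Qed.

Section Capacity.
Context {Omega : Type} {F : (Omega -> Prop) -> Prop}
  {H : (Omega -> R) -> Prop} {E : (Omega -> R) -> Rbar} (SL : sublinear_space F H E).

Definition bounded_fun (xi : Omega -> R) : Prop := exists M, forall w, Rabs (xi w) <= M.

(** A constant is a bounded continuous function of zero variables. *)
Lemma H_const c : H (fun _ => c).
Proof.
  apply (sl_closed_bc _ _ _ SL 0 (fun _ => c) (fun _ _ => 0)).
  - intros j Hj; inversion Hj.
  - split.
    + exists (Rabs c). intros; lra.
    + intros z eps He. exists 1; split; [lra|]. intros; rewrite Rminus_diag, Rabs_R0; lra.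
Qed.

Lemma H_ext X Y : (forall w, X w = Y w) -> H X -> H Y.
Proof. intros e; replace Y with X; auto. apply functional_extensionality; auto. Qed.

(** [E] takes values in [Rbar]; monotonicity between two constants makes it finite on bounded
    functions, so [real] loses nothing there. *)
Lemma E_finite xi M : H xi -> (forall w, Rabs (xi w) <= M) ->
  E xi = Finite (real (E xi)) /\ Rabs (real (E xi)) <= M.
Proof.
  intros Hx HM.
  assert (h1 := sl_mono _ _ _ SL xi (fun _ => M) Hx (H_const M) (fun w => proj2 (proj1 (Rabs_le_between _ _) (HM w)))).
  assert (h2 := sl_mono _ _ _ SL (fun _ => - M) xi (H_const (- M)) Hx (fun w => proj1 (proj1 (Rabs_le_between _ _) (HM w)))).
  rewrite (sl_const _ _ _ SL) in h1, h2.
  destruct (E xi); simpl in *; try tauto.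
  split; auto. apply Rabs_le; auto.
Qed.

Lemma E_finite' xi : H xi -> bounded_fun xi -> E xi = Finite (real (E xi)).
Proof. intros Hx [M HM]; apply (E_finite xi M); auto. Qed.

Lemma er_mono X Y : H X -> H Y -> bounded_fun X -> bounded_fun Y -> (forall w, X w <= Y w) ->
  real (E X) <= real (E Y).
Proof.
  intros hX hY bX bY h. assert (h1 := sl_mono _ _ _ SL X Y hX hY h).
  rewrite (E_finite' X), (E_finite' Y) in h1 by auto. exact h1.
Qed.

Lemma bounded_add X Y : bounded_fun X -> bounded_fun Y -> bounded_fun (fun w => X w + Y w).
Proof.
  intros [M HM] [N HN]; exists (M + N); intros w.
  eapply Rle_trans; [apply Rabs_triang|]. specialize (HM w); specialize (HN w); lra.
Qed.

Lemma er_subadd X Y : H X -> H Y -> bounded_fun X -> bounded_fun Y ->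
  real (E (fun w => X w + Y w)) <= real (E X) + real (E Y).
Proof.
  intros hX hY bX bY.
  assert (h1 := sl_subadd _ _ _ SL X Y hX hY).
  assert (hS := sl_add _ _ _ SL X Y hX hY).
  rewrite (E_finite' X), (E_finite' Y), (E_finite' (fun w => X w + Y w)) in h1; auto using bounded_add.
  apply h1. exact I.
Qed.

Lemma er_scal l X : H X -> bounded_fun X -> 0 <= l -> real (E (fun w => l * X w)) = l * real (E X).
Proof.
  intros hX bX [hl|<-].
  - rewrite (sl_poshom _ _ _ SL) by auto. rewrite (E_finite' X) by auto. reflexivity.
  - replace (fun w => 0 * X w) with (fun _ : Omega => 0).
    + rewrite (sl_const _ _ _ SL). simpl; ring.
    + apply functional_extensionality; intros; ring.
Qed.

Local Notation V := (Vcap H E).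

(** Rules out the default value of [real] in [Vcap]: the constant 1 is admissible, and every
    admissible function dominates 0. *)
Lemma glb_facts A : let g := Rbar_glb (fun y => exists xi, H xi /\ (forall w, indic A w <= xi w) /\ E xi = y) in
  g = Finite (V A) /\ 0 <= V A <= 1.
Proof.
  intros g.
  assert (hg := proj2_sig (Rbar_ex_glb (fun y => exists xi, H xi /\ (forall w, indic A w <= xi w) /\ E xi = y))).
  fold (Rbar_glb (fun y => exists xi, H xi /\ (forall w, indic A w <= xi w) /\ E xi = y)) in hg. fold g in hg.
  destruct hg as [h1 h2].
  assert (a : Rbar_le g 1).
  { apply h1. exists (fun _ => 1). split; [apply H_const|split].
    - intros; apply indic_bounds.
    - apply (sl_const _ _ _ SL). }
  assert (b : Rbar_le 0 g).
  { apply h2. intros y (xi & hx & hi & <-). rewrite <- (sl_const _ _ _ SL 0).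
    apply (sl_mono _ _ _ SL); auto using H_const.
    intros w. eapply Rle_trans; [apply (indic_bounds A w)|auto]. }
  unfold Vcap. fold g. destruct g; simpl in *; try tauto. 
Qed.

Lemma V_bounds A : 0 <= V A <= 1.
Proof. apply glb_facts. Qed.

Lemma V_le_E A xi c : H xi -> (forall w, indic A w <= xi w) -> Rbar_le (E xi) (Finite c) -> V A <= c.
Proof.
  intros hx hi hc. destruct (glb_facts A) as [e _].
  assert (hg := proj2_sig (Rbar_ex_glb (fun y => exists xi, H xi /\ (forall w, indic A w <= xi w) /\ E xi = y))).
  destruct hg as [h1 _].
  assert (a : Rbar_le (Finite (V A)) (E xi)).
  { rewrite <- e. apply h1. exists xi; auto. }
  exact (Rbar_le_trans _ _ _ a hc).
Qed.

Lemma le_V A c : (forall xi, H xi -> (forall w, indic A w <= xi w) -> Rbar_le (Finite c) (E xi)) -> c <= V A.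
Proof.
  intros h. destruct (glb_facts A) as [e _].
  assert (hg := proj2_sig (Rbar_ex_glb (fun y => exists xi, H xi /\ (forall w, indic A w <= xi w) /\ E xi = y))).
  destruct hg as [_ h2].
  change (Rbar_le c (V A)). rewrite <- e. apply h2. intros y (xi & hx & hi & <-); auto.
Qed.

Lemma V_approx A eps : 0 < eps -> exists xi r, H xi /\ (forall w, indic A w <= xi w) /\ E xi = Finite r /\ r < V A + eps.
Proof.
  intros he. apply NNPP; intros hn.
  assert (V A + eps <= V A); [|lra].
  apply le_V. intros xi hx hi.
  assert (b : Rbar_le 0 (E xi)).
  { rewrite <- (sl_const _ _ _ SL 0).
    apply (sl_mono _ _ _ SL); auto using H_const.
    intros w. eapply Rle_trans; [apply (indic_bounds A w)|auto]. }
  destruct (E xi) eqn:Ex; simpl in *; try tauto.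
  apply Rnot_lt_le. intros hl. apply hn. exists xi, r; auto.
Qed.

Lemma V_mono A B : (forall w, A w -> B w) -> V A <= V B.
Proof.
  intros h. apply Rnot_lt_le; intros hl.
  destruct (V_approx B (V A - V B)) as (xi & r & hx & hi & hE & hr); [lra|].
  assert (V A <= r); [|lra].
  apply (V_le_E A xi); auto.
  - intros w; eapply Rle_trans; [|apply hi]. apply indic_le; [apply indic_bounds|].
    intros; rewrite indic_true; auto; lra.
  - rewrite hE; simpl; lra.
Qed.

Lemma V_empty A : (forall w, ~ A w) -> V A = 0.
Proof.
  intros h. apply Rle_antisym; [|apply V_bounds].
  apply (V_le_E A (fun _ => 0)); auto using H_const.
  - intros w; rewrite indic_false; auto; lra.
  - rewrite (sl_const _ _ _ SL); simpl; lra.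
Qed.

Lemma V_union A B : V (fun w => A w \/ B w) <= V A + V B.
Proof.
  apply Rnot_lt_le; intros hl.
  set (eps := (V (fun w => A w \/ B w) - (V A + V B)) / 2).
  assert (0 < eps) by (unfold eps; lra).
  destruct (V_approx A eps) as (xi & r & hx & hi & hE & hr); auto.
  destruct (V_approx B eps) as (xi' & r' & hx' & hi' & hE' & hr'); auto.
  assert (V (fun w => A w \/ B w) <= r + r'); [|unfold eps in *; lra].
  apply (V_le_E _ (fun w => xi w + xi' w)).
  - apply (sl_add _ _ _ SL); auto.
  - intros w. specialize (hi w); specialize (hi' w).
    assert (h1 := indic_bounds A w); assert (h2 := indic_bounds B w).
    apply indic_le; [lra|]. intros [a|b].
    + rewrite (indic_true A) in hi; auto; lra.
    + rewrite (indic_true B) in hi'; auto; lra.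
  - assert (h := sl_subadd _ _ _ SL xi xi' hx hx').
    rewrite hE, hE' in h. apply h. exact I.
Qed.

(** * Measurable events *)

Lemma F_ext (A B : Omega -> Prop) : (forall w, A w <-> B w) -> F A -> F B.
Proof.
  intros h hA. replace B with A; auto. apply functional_extensionality; intros w.
  apply propositional_extensionality; auto.
Qed.

Lemma F_not A : F A -> F (fun w => ~ A w).
Proof. apply (sl_sigma _ _ _ SL). Qed.

Lemma F_exists (A : nat -> Omega -> Prop) : (forall n, F (A n)) -> F (fun w => exists n, A n w).
Proof. apply (sl_sigma _ _ _ SL). Qed.

Lemma F_forall (A : nat -> Omega -> Prop) : (forall n, F (A n)) -> F (fun w => forall n, A n w).
Proof.
  intros h. apply (F_ext (fun w => ~ exists n, ~ A n w)).
  - intros w; split.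
    + intros hn n. apply NNPP; intros hh; apply hn; exists n; auto.
    + intros hh [n hn]; auto.
  - apply F_not, F_exists. intros n; apply F_not; auto.
Qed.

Lemma F_const (P : Prop) : F (fun _ => P).
Proof.
  destruct (classic P) as [p|p].
  - apply (F_ext (fun _ => True)); [tauto|]. apply (sl_sigma _ _ _ SL).
  - apply (F_ext (fun _ => ~ True)); [tauto|]. apply F_not, (sl_sigma _ _ _ SL).
Qed.

Lemma F_or A B : F A -> F B -> F (fun w => A w \/ B w).
Proof.
  intros hA hB. apply (F_ext (fun w => exists n : nat, match n with O => A w | _ => B w end)).
  - intros w; split.
    + intros [[|n] h]; auto.
    + intros [h|h]; [exists O|exists 1%nat]; auto.
  - apply (F_exists (fun n w => match n with O => A w | _ => B w end)). intros [|n]; auto.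
Qed.

Lemma F_and A B : F A -> F B -> F (fun w => A w /\ B w).
Proof.
  intros hA hB. apply (F_ext (fun w => ~ (~ A w \/ ~ B w))).
  - intros w; split; [intros h|]; [split; apply NNPP|]; tauto.
  - apply F_not, F_or; apply F_not; auto.
Qed.

Lemma F_impl (P : Prop) A : F A -> F (fun w => P -> A w).
Proof.
  intros hA. apply (F_ext (fun w => ~ P \/ A w)).
  - intros w; split; [tauto|]. intros h; destruct (classic P); tauto.
  - apply F_or; auto using F_const.
Qed.

Lemma F_le xi a : H xi -> F (fun w => xi w <= a).
Proof. intros; apply (sl_meas _ _ _ SL); auto. Qed.

Lemma F_gt xi a : H xi -> F (fun w => a < xi w).
Proof.
  intros h. apply (F_ext (fun w => ~ xi w <= a)); [intros; lra|]. apply F_not, F_le; auto.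
Qed.

Lemma F_ge xi a : H xi -> F (fun w => a <= xi w).
Proof.
  intros h. apply (F_ext (fun w => -1 * xi w <= - a)); [intros; lra|]. apply F_le. apply (sl_scal _ _ _ SL); auto.
Qed.

Lemma F_lt xi a : H xi -> F (fun w => xi w < a).
Proof.
  intros h. apply (F_ext (fun w => ~ a <= xi w)); [intros; lra|]. apply F_not, F_ge; auto.
Qed.

(** * Continuity of the capacity, null sets, Borel-Cantelli *)

Context (CV : Vcap_continuous F H E).

(** Continuity is assumed along sets of [F] only, which is why the limiting arguments below carry
    measurability goals. *)
Lemma V_exists_le (A : nat -> Omega -> Prop) c : (forall n, F (A n)) ->
  (forall n w, A n w -> A (S n) w) -> (forall n, V (A n) <= c) -> V (fun w => exists n, A n w) <= c.
Proof.
  intros hF hm hc.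
  assert (h := proj1 CV A (fun w => exists n, A n w) hF (F_exists A hF) hm (fun w => iff_refl _)).
  apply (is_lim_seq_le _ _ _ _ hc h (is_lim_seq_const c)).
Qed.

Lemma V_forall_ge (A : nat -> Omega -> Prop) c : (forall n, F (A n)) ->
  (forall n w, A (S n) w -> A n w) -> (forall n, c <= V (A n)) -> c <= V (fun w => forall n, A n w).
Proof.
  intros hF hm hc.
  assert (h := proj2 CV A (fun w => forall n, A n w) hF (F_forall A hF) hm (fun w => iff_refl _)).
  apply (is_lim_seq_le _ _ _ _ hc (is_lim_seq_const c) h).
Qed.

Lemma V_finite_union_le (A : nat -> Omega -> Prop) a : (forall k, V (A k) <= a k) ->
  forall n, V (fun w => exists k, (k < n)%nat /\ A k w) <= psum a n.
Proof.
  intros ha n. induction n as [|n IH].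
  - rewrite V_empty; simpl; [lra|]. intros w (k & hk & _); lia.
  - simpl. eapply Rle_trans; [|apply Rplus_le_compat; [apply IH|apply (ha n)]].
    eapply Rle_trans; [|apply V_union]. apply V_mono. intros w (k & hk & hA).
    destruct (Nat.eq_dec k n) as [->|]; auto. left; exists k; split; auto; lia.
Qed.

(** Finite sub-additivity passes to the limit along the increasing finite unions; a bound [c] on all
    partial sums replaces an infinite series. *)
Lemma V_countable_union_le (A : nat -> Omega -> Prop) a c : (forall k, F (A k)) -> (forall k, V (A k) <= a k) ->
  (forall n, psum a n <= c) -> V (fun w => exists k, A k w) <= c.
Proof.
  intros hF ha hc.
  eapply Rle_trans; [|apply (V_exists_le (fun n w => exists k, (k < n)%nat /\ A k w) c)].
  - apply V_mono. intros w [k hk]. exists (S k), k; auto.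
  - intros n. apply F_exists. intros k. apply F_and; auto using F_const.
  - intros n w (k & hk & h); exists k; split; auto.
  - intros n; eapply Rle_trans; [apply V_finite_union_le; eauto|auto].
Qed.

(** The exceptional set is covered by a null set of [F], because countable unions are controlled
    only inside [F] and the negation of [P] need not lie there. *)
Definition almost_surely (P : Omega -> Prop) : Prop :=
  exists B, F B /\ (forall w, ~ P w -> B w) /\ V B = 0.

Local Notation as_ := almost_surely.

Lemma as_mono P Q : as_ P -> (forall w, P w -> Q w) -> as_ Q.
Proof. intros (B & hB & hP & hV) h. exists B; repeat split; auto. Qed.

Lemma as_forall (P : nat -> Omega -> Prop) : (forall n, as_ (P n)) -> as_ (fun w => forall n, P n w).
Proof.
  intros h. destruct (ClassicalEpsilon.choice _ h) as [B hB].
  exists (fun w => exists n, B n w). split; [|split].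
  - apply F_exists; apply hB.
  - intros w hn. apply not_all_ex_not in hn. destruct hn as [n hn]. exists n. apply hB; auto.
  - apply Rle_antisym; [|apply V_bounds].
    apply (V_countable_union_le B (fun _ => 0)).
    + apply hB.
    + intros k; right; apply hB.
    + intros n; induction n; simpl; lra.
Qed.

Lemma as_and P Q : as_ P -> as_ Q -> as_ (fun w => P w /\ Q w).
Proof.
  intros hP hQ. apply (as_mono (fun w => forall n : nat, match n with O => P w | _ => Q w end)).
  - apply (as_forall (fun n w => match n with O => P w | _ => Q w end)). intros [|n]; auto.
  - intros w h; split; [apply (h O)|apply (h 1%nat)].
Qed.

Lemma as_lV P : as_ P -> lVcap H E P = 1.
Proof.
  intros (B & _ & hB & hV). unfold lVcap.
  assert (V (fun w => ~ P w) <= 0) by (rewrite <- hV; apply V_mono; auto).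
  assert (h := V_bounds (fun w => ~ P w)). lra.
Qed.

(** The convergent half, which rests on sub-additivity: the upper limit of the events lies in every
    tail union, whose capacity is at most a tail of the series. *)
Lemma borel_cantelli (A : nat -> Omega -> Prop) a C :
  (forall k, F (A k)) -> (forall n, psum a n <= C) -> (forall k, 0 <= a k) ->
  (exists n0, forall k, (n0 <= k)%nat -> V (A k) <= a k) ->
  as_ (fun w => exists n, forall k, (n <= k)%nat -> ~ A k w).
Proof.
  intros hF hC ha [n0 hV].
  exists (fun w => forall n, exists k, A (n + k)%nat w). split; [|split].
  - apply F_forall; intros n; apply F_exists; auto.
  - intros w h n. apply NNPP; intros hn. apply h. exists n. intros k hk hA.
    apply hn. exists (k - n)%nat. replace (n + (k - n))%nat with k by lia; auto.
  - apply Rle_antisym; [|apply V_bounds].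
    apply le_epsilon. intros eps he. rewrite Rplus_0_l.
    destruct (psum_tail a C eps he ha hC) as [N hN].
    set (m := max N n0).
    eapply Rle_trans; [apply (V_mono _ (fun w => exists k, A (m + k)%nat w)); auto|].
    apply (V_countable_union_le (fun k => A (m + k)%nat) (fun k => a (m + k)%nat)); auto.
    + intros k; apply hV; unfold m; lia.
    + intros n. apply hN. unfold m; lia.
Qed.

End Capacity.

(** * Bounded Lipschitz functions of the sequence *)

(** Unlike [normn], the sum distance splits exactly when a coordinate is appended or a block is
    shifted; [l1_le_normn] leads back to [normn]. *)
Definition l1 (n : nat) (x y : nat -> R) : R := psum (fun j => Rabs (x j - y j)) n.

(** The working class of test functions: contained in [lip_poly], bounded so that [E] is finite,
    stable under products and under integrating out the last coordinate. The Lipschitz bound also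
    forces dependence on the first [n] coordinates only ([BL_local]). *)
Definition BL (n : nat) (Phi : (nat -> R) -> R) : Prop :=
  (exists M, forall x, Rabs (Phi x) <= M) /\
  (exists L, 0 <= L /\ forall x y, Rabs (Phi x - Phi y) <= L * l1 n x y).

(** Meant for outer functions such as [exp] or the square, composed with bounded inner functions. *)
Definition loc_lip (h : R -> R) : Prop :=
  forall M, exists L, 0 <= L /\
    forall u v, Rabs u <= M -> Rabs v <= M -> Rabs (h u - h v) <= L * Rabs (u - v).

Lemma l1_nonneg n x y : 0 <= l1 n x y.
Proof. apply psum_nonneg; intros; apply Rabs_pos. Qed.

Lemma l1_mono n m x y : (n <= m)%nat -> l1 n x y <= l1 m x y.
Proof.
  intros h. replace m with (n + (m - n))%nat by lia. unfold l1. rewrite psum_split.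
  assert (0 <= psum (fun k => Rabs (x (n + k)%nat - y (n + k)%nat)) (m - n))
    by (apply psum_nonneg; intros; apply Rabs_pos). lra.
Qed.

Lemma coord_le_l1 n j x y : (j < n)%nat -> Rabs (x j - y j) <= l1 n x y.
Proof.
  intros h. eapply Rle_trans; [|apply (l1_mono (S j) n); lia].
  unfold l1; simpl. assert (h' := l1_nonneg j x y). unfold l1 in h'. lra.
Qed.

Lemma BL_const n c : BL n (fun _ => c).
Proof.
  split; [exists (Rabs c); intros; lra|]. exists 0; split; [lra|].
  intros. rewrite Rminus_diag, Rabs_R0. lra.
Qed.

Lemma BL_weaken n m Phi : (n <= m)%nat -> BL n Phi -> BL m Phi.
Proof.
  intros h [hM (L & hL & h')]. split; auto. exists L; split; auto.
  intros x y. eapply Rle_trans; [apply h'|]. apply Rmult_le_compat_l; auto using l1_mono.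
Qed.

Lemma BL_ext n Phi Psi : (forall x, Phi x = Psi x) -> BL n Phi -> BL n Psi.
Proof. intros h; replace Psi with Phi; auto. apply functional_extensionality; auto. Qed.

Lemma BL_plus n Phi Psi : BL n Phi -> BL n Psi -> BL n (fun x => Phi x + Psi x).
Proof.
  intros [[M hM] (L & hL & h)] [[M' hM'] (L' & hL' & h')]. split.
  - exists (M + M'). intros x. eapply Rle_trans; [apply Rabs_triang|]. apply Rplus_le_compat; auto.
  - exists (L + L'); split; [lra|]. intros x y.
    replace (Phi x + Psi x - (Phi y + Psi y)) with ((Phi x - Phi y) + (Psi x - Psi y)) by ring.
    eapply Rle_trans; [apply Rabs_triang|]. specialize (h x y); specialize (h' x y); lra.
Qed.

Lemma BL_mult n Phi Psi : BL n Phi -> BL n Psi -> BL n (fun x => Phi x * Psi x).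
Proof.
  intros [[M hM] (L & hL & h)] [[M' hM'] (L' & hL' & h')].
  assert (hM0 : forall x, 0 <= Rabs (Phi x) <= M) by (intros; split; auto using Rabs_pos).
  assert (hM0' : forall x, 0 <= Rabs (Psi x) <= M') by (intros; split; auto using Rabs_pos).
  assert (0 <= M) by (specialize (hM0 (fun _ => 0)); lra).
  assert (0 <= M') by (specialize (hM0' (fun _ => 0)); lra).
  split.
  - exists (M * M'). intros x. rewrite Rabs_mult. apply Rmult_le_compat; apply hM0 || apply hM0'.
  - exists (M * L' + M' * L); split; [nra|]. intros x y.
    replace (Phi x * Psi x - Phi y * Psi y) with (Phi x * (Psi x - Psi y) + Psi y * (Phi x - Phi y)) by ring.
    eapply Rle_trans; [apply Rabs_triang|]. rewrite !Rabs_mult.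
    rewrite Rmult_plus_distr_r, !Rmult_assoc.
    apply Rplus_le_compat; apply Rmult_le_compat; auto using Rabs_pos.
Qed.

Lemma BL_scal n c Phi : BL n Phi -> BL n (fun x => c * Phi x).
Proof. intros; apply BL_mult; auto using BL_const. Qed.

Lemma BL_opp n Phi : BL n Phi -> BL n (fun x => - Phi x).
Proof. intros h. apply (BL_ext n (fun x => -1 * Phi x)); [intros; ring|]. apply BL_scal; auto. Qed.

Lemma BL_minus n Phi Psi : BL n Phi -> BL n Psi -> BL n (fun x => Phi x - Psi x).
Proof. intros; apply BL_plus; auto using BL_opp. Qed.

Lemma BL_comp n h Phi : loc_lip h -> BL n Phi -> BL n (fun x => h (Phi x)).
Proof.
  intros hh [[M hM] (L & hL & hP)]. destruct (hh M) as (K & hK & hh').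
  assert (0 <= M) by (eapply Rle_trans; [apply Rabs_pos|apply (hM (fun _ => 0))]).
  split.
  - exists (Rabs (h 0) + K * M). intros x.
    replace (h (Phi x)) with (h 0 + (h (Phi x) - h 0)) by ring.
    eapply Rle_trans; [apply Rabs_triang|]. apply Rplus_le_compat_l.
    eapply Rle_trans; [apply hh'; auto; rewrite Rabs_R0; auto|].
    rewrite Rminus_0_r. apply Rmult_le_compat_l; auto.
  - exists (K * L); split; [nra|]. intros x y.
    eapply Rle_trans; [apply hh'; auto|]. rewrite Rmult_assoc. apply Rmult_le_compat_l; auto.
Qed.

Lemma loc_lip_max c : loc_lip (fun u => Rmax u c).
Proof.
  intros M; exists 1; split; [lra|]. intros u v _ _. rewrite Rmult_1_l.
  unfold Rmax; repeat destruct Rle_dec; unfold Rabs; repeat destruct Rcase_abs; lra.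
Qed.

Lemma loc_lip_min c : loc_lip (fun u => Rmin u c).
Proof.
  intros M; exists 1; split; [lra|]. intros u v _ _. rewrite Rmult_1_l.
  unfold Rmin; repeat destruct Rle_dec; unfold Rabs; repeat destruct Rcase_abs; lra.
Qed.

Lemma lip_of_derive (f df : R -> R) L : (forall x, is_derive f x (df x)) -> (forall x, Rabs (df x) <= L) ->
  forall x y, Rabs (f x - f y) <= L * Rabs (x - y).
Proof.
  intros hd hL x y.
  destruct (MVT_gen f y x df) as (c & hc & e).
  - intros; apply hd.
  - intros z hz. apply continuity_pt_filterlim. apply (ex_derive_continuous f z). eexists; apply hd.
  - rewrite e, Rabs_mult. apply Rmult_le_compat_r; auto using Rabs_pos.
Qed.

Lemma loc_lip_exp : loc_lip exp.
Proof.
  intros M; exists (exp M); split; [left; apply exp_pos|]. intros u v hu hv.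
  destruct (MVT_gen exp v u exp) as (c & hc & e).
  - intros; apply is_derive_exp.
  - intros z hz. apply derivable_continuous_pt, derivable_pt_exp.
  - rewrite e, Rabs_mult. apply Rmult_le_compat_r; auto using Rabs_pos.
    rewrite Rabs_right; [|left; apply exp_pos].
    apply Rabs_le_between in hu; apply Rabs_le_between in hv.
    assert (c <= M) by (eapply Rle_trans; [apply hc|]; apply Rmax_lub; lra).
    destruct (Req_dec c M); [subst; lra|]. left; apply exp_increasing; lra.
Qed.

Lemma bdd_lip1_BL f : bdd_lip1 f <-> BL 1 (fun x => f (x O)).
Proof.
  unfold BL, l1; simpl. split.
  - intros [[M hM] [L hL]]. split; [exists M; auto|].
    exists (Rabs L); split; [apply Rabs_pos|]. intros x y. rewrite Rplus_0_l.
    eapply Rle_trans; [apply hL|]. apply Rmult_le_compat_r; [apply Rabs_pos|apply Rle_abs].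
  - intros [[M hM] (L & _ & hL)]. split.
    + exists M; intros x. apply (hM (fun _ => x)).
    + exists L; intros x y. specialize (hL (fun _ => x) (fun _ => y)). simpl in hL. rewrite Rplus_0_l in hL; auto.
Qed.

Lemma BL_coord f n j : bdd_lip1 f -> (j < n)%nat -> BL n (fun x => f (x j)).
Proof.
  intros [[M hM] [L hL]] hj. split; [exists M; auto|].
  exists (Rabs L); split; [apply Rabs_pos|]. intros x y.
  eapply Rle_trans; [apply hL|].
  eapply Rle_trans; [apply Rmult_le_compat_r; [apply Rabs_pos|apply Rle_abs]|].
  apply Rmult_le_compat_l; [apply Rabs_pos|]. apply coord_le_l1; auto.
Qed.

Lemma psum_abs_diff x y n : Rabs (psum x n - psum y n) <= l1 n x y.
Proof.
  induction n; unfold l1 in *; simpl.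
  - rewrite Rminus_diag, Rabs_R0; lra.
  - replace (psum x n + x n - (psum y n + y n)) with ((psum x n - psum y n) + (x n - y n)) by ring.
    eapply Rle_trans; [apply Rabs_triang|]. lra.
Qed.

Lemma BL_psum f n : bdd_lip1 f -> BL n (fun x => f (psum x n)).
Proof.
  intros [[M hM] [L hL]]. split; [exists M; auto|].
  exists (Rabs L); split; [apply Rabs_pos|]. intros x y.
  eapply Rle_trans; [apply hL|].
  eapply Rle_trans; [apply Rmult_le_compat_r; [apply Rabs_pos|apply Rle_abs]|].
  apply Rmult_le_compat_l; [apply Rabs_pos|]. apply psum_abs_diff.
Qed.

Definition shift (n : nat) (x : nat -> R) : nat -> R := fun j => x (n + j)%nat.

Lemma BL_shift n N Gam : BL N Gam -> BL (n + N) (fun x => Gam (shift n x)).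
Proof.
  intros [[M hM] (L & hL & h)]. split; [exists M; auto|].
  exists L; split; auto. intros x y. eapply Rle_trans; [apply h|].
  apply Rmult_le_compat_l; auto. unfold l1 at 2. rewrite psum_split.
  assert (h' := l1_nonneg n x y). unfold l1 in h'. unfold l1, shift. lra.
Qed.

(** Every coordinate from [n] on is filled with [y]: this is literally the shape of the argument of
    [phi] in [indep_next]. *)
Definition ext (n : nat) (x : nat -> R) (y : R) : nat -> R := fun j => if (j <? n)%nat then x j else y.

Lemma ext_lt n x y j : (j < n)%nat -> ext n x y j = x j.
Proof. intros h; unfold ext. apply Nat.ltb_lt in h; rewrite h; auto. Qed.

Lemma ext_eq n x y : ext n x y n = y.
Proof. unfold ext. rewrite Nat.ltb_irrefl; auto. Qed.

Lemma l1_ext n x x' y y' : l1 (S n) (ext n x y) (ext n x' y') = l1 n x x' + Rabs (y - y').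
Proof.
  unfold l1; simpl. rewrite !ext_eq. f_equal. apply psum_ext. intros j hj. rewrite !ext_lt; auto.
Qed.

Lemma l1_refl n x : l1 n x x = 0.
Proof. induction n; unfold l1 in *; simpl; auto. rewrite IHn, Rminus_diag, Rabs_R0; lra. Qed.

Lemma BL_section n Phi x : BL (S n) Phi -> bdd_lip1 (fun y => Phi (ext n x y)).
Proof.
  intros [[M hM] (L & hL & h)]. split; [exists M; auto|].
  exists L. intros y y'. eapply Rle_trans; [apply h|]. rewrite l1_ext, l1_refl. lra.
Qed.

Lemma BL_local n Phi x y : BL n Phi -> (forall j, (j < n)%nat -> x j = y j) -> Phi x = Phi y.
Proof.
  intros [_ (L & hL & h)] e. specialize (h x y).
  replace (l1 n x y) with 0 in h.
  - rewrite Rmult_0_r in h. assert (h' := Rabs_pos (Phi x - Phi y)).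
    apply Rminus_diag_uniq, NNPP. intros hn. apply Rabs_no_R0 in hn. lra.
  - symmetry. rewrite <- (l1_refl n x). apply psum_ext. intros; rewrite e; auto.
Qed.

Lemma sumsq_nonneg n v : 0 <= sumsq n v.
Proof. induction n; simpl; [lra|]. nra. Qed.

Lemma coord_le_normn n j v : (j < n)%nat -> Rabs (v j) <= normn n v.
Proof.
  intros h. unfold normn. rewrite <- sqrt_Rsqr_abs. apply sqrt_le_1_alt. unfold Rsqr.
  induction n; [lia|]. simpl. destruct (Nat.eq_dec j n) as [->|].
  - assert (h' := sumsq_nonneg n v). lra.
  - assert (v j * v j <= sumsq n v) by (apply IHn; lia). nra.
Qed.

Lemma l1_le_normn n x y : l1 n x y <= INR n * normn n (vsub x y).
Proof.
  assert (h : forall m, (m <= n)%nat -> l1 m x y <= INR m * normn n (vsub x y)).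
  { induction m; intros hm; unfold l1; simpl psum.
    - simpl; lra.
    - rewrite S_INR. unfold l1 in IHm.
      assert (h := coord_le_normn n m (vsub x y) hm). unfold vsub at 1 in h.
      specialize (IHm ltac:(lia)). lra. }
  apply h; auto.
Qed.

Lemma BL_lip_poly n Phi : BL n Phi -> lip_poly n Phi.
Proof.
  intros [_ (L & hL & h)]. exists (L * INR n), O. intros x y.
  eapply Rle_trans; [apply h|]. simpl.
  assert (h1 := l1_le_normn n x y). assert (h2 := l1_nonneg n x y).
  assert (L * l1 n x y <= L * (INR n * normn n (vsub x y))) by (apply Rmult_le_compat_l; auto).
  assert (0 <= L * (INR n * normn n (vsub x y))) by (apply Rmult_le_pos; lra).
  lra.
Qed.

Lemma bdd_lip1_poly f : bdd_lip1 f -> lip_poly1 f.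
Proof.
  intros [_ [L h]]. exists (Rabs L), O. intros x y.
  eapply Rle_trans; [apply h|]. simpl.
  assert (h1 := Rabs_pos L). assert (h2 := Rabs_pos (x - y)). assert (h3 := Rle_abs L).
  nra.
Qed.

Record setting {Omega : Type} (F : (Omega -> Prop) -> Prop)
    (H : (Omega -> R) -> Prop) (E : (Omega -> R) -> Rbar)
    (X0 : Omega -> R) (X : nat -> Omega -> R) : Prop := {
  set_sl : sublinear_space F H E;
  set_H0 : H X0;
  set_H : forall n, H (X n);
  set_indep : indep_seq E X;
  set_dist : forall n, same_dist E (X n) X0;
  set_cont : Vcap_continuous F H E
}.

Section Functionals.
Context {Omega : Type} {F : (Omega -> Prop) -> Prop}
  {H : (Omega -> R) -> Prop} {E : (Omega -> R) -> Rbar}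
  {X0 : Omega -> R} {X : nat -> Omega -> R} (ST : setting F H E X0 X).

Definition Xp (w : Omega) : nat -> R := fun j => X j w.
Definition Eseq (Phi : (nat -> R) -> R) : R := real (E (fun w => Phi (Xp w))).
Definition Eone (f : R -> R) : R := real (E (fun w => f (X0 w))).
Local Notation EE := Eseq.
Local Notation E0 := Eone.

Lemma H_BL n Phi : BL n Phi -> H (fun w => Phi (Xp w)).
Proof.
  intros h. apply (sl_closed_lip _ _ _ (set_sl _ _ _ _ _ ST) n Phi X); auto using BL_lip_poly.
  intros; apply (set_H _ _ _ _ _ ST).
Qed.

Lemma H_bl f : bdd_lip1 f -> H (fun w => f (X0 w)).
Proof.
  intros h. apply (sl_closed_lip _ _ _ (set_sl _ _ _ _ _ ST) 1 (fun x => f (x O)) (fun _ => X0)).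
  - intros; apply (set_H0 _ _ _ _ _ ST).
  - apply BL_lip_poly, bdd_lip1_BL; auto.
Qed.

Lemma bd_BL n Phi : BL n Phi -> bounded_fun (fun w => Phi (Xp w)).
Proof. intros [[M hM] _]; exists M; auto. Qed.

Lemma bd_bl f : bdd_lip1 f -> bounded_fun (fun w => f (X0 w)).
Proof. intros [[M hM] _]; exists M; auto. Qed.

Hint Resolve H_BL H_bl bd_BL bd_bl : bl.
Let SL := set_sl _ _ _ _ _ ST.

Lemma E0_mono f g : bdd_lip1 f -> bdd_lip1 g -> (forall y, f y <= g y) -> E0 f <= E0 g.
Proof. intros hf hg h. apply (er_mono SL); eauto with bl. Qed.

Lemma E0_const c : E0 (fun _ => c) = c.
Proof. unfold Eone. rewrite (sl_const _ _ _ SL); auto. Qed.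

Lemma E0_subadd f g : bdd_lip1 f -> bdd_lip1 g -> E0 (fun y => f y + g y) <= E0 f + E0 g.
Proof. intros hf hg. apply (er_subadd SL); eauto with bl. Qed.

Lemma E0_scal c f : bdd_lip1 f -> 0 <= c -> E0 (fun y => c * f y) = c * E0 f.
Proof. intros hf hc. apply (er_scal SL c (fun w => f (X0 w))); eauto with bl. Qed.

Lemma EE_mono n m Phi Psi : BL n Phi -> BL m Psi -> (forall x, Phi x <= Psi x) -> EE Phi <= EE Psi.
Proof. intros hf hg h. apply (er_mono SL); eauto with bl. Qed.

Lemma EE_const c : EE (fun _ => c) = c.
Proof. unfold Eseq. rewrite (sl_const _ _ _ SL); auto. Qed.

Lemma EE_subadd n Phi Psi : BL n Phi -> BL n Psi -> EE (fun x => Phi x + Psi x) <= EE Phi + EE Psi.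
Proof. intros hf hg. apply (er_subadd SL); eauto with bl. Qed.

Lemma EE_scal n c Phi : BL n Phi -> 0 <= c -> EE (fun x => c * Phi x) = c * EE Phi.
Proof. intros hf hc. apply (er_scal SL c (fun w => Phi (Xp w))); eauto with bl. Qed.

Lemma bl_const c : bdd_lip1 (fun _ => c).
Proof. apply bdd_lip1_BL. apply BL_const. Qed.

Lemma bl_plus f g : bdd_lip1 f -> bdd_lip1 g -> bdd_lip1 (fun y => f y + g y).
Proof. rewrite !bdd_lip1_BL. intros; apply BL_plus; auto. Qed.

Lemma bl_opp f : bdd_lip1 f -> bdd_lip1 (fun y => - f y).
Proof. rewrite !bdd_lip1_BL. intros; apply BL_opp; auto. Qed.

Lemma bl_mult f g : bdd_lip1 f -> bdd_lip1 g -> bdd_lip1 (fun y => f y * g y).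
Proof. rewrite !bdd_lip1_BL. intros; apply BL_mult; auto. Qed.

Lemma bl_comp h f : loc_lip h -> bdd_lip1 f -> bdd_lip1 (fun y => h (f y)).
Proof. rewrite !bdd_lip1_BL. intros; apply (BL_comp 1 h); auto. Qed.

Lemma E0_close f g d : bdd_lip1 f -> bdd_lip1 g -> (forall y, Rabs (f y - g y) <= d) -> Rabs (E0 f - E0 g) <= d.
Proof.
  assert (K : forall f g, bdd_lip1 f -> bdd_lip1 g -> (forall y, Rabs (f y - g y) <= d) -> E0 f <= E0 g + d).
  { clear f g; intros f g hf hg h.
    eapply Rle_trans; [apply (E0_mono f (fun y => g y + d))|]; auto using bl_plus, bl_const.
    - intros y. specialize (h y). apply Rabs_le_between in h; lra.
    - eapply Rle_trans; [apply (E0_subadd g (fun _ => d))|]; auto using bl_const. rewrite E0_const; lra. }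
  intros hf hg h. apply Rabs_le. split.
  - assert (E0 g <= E0 f + d); [|lra]. apply K; auto. intros; rewrite Rabs_minus_sym; auto.
  - assert (E0 f <= E0 g + d); [|lra]. apply K; auto.
Qed.

(** The bound and the Lipschitz constant both survive the integration, so [EE_step] can be
    iterated. *)
Lemma BL_integrate n Phi : BL (S n) Phi -> BL n (fun x => E0 (fun y => Phi (ext n x y))).
Proof.
  intros h. assert (h' := h). destruct h' as [[M hM] (L & hL & hl)]. split.
  - exists M. intros x. unfold Eone.
    apply (E_finite SL (fun w => Phi (ext n x (X0 w)))); auto.
    apply (H_bl (fun y => Phi (ext n x y))). apply BL_section; auto.
  - exists L; split; auto. intros x x'.
    apply E0_close; try apply BL_section; auto.
    intros y. eapply Rle_trans; [apply hl|]. rewrite l1_ext, Rminus_diag, Rabs_R0, Rplus_0_r. lra.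
Qed.

Lemma E_coord f i : bdd_lip1 f -> E (fun w => f (X i w)) = Finite (E0 f).
Proof.
  intros h. rewrite (set_dist _ _ _ _ _ ST i f) by (apply bdd_lip1_poly; auto).
  apply (E_finite' SL); eauto with bl.
Qed.

(** Independence freezes the first [n] variables, and equality in law replaces the next one by [X0].
    The case [n = 0] is separate because [indep_seq] starts at index 1. *)
Lemma EE_step n Phi : BL (S n) Phi -> EE Phi = EE (fun x => E0 (fun y => Phi (ext n x y))).
Proof.
  intros h. destruct n as [|n].
  - replace (fun x => E0 (fun y => Phi (ext 0 x y))) with (fun _ : nat -> R => E0 (fun y => Phi (fun _ => y))).
    + rewrite EE_const. unfold Eseq.
      replace (fun w => Phi (Xp w)) with (fun w => (fun y => Phi (fun _ => y)) (X O w)).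
      * rewrite (E_coord (fun y => Phi (fun _ => y))); auto. apply (BL_section 0 Phi (fun _ => 0)); auto.
      * apply functional_extensionality; intros w. apply (BL_local 1); auto.
        intros j hj. replace j with O by lia; auto.
    + apply functional_extensionality; intros x. f_equal.
  - assert (hi := set_indep _ _ _ _ _ ST (S n) ltac:(lia) Phi (BL_lip_poly _ _ h)). cbv zeta in hi.
    assert (he : forall x, E (fun w' => Phi (fun j => if (j <? S n)%nat then x j else X (S n) w'))
      = Finite (E0 (fun y => Phi (ext (S n) x y)))).
    { intros x. apply (E_coord (fun y => Phi (ext (S n) x y))). apply BL_section; auto. }
    unfold Eseq, Xp. rewrite hi; [|intros x; rewrite he; reflexivity].
    do 2 f_equal. apply functional_extensionality; intros w. rewrite he; reflexivity.
Qed.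

(** Induction on the length of the second block: [EE_step] peels off its last variable, and
    nonnegativity of [Phi] lets it pass through [E0] by positive homogeneity. The constant [EE Gam]
    stays inside because it may be negative, and a negative factor cannot be pulled out of a
    sub-linear expectation. *)
Lemma EE_product N : forall n Phi Gam, BL n Phi -> (forall x, 0 <= Phi x) -> BL N Gam ->
  EE (fun x => Phi x * Gam (shift n x)) = EE (fun x => Phi x * EE Gam).
Proof.
  induction N as [|N IH]; intros n Phi Gam hP hP0 hG.
  - f_equal. apply functional_extensionality; intros x. f_equal.
    rewrite <- (EE_const (Gam (shift n x))). f_equal. apply functional_extensionality; intros y.
    apply (BL_local 0); auto. intros; lia.
  - rewrite (EE_step N Gam) by auto. rewrite <- (IH n Phi (fun x => E0 (fun y => Gam (ext N x y)))) by auto using BL_integrate.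
    rewrite (EE_step (n + N)).
    + f_equal. apply functional_extensionality; intros x.
      rewrite <- (E0_scal (Phi x) (fun y => Gam (ext N (shift n x) y))) by (auto; apply BL_section; auto). f_equal.
      apply functional_extensionality; intros y. f_equal.
      * apply (BL_local n); auto. intros; apply ext_lt; lia.
      * apply (BL_local (S N)); auto. intros j hj. unfold shift.
        destruct (Nat.eq_dec j N) as [->|]; [rewrite !ext_eq; auto|].
        rewrite !ext_lt by lia; auto.
    + rewrite plus_n_Sm. apply BL_mult; [apply (BL_weaken n); auto; lia|apply BL_shift; auto].
Qed.

(** Factor [k] reads the sequence from coordinate [st k] on, and is meant to stop before
    [st (S k)]. *)
Fixpoint blockprod (st : nat -> nat) (h : nat -> (nat -> R) -> R) (k : nat) (x : nat -> R) : R :=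
  match k with O => 1 | S k => blockprod st h k x * h k (shift (st k) x) end.

Fixpoint rprod (a : nat -> R) (k : nat) : R := match k with O => 1 | S k => rprod a k * a k end.

Lemma BL_blockprod st h k : (forall i, (st i <= st (S i))%nat) -> 
  (forall i, BL (st (S i) - st i) (h i)) -> BL (st k) (blockprod st h k).
Proof.
  intros hs hb. induction k; simpl; [apply BL_const|].
  apply BL_mult; [apply (BL_weaken (st k)); auto|].
  replace (st (S k)) with (st k + (st (S k) - st k))%nat by (specialize (hs k); lia).
  apply BL_shift; auto.
Qed.

Lemma blockprod_nonneg st h k x : (forall i y, 0 <= h i y) -> 0 <= blockprod st h k x.
Proof. intros h0. induction k; simpl; [lra|]. apply Rmult_le_pos; auto. Qed.

Lemma EE_blockprod st h k : (forall i, (st i <= st (S i))%nat) -> 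
  (forall i, BL (st (S i) - st i) (h i)) -> (forall i y, 0 <= h i y) ->
  EE (blockprod st h k) = rprod (fun i => EE (h i)) k.
Proof.
  intros hs hb h0. induction k; simpl; [apply EE_const|].
  rewrite (EE_product (st (S k) - st k)); auto using BL_blockprod, blockprod_nonneg.
  rewrite <- IHk.
  replace (fun x => blockprod st h k x * EE (h k)) with (fun x => EE (h k) * blockprod st h k x)
    by (apply functional_extensionality; intros; ring).
  rewrite (EE_scal (st k)); auto using BL_blockprod; [ring|].
  rewrite <- (EE_const 0). apply (EE_mono 0 (st (S k) - st k)); auto using BL_const.
Qed.

Local Notation V := (Vcap H E).

Lemma V_le_EE n A Phi : BL n Phi -> (forall w, 0 <= Phi (Xp w)) -> (forall w, A w -> 1 <= Phi (Xp w)) -> V A <= EE Phi.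
Proof.
  intros h h0 h1. apply (V_le_E SL A (fun w => Phi (Xp w))); eauto with bl.
  - intros w; apply indic_le; auto.
  - rewrite (E_finite' SL (fun w => Phi (Xp w))); eauto with bl. apply Rle_refl.
Qed.

Lemma EE_le_V n A Phi : BL n Phi -> (forall w, Phi (Xp w) <= 1) -> (forall w, ~ A w -> Phi (Xp w) <= 0) -> EE Phi <= V A.
Proof.
  intros h h0 h1. apply (le_V SL). intros xi hx hi.
  assert (h2 := sl_mono _ _ _ SL (fun w => Phi (Xp w)) xi (H_BL n Phi h) hx).
  rewrite (E_finite' SL (fun w => Phi (Xp w))) in h2; eauto with bl. apply h2.
  intros w. eapply Rle_trans; [|apply hi]. apply le_indic; auto.
Qed.

End Functionals.

(** * Linearity of the expectation *)

Lemma rprod_nonneg a K : (forall k, 0 <= a k) -> 0 <= rprod a K.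
Proof. intros h. induction K; simpl; [lra|apply Rmult_le_pos; auto]. Qed.

(** The Weierstrass product inequality for the factors [1 - e k], followed by monotonicity. *)
Lemma rprod_ge a e K : (forall k, 0 <= e k <= 1) -> (forall k, 1 - e k <= a k) -> 1 - psum e K <= rprod a K.
Proof.
  intros he ha.
  assert (h : 1 - psum e K <= rprod (fun k => 1 - e k) K).
  { induction K; simpl; [lra|].
    assert (h1 : rprod (fun k => 1 - e k) K <= 1).
    { clear - he. induction K; simpl; [lra|]. specialize (he K) as hK.
      assert (0 <= rprod (fun k => 1 - e k) K) by (apply rprod_nonneg; intros k; specialize (he k); lra). nra. }
    specialize (he K); nra. }
  eapply Rle_trans; [apply h|]. clear h. induction K; simpl; [lra|].
  apply Rmult_le_compat; auto.
  - apply rprod_nonneg. intros k; specialize (he k); lra.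
  - specialize (he K); lra.
Qed.

Lemma exp_le_quadratic y : y <= / 2 -> exp y <= 1 + y + 2 * y ^ 2.
Proof.
  intros h. assert (h1 := exp_ineq1_le (- y)).
  assert (h2 : exp y * exp (- y) = 1) by (rewrite <- exp_plus, Rplus_opp_r, exp_0; auto).
  assert (h3 := exp_pos y).
  assert (exp y * (1 + - y) <= 1) by (rewrite <- h2; apply Rmult_le_compat_l; lra).
  (* The product equals [1 + y^2 (1 - 2 y)], whence the threshold 1/2 on [y]. *)
  assert (1 <= (1 + y + 2 * y ^ 2) * (1 - y)) by nra.
  apply Rmult_le_reg_r with (1 - y); lra.
Qed.

Definition prodn (f : R -> R) (n : nat) (x : nat -> R) : R := rprod (fun j => f (x j)) n.

Lemma BL_prodn f n : bdd_lip1 f -> BL n (prodn f n).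
Proof.
  intros hf. induction n; unfold prodn in *; simpl; [apply BL_const|].
  apply BL_mult; [apply (BL_weaken n); auto|apply BL_coord; auto].
Qed.

Lemma prodn_nonneg f n x : (forall y, 0 <= f y) -> 0 <= prodn f n x.
Proof. intros; apply rprod_nonneg; auto. Qed.

Section Linear.
Context {Omega : Type} {F : (Omega -> Prop) -> Prop}
  {H : (Omega -> R) -> Prop} {E : (Omega -> R) -> Rbar}
  {X0 : Omega -> R} {X : nat -> Omega -> R} (ST : setting F H E X0 X).
Local Notation V := (Vcap H E).
Local Notation EE := (Eseq (E:=E) (X:=X)).
Local Notation E0 := (Eone (E:=E) (X0:=X0)).
Let SL := set_sl _ _ _ _ _ ST.
Let CV := set_cont _ _ _ _ _ ST.

Lemma EE_coord f : bdd_lip1 f -> EE (fun x => f (x O)) = E0 f.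
Proof. intros h. unfold Eseq, Xp. rewrite (E_coord ST f O h). reflexivity. Qed.

Lemma E0_nonneg f : bdd_lip1 f -> (forall y, 0 <= f y) -> 0 <= E0 f.
Proof. intros hf h. rewrite <- (E0_const ST 0). apply (E0_mono ST); auto using bl_const. Qed.

Lemma E0_translate f c : bdd_lip1 f -> E0 (fun y => f y + c) = E0 f + c.
Proof.
  intros hf. apply Rle_antisym.
  - eapply Rle_trans; [apply (E0_subadd ST f (fun _ => c)); auto using bl_const|]. rewrite (E0_const ST); lra.
  - assert (h := E0_subadd ST (fun y => f y + c) (fun _ => - c)). rewrite (E0_const ST) in h.
    assert (e : E0 f = E0 (fun y => f y + c + - c)) by (f_equal; apply functional_extensionality; intros; ring).
    rewrite e. specialize (h ltac:(auto using bl_plus, bl_const) ltac:(apply bl_const)). lra.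
Qed.

(** The lower mean, conjugate to [E0]. Linearity amounts to its agreement with [E0]. *)
Definition E0low (f : R -> R) : R := - E0 (fun y => - f y).

Lemma E0low_nonneg f : bdd_lip1 f -> (forall y, 0 <= f y) -> 0 <= E0low f.
Proof.
  intros hf h. unfold E0low. assert (E0 (fun y => - f y) <= 0); [|lra].
  apply Rle_trans with (E0 (fun _ => 0)); [|rewrite (E0_const ST); lra]. apply (E0_mono ST); auto using bl_const, bl_opp. intros y; specialize (h y); lra.
Qed.

Lemma EE_prodn f n : bdd_lip1 f -> (forall y, 0 <= f y) -> EE (prodn f n) = E0 f ^ n.
Proof.
  intros hf h. induction n.
  - unfold prodn; simpl. apply (EE_const ST).
  - assert (e := EE_product ST 1 n (prodn f n) (fun x => f (x O)) (BL_prodn f n hf) (fun x => prodn_nonneg f n x h)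
      (proj1 (bdd_lip1_BL f) hf)).
    rewrite EE_coord in e by auto.
    replace (prodn f (S n)) with (fun x => prodn f n x * f (shift n x O)).
    2:{ apply functional_extensionality; intros x. unfold prodn, shift; simpl. rewrite Nat.add_0_r; auto. }
    rewrite e. replace (fun x => prodn f n x * E0 f) with (fun x => E0 f * prodn f n x)
      by (apply functional_extensionality; intros; ring).
    rewrite (EE_scal ST n); auto using BL_prodn, E0_nonneg. rewrite IHn. simpl; ring.
Qed.

(** For nonnegative [f] the lower mean is multiplicative as well: [EE_product] is applied with the
    sign attached to the last variable only. *)
Lemma EE_opp_prodn f n : bdd_lip1 f -> (forall y, 0 <= f y) -> EE (fun x => - prodn f n x) = - E0low f ^ n.
Proof.
  intros hf h. induction n.
  - unfold prodn; simpl. apply (EE_const ST (- (1))).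
  - assert (e := EE_product ST 1 n (prodn f n) (fun x => - f (x O)) (BL_prodn f n hf) (fun x => prodn_nonneg f n x h)
      (BL_opp 1 _ (proj1 (bdd_lip1_BL f) hf))).
    rewrite (EE_coord (fun y => - f y)) in e by auto using bl_opp.
    replace (fun x => - prodn f (S n) x) with (fun x => prodn f n x * - f (shift n x O)).
    2:{ apply functional_extensionality; intros x. unfold prodn, shift; simpl. rewrite Nat.add_0_r; ring. }
    rewrite e. replace (fun x => prodn f n x * E0 (fun y => - f y)) with (fun x => E0low f * - prodn f n x)
      by (apply functional_extensionality; intros; unfold E0low; ring).
    rewrite (EE_scal ST n); auto using BL_prodn, E0low_nonneg, BL_opp. rewrite IHn. simpl; ring.
Qed.

Lemma tilt_bl f c l : bdd_lip1 f -> bdd_lip1 (fun y => exp (l * (f y - c))).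
Proof.
  intros hf. apply (bl_comp exp (fun y => l * (f y - c))); [apply loc_lip_exp|].
  apply bl_mult; [apply bl_const|]. apply bl_plus; auto. apply bl_const.
Qed.

(** The Chernoff argument for the lower mean: to first order the tilted mean is at most
    [1 + l (E0low f - c)], which is below 1 for small [l]. Its powers tend to 0, which replaces a
    law of large numbers for block averages. *)
Lemma tilt_lt_1 f c : bdd_lip1 f -> E0low f < c ->
  exists l0, 0 < l0 /\ forall l, 0 < l <= l0 -> E0low (fun y => exp (l * (f y - c))) < 1.
Proof.
  intros hf hc. assert (hf' := hf). destruct hf' as [[M hM] _].
  set (K := M + Rabs c + 1). set (d := c - E0low f).
  assert (hK : forall y, Rabs (f y - c) <= K).
  { intros y. unfold K. specialize (hM y). unfold Rminus. eapply Rle_trans; [apply Rabs_triang|].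
    rewrite Rabs_Ropp. lra. }
  assert (1 <= K) by (assert (h := Rabs_pos c); assert (h' := Rabs_pos (f 0)); specialize (hM 0); unfold K; lra).
  assert (hd : 0 < d) by (unfold d; lra).
  assert (0 < / (2 * K)) by (apply Rinv_0_lt_compat; lra).
  assert (0 < d / (4 * K ^ 2)) by (apply Rdiv_lt_0_compat; nra).
  (* The first bound keeps the exponent in the range of [exp_le_quadratic]; the second makes the
     quadratic error [2 (l K)^2] at most half of the gain [l d]. *)
  exists (Rmin (/ (2 * K)) (d / (4 * K ^ 2))). split; [apply Rmin_glb_lt; auto|].
  intros l [hl hl'].
  assert (h1 : l * K <= / 2).
  { apply Rle_trans with (/ (2 * K) * K); [apply Rmult_le_compat_r; [lra|]; eapply Rle_trans; [apply hl'|apply Rmin_l]|].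
    right; field; lra. }
  assert (h2 : l * (4 * K ^ 2) <= d).
  { apply Rle_trans with (d / (4 * K ^ 2) * (4 * K ^ 2)); [apply Rmult_le_compat_r; [nra|];
      eapply Rle_trans; [apply hl'|apply Rmin_r]|].
    right; field; lra. }
  assert (h3 : E0 (fun y => l * (- f y) + (l * c - 1 - 2 * (l * K) ^ 2)) <= E0 (fun y => - exp (l * (f y - c)))).
  { apply (E0_mono ST).
    - apply bl_plus; [|apply bl_const]. apply bl_mult; [apply bl_const|]. apply bl_opp; auto.
    - apply bl_opp, tilt_bl; auto.
    - intros y. specialize (hK y). apply Rabs_le_between in hK.
      assert (l * (f y - c) <= l * K) by (apply Rmult_le_compat_l; lra).
      assert (- (l * K) <= l * (f y - c)) by nra.
      assert (h4 := exp_le_quadratic (l * (f y - c)) ltac:(lra)).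
      assert ((l * (f y - c)) ^ 2 <= (l * K) ^ 2) by nra. lra. }
  rewrite E0_translate in h3 by (apply bl_mult; [apply bl_const|]; apply bl_opp; auto).
  rewrite (E0_scal ST l (fun y => - f y)) in h3 by (try apply bl_opp; auto; lra).
  unfold E0low. unfold d, E0low in *. nra.
Qed.

(** Block [k] starts at [tri k] and has length [k], which makes the failure bounds [r ^ k]
    summable. *)
Fixpoint tri (k : nat) : nat := match k with O => O | S k => (tri k + k)%nat end.

Lemma blockprod_zero st h K k x : (k < K)%nat -> h k (shift (st k) x) = 0 -> blockprod st h K x = 0.
Proof.
  intros hk h0. induction K; [lia|]. simpl. destruct (Nat.eq_dec k K) as [->|].
  - rewrite h0; ring.
  - rewrite IHK by lia. ring.
Qed.

Lemma blockprod_le1 st h K x : (forall k y, 0 <= h k y <= 1) -> blockprod st h K x <= 1.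
Proof.
  intros hh. induction K; simpl; [lra|].
  assert (h0 : 0 <= blockprod st h K x) by (apply blockprod_nonneg; intros; apply hh).
  specialize (hh K (shift (st K) x)). nra.
Qed.

(** For nonnegative [p] this lies between 0 and 1 and vanishes unless the product over the block is
    below 1: a Lipschitz minorant of the indicator of that event. *)
Let hit (p : R -> R) (k : nat) (x : nat -> R) : R := Rmax (1 - prodn p k x) 0.

Lemma BL_hit p k : bdd_lip1 p -> BL k (hit p k).
Proof.
  intros hp. unfold hit. apply (BL_comp k (fun u => Rmax u 0)); [apply loc_lip_max|].
  apply BL_minus; [apply BL_const|apply BL_prodn; auto].
Qed.

(** The upper mean of [1 - prodn p k] is at least 1 minus the lower mean of the product, which is
    the power [E0low p ^ k]. *)
Lemma EE_hit p k r : bdd_lip1 p -> (forall y, 0 <= p y) -> E0low p <= r -> 1 - r ^ k <= EE (hit p k).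
Proof.
  intros hp hp0 hr.
  assert (h1 : EE (fun x => - prodn p k x) <= EE (fun x => (1 - prodn p k x) + - (1))).
  { apply (EE_mono ST k k).
    - apply BL_opp, BL_prodn; auto.
    - apply BL_plus; [apply BL_minus|]; auto using BL_const, BL_prodn.
    - intros; lra. }
  rewrite EE_opp_prodn in h1 by auto.
  assert (h2 := EE_subadd ST k (fun x => 1 - prodn p k x) (fun _ => - (1))).
  specialize (h2 ltac:(apply BL_minus; auto using BL_const, BL_prodn) ltac:(apply BL_const)).
  rewrite (EE_const ST) in h2.
  assert (h3 : EE (fun x => 1 - prodn p k x) <= EE (hit p k)).
  { apply (EE_mono ST k k); auto using BL_hit.
    - apply BL_minus; auto using BL_const, BL_prodn.
    - intros; apply Rmax_l. }
  assert (E0low p ^ k <= r ^ k) by (apply pow_incr; split; auto using E0low_nonneg). lra.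
Qed.

(** On block [k] the product of [p], and likewise that of [q], can be made smaller than 1 with
    capacity at least [1 - r ^ k]. The two products are reciprocal, so both cannot be small on the
    same block; continuity from above does not tolerate this freedom of choice. *)
Lemma no_opposite_tilts p q : bdd_lip1 p -> bdd_lip1 q -> (forall y, 0 <= p y) -> (forall y, 0 <= q y) ->
  (forall y, p y * q y = 1) -> E0low p < 1 -> E0low q < 1 -> False.
Proof.
  intros hp hq hp0 hq0 hpq h1 h2.
  set (r := Rmax (E0low p) (E0low q)).
  assert (hr : 0 <= r < 1).
  { split; [eapply Rle_trans; [|apply Rmax_l]; auto using E0low_nonneg|]. apply Rmax_lub_lt; auto. }
  set (low := fun k w => prodn p k (shift (tri k) (Xp (X:=X) w)) < 1).
  set (high := fun k w => prodn q k (shift (tri k) (Xp (X:=X) w)) < 1).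
  assert (hlh : forall k w, low k w -> high k w -> False).
  { unfold low, high. intros k w. set (x := shift (tri k) (Xp w)).
    assert (e : prodn p k x * prodn q k x = 1).
    { unfold prodn. clearbody x. clear - hpq. induction k; simpl; [lra|].
      transitivity (rprod (fun j => p (x j)) k * rprod (fun j => q (x j)) k * (p (x k) * q (x k))); [ring|].
      rewrite IHk, hpq; ring. }
    assert (a := prodn_nonneg p k x hp0). assert (b := prodn_nonneg q k x hq0). nra. }
  assert (Flow : forall k, F (low k)).
  { intros k. apply (F_lt SL). apply (H_BL ST (tri k + k) (fun x => prodn p k (shift (tri k) x))). apply BL_shift, BL_prodn; auto. }
  assert (Fhigh : forall k, F (high k)).
  { intros k. apply (F_lt SL). apply (H_BL ST (tri k + k) (fun x => prodn q k (shift (tri k) x))). apply BL_shift, BL_prodn; auto. }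
  (* This makes the geometric tail [r ^ n / (1 - r)] at most one half for every [n] from [n0] on. *)
  destruct (pow_lt_1_zero r ltac:(rewrite Rabs_right; lra) ((1 - r) / 2) ltac:(lra)) as [n0 hn0].
  set (W := fun n w => (exists k, (n <= k)%nat /\ high k w) /\ (exists m, forall k, (m <= k)%nat -> low k w)).
  assert (FW : forall n, F (W n)).
  { intros n. apply (F_and SL).
    - apply (F_exists SL). intros k. apply (F_and SL); auto. apply (F_const SL).
    - apply (F_exists SL). intros m. apply (F_forall SL). intros k. apply (F_impl SL); auto. }
  assert (HW : forall n, (n0 <= n)%nat -> / 2 <= V (W n)).
  { intros n hn.
    (* The finite-horizon event: blocks before [n] are free, block [n] is high, later ones are low.
       It decreases with [K], so continuity from above applies. *)
    set (D := fun K w => forall k, (k < K)%nat -> (k = n -> high k w) /\ ((n < k)%nat -> low k w)).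
    apply Rle_trans with (V (fun w => forall K, D K w)).
    2:{ apply (V_mono SL). intros w hD. split.
        - exists n; split; auto. apply (hD (S n) n); auto.
        - exists (S n). intros k hk. apply (hD (S k) k); auto; lia. }
    apply (V_forall_ge SL CV).
    { intros K. apply (F_forall SL); intros k. apply (F_impl SL). apply (F_and SL); apply (F_impl SL); auto. }
    { intros K w hD k hk; apply hD; lia. }
    intros K.
    set (h := fun k => if (k <? n)%nat then (fun _ => 1) else if (k =? n)%nat then hit q k else hit p k).
    assert (hb : forall k, BL (tri (S k) - tri k) (h k)).
    { intros k. replace (tri (S k) - tri k)%nat with k by (simpl; lia).
      unfold h. destruct (k <? n)%nat; [apply BL_const|]. destruct (k =? n)%nat; apply BL_hit; auto. }
    assert (hh : forall k y, 0 <= h k y <= 1).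
    { intros k y. unfold h. destruct (k <? n)%nat; [lra|].
      destruct (k =? n)%nat; unfold hit; split; try apply Rmax_r; apply Rmax_lub; try lra.
      - assert (a := prodn_nonneg q k y hq0); lra.
      - assert (a := prodn_nonneg p k y hp0); lra. }
    apply Rle_trans with (EE (blockprod tri h K)).
    - rewrite (EE_blockprod ST); auto; [|intros; simpl; lia|intros; apply hh].
      set (e := fun k => if (k <? n)%nat then 0 else r ^ k).
      apply Rle_trans with (1 - psum e K).
      + assert (he : psum e K <= (r ^ n - r ^ (max K n)) / (1 - r)).
        { induction K; simpl psum.
          - rewrite Nat.max_0_l. unfold Rdiv; rewrite Rminus_diag; lra.
          - unfold e at 2. destruct (Nat.ltb_spec K n).
            + rewrite Nat.max_r in * by lia. lra.
            + rewrite Nat.max_l in * by lia.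
              replace ((r ^ n - r ^ S K) / (1 - r)) with ((r ^ n - r ^ K) / (1 - r) + r ^ K) by (simpl; field; lra). lra. }
        assert (0 <= r ^ (max K n)) by (apply pow_le; lra).
        specialize (hn0 n hn). rewrite Rabs_right in hn0 by (apply Rle_ge, pow_le; lra).
        assert ((r ^ n - r ^ (max K n)) / (1 - r) <= / 2).
        { apply Rmult_le_reg_r with (1 - r); [lra|]. unfold Rdiv; rewrite Rmult_assoc, Rinv_l by lra. lra. }
        lra.
      + apply rprod_ge.
        * intros k. unfold e. destruct (k <? n)%nat; [lra|]. split; [apply pow_le; lra|].
          rewrite <- (pow1 k). apply pow_incr; lra.
        * intros k. unfold e, h. destruct (k <? n)%nat; [rewrite (EE_const ST); lra|].
          destruct (k =? n)%nat; apply EE_hit; auto; apply Rmax_r || apply Rmax_l.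
    - apply (EE_le_V ST (tri K)).
      + apply BL_blockprod; auto. intros; simpl; lia.
      + intros w. apply blockprod_le1; auto.
      + intros w hD. right. apply not_all_ex_not in hD. destruct hD as [k hk].
        apply (blockprod_zero _ _ _ k); [tauto|]. unfold h.
        destruct (Nat.ltb_spec k n); [exfalso; apply hk; intros; split; intros; lia|].
        destruct (Nat.eqb_spec k n); unfold hit.
        * apply Rmax_right. apply Rnot_lt_le; intros hl. apply hk. intros _; split; [|lia].
          intros _. unfold high. lra.
        * apply Rmax_right. apply Rnot_lt_le; intros hl. apply hk. intros _; split; [lia|].
          intros _. unfold low. lra. }
  assert (hfin : / 2 <= V (fun w => forall n, W (n0 + n)%nat w)).
  { apply (V_forall_ge SL CV (fun n => W (n0 + n)%nat)); auto.
    - intros n w [(k & hk & h) h']; split; auto. exists k; split; auto; lia.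
    - intros n; apply HW; lia. }
  rewrite (V_empty SL) in hfin; [lra|].
  (* The first event supplies a rank [m] from which all blocks are low, and the event of index
     [n0 + m] a high block beyond that rank. *)
  intros w hw. destruct (hw O) as [_ [m hm]].
  destruct (hw m) as [(k & hk & hkh) _]. apply (hlh k w); auto. apply hm; lia.
Qed.

(** With [c] halfway between the two means, [tilt_lt_1] applies to [f] around [c] and to [- f]
    around [- c]. A common parameter makes the two exponentials reciprocal. *)
Proposition E0_opp f : bdd_lip1 f -> E0 (fun y => - f y) = - E0 f.
Proof.
  intros hf.
  assert (h0 : 0 <= E0 f + E0 (fun y => - f y)).
  { eapply Rle_trans; [|apply (E0_subadd ST); auto using bl_opp].
    rewrite <- (E0_const ST 0). apply (E0_mono ST); auto using bl_const, bl_plus, bl_opp. intros; lra. }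
  destruct (Req_dec (E0 f + E0 (fun y => - f y)) 0) as [|hn]; [lra|exfalso].
  set (c := (E0 f + E0low f) / 2).
  destruct (tilt_lt_1 f c hf) as (l1 & hl1 & h1); [unfold c, E0low; lra|].
  destruct (tilt_lt_1 (fun y => - f y) (- c)) as (l2 & hl2 & h2); [apply bl_opp; auto| |].
  { unfold E0low at 1. replace (fun y => - - f y) with f by (apply functional_extensionality; intros; ring).
    unfold c, E0low; lra. }
  assert (hl : 0 < Rmin l1 l2) by (apply Rmin_glb_lt; auto).
  apply (no_opposite_tilts (fun y => exp (Rmin l1 l2 * (f y - c))) (fun y => exp (Rmin l1 l2 * (- f y - - c)))).
  - apply tilt_bl; auto.
  - apply (tilt_bl (fun y => - f y)); apply bl_opp; auto.
  - intros; left; apply exp_pos.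
  - intros; left; apply exp_pos.
  - intros y. rewrite <- exp_plus, <- exp_0. f_equal. ring.
  - apply h1; split; auto. apply Rmin_l.
  - apply h2; split; auto. apply Rmin_r.
Qed.

Lemma E0_plus f g : bdd_lip1 f -> bdd_lip1 g -> E0 (fun y => f y + g y) = E0 f + E0 g.
Proof.
  intros hf hg. apply Rle_antisym; [apply (E0_subadd ST); auto|].
  assert (h := E0_subadd ST (fun y => f y + g y) (fun y => - g y)).
  rewrite (E0_opp g hg) in h.
  replace (fun y => f y + g y + - g y) with f in h by (apply functional_extensionality; intros; ring).
  specialize (h ltac:(auto using bl_plus) ltac:(auto using bl_opp)). lra.
Qed.

Lemma E0_mult c f : bdd_lip1 f -> E0 (fun y => c * f y) = c * E0 f.
Proof.
  intros hf. destruct (Rle_dec 0 c); [apply (E0_scal ST); auto|].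
  replace (fun y => c * f y) with (fun y => - (- c * f y)) by (apply functional_extensionality; intros; ring).
  rewrite (E0_opp (fun y => - c * f y)); [rewrite (E0_scal ST); auto; lra|]. apply bl_mult; auto using bl_const.
Qed.

(** Integrating out one variable at a time carries [E0_opp] over to functions of finitely many
    variables. *)
Lemma EE_opp n : forall Phi, BL n Phi -> EE (fun x => - Phi x) = - EE Phi.
Proof.
  induction n; intros Phi h.
  - replace Phi with (fun _ : nat -> R => Phi (fun _ => 0)).
    + rewrite !(EE_const ST); auto.
    + apply functional_extensionality; intros x. apply (BL_local 0); auto. intros; lia.
  - rewrite (EE_step ST n Phi), (EE_step ST n (fun x => - Phi x)) by auto using BL_opp.
    rewrite <- IHn by (apply (BL_integrate ST); auto). f_equal.
    apply functional_extensionality; intros x. apply (E0_opp (fun y => Phi (ext n x y))). apply BL_section; auto.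
Qed.

Lemma EE_plus n Phi Psi : BL n Phi -> BL n Psi -> EE (fun x => Phi x + Psi x) = EE Phi + EE Psi.
Proof.
  intros hf hg. apply Rle_antisym; [apply (EE_subadd ST n); auto|].
  assert (h := EE_subadd ST n (fun y => Phi y + Psi y) (fun y => - Psi y)).
  rewrite (EE_opp n Psi hg) in h.
  replace (fun y => Phi y + Psi y + - Psi y) with Phi in h by (apply functional_extensionality; intros; ring).
  specialize (h ltac:(auto using BL_plus) ltac:(auto using BL_opp)). lra.
Qed.

End Linear.

(** * The G-heat equation and Gaussian test functions *)

Lemma bl_cos : bdd_lip1 cos.
Proof.
  split; [exists 1; intros; apply Rabs_le; apply COS_bound|].
  exists 1. apply (lip_of_derive cos (fun x => - sin x)); intros x.
  - apply is_derive_cos.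
  - rewrite Rabs_Ropp. apply Rabs_le, SIN_bound.
Qed.

Lemma bl_sin : bdd_lip1 sin.
Proof.
  split; [exists 1; intros; apply Rabs_le; apply SIN_bound|].
  exists 1. apply (lip_of_derive sin cos); intros x.
  - apply is_derive_sin.
  - apply Rabs_le, COS_bound.
Qed.

Lemma bl_affine f a b : bdd_lip1 f -> bdd_lip1 (fun y => f (a + b * y)).
Proof.
  intros [[M hM] [L hL]]. split; [exists M; auto|].
  exists (L * Rabs b). intros x y. eapply Rle_trans; [apply hL|].
  rewrite Rmult_assoc, <- Rabs_mult. right; do 2 f_equal; ring.
Qed.

Lemma test_fun_cos P dP : (forall t, is_derive P t (dP t)) -> (forall t, continuous dP t) ->
  test_fun (fun t x => P t * cos x) (fun t x => dP t * cos x) (fun t x => - P t * cos x).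
Proof.
  intros hP hd.
  assert (cP : forall t, continuous P t) by (intros t; apply (ex_derive_continuous P); eexists; apply hP).
  assert (cfst : forall g : R -> R, (forall t, continuous g t) -> forall p : R * R, continuous (fun p => g (fst p)) p).
  { intros g hg p. apply (continuous_comp fst g); [apply continuous_fst|apply hg]. }
  assert (csnd : forall g : R -> R, (forall t, continuous g t) -> forall p : R * R, continuous (fun p => g (snd p)) p).
  { intros g hg p. apply (continuous_comp snd g); [apply continuous_snd|apply hg]. }
  exists (fun t x => - P t * sin x). split; [|split; [|split; [|split; [|split]]]].
  - intros t x. replace (dP t * cos x) with (cos x * dP t) by ring.
    apply (is_derive_ext (fun s => cos x * P s)); [intros; apply Rmult_comm|].
    apply is_derive_scal. apply hP.
  - intros t x. auto_derive; auto. ring.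
  - intros t x. auto_derive; auto. ring.
  - intros t x. apply (continuous_mult (fun p : R * R => dP (fst p)) (fun p : R * R => cos (snd p))); [apply cfst; auto|apply csnd, continuous_cos].
  - intros t x. apply (continuous_mult (fun p : R * R => - P (fst p)) (fun p : R * R => sin (snd p))).
    + apply (cfst (fun t => - P t)). intros s. apply (continuous_opp P); auto.
    + apply csnd, continuous_sin.
  - intros t x. apply (continuous_mult (fun p : R * R => - P (fst p)) (fun p : R * R => cos (snd p))).
    + apply (cfst (fun t => - P t)). intros s. apply (continuous_opp P); auto.
    + apply csnd, continuous_cos.
Qed.

(* [eta * (t / T) ^ n] is small at [T] and huge at [2 * T], so [f] minus it has an interior maximum. *)
Lemma increasing_touch f T : 0 < T -> (forall t, 0 <= t <= 2 * T -> continuity_pt f t) -> f 0 < f T ->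
  exists (q dq : R -> R) m, 0 < m < 2 * T /\ (forall t, is_derive q t (dq t)) /\ (forall t, ex_derive dq t) /\
    0 < dq m /\ f m = q m /\ forall t, 0 <= t <= 2 * T -> f t <= q t.
Proof.
  intros hT hc hlt.
  set (eta := (f T - f 0) / 2). assert (he : 0 < eta) by (unfold eta; lra).
  destruct (INR_unbounded ((f (2 * T) - f 0) / eta)) as [N hN].
  remember (S N) as n eqn:En.
  assert (h2 : f (2 * T) - f 0 < eta * 2 ^ n).
  { apply Rlt_le_trans with (eta * INR N).
    - apply Rmult_lt_reg_r with (/ eta); [apply Rinv_0_lt_compat; auto|].
      replace (eta * INR N * / eta) with (INR N) by (field; lra). exact hN.
    - apply Rmult_le_compat_l; [lra|]. assert (h := poly n 1 ltac:(lra)). replace (1 + 1) with 2 in h by ring.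
      rewrite En in h at 1. rewrite S_INR in h. lra. }
  set (q0 := fun t => eta * (t / T) ^ n).
  destruct (continuity_ab_maj (fun t => f t - q0 t) 0 (2 * T)) as (m & hm & hm01); [lra| |].
  { intros c hcc. apply continuity_pt_minus; auto. apply continuity_pt_filterlim. apply (ex_derive_continuous q0). unfold q0. auto_derive; lra. }
  assert (q00 : q0 0 = 0) by (unfold q0; rewrite En; simpl; unfold Rdiv; ring).
  assert (q0T : q0 T = eta) by (unfold q0; replace (T / T) with 1 by (field; lra); rewrite pow1; ring).
  assert (q02 : q0 (2 * T) = eta * 2 ^ n) by (unfold q0; replace (2 * T / T) with 2 by (field; lra); auto).
  assert (hmT := hm T ltac:(lra)).
  assert (hm0 : m <> 0) by (intros ->; rewrite q0T, q00 in hmT; unfold eta in *; lra).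
  assert (hm2 : m <> 2 * T) by (intros ->; rewrite q0T, q02 in hmT; unfold eta in *; lra).
  exists (fun t => q0 t + (f m - q0 m)), (fun t => eta * (INR n * / T * (t / T) ^ N)), m.
  split; [lra|]. split; [|split; [|split; [|split]]].
  - intros t. unfold q0. auto_derive; [lra|]. replace (Nat.pred n) with N by lia. unfold Rdiv. ring.
  - intros t. auto_derive; auto.
  - apply Rmult_lt_0_compat; auto. assert (0 < / T) by (apply Rinv_0_lt_compat; auto).
    apply Rmult_lt_0_compat; [apply Rmult_lt_0_compat; auto; apply lt_0_INR; lia|].
    apply pow_lt. apply Rdiv_lt_0_compat; lra.
  - ring.
  - intros t ht. specialize (hm t ht). simpl in hm. lra.
Qed.

Lemma is_derive_reflect (f : R -> R) x l : is_derive f (- x) l -> is_derive (fun y => f (- y)) x (- l).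
Proof.
  intros h. replace (- l) with (scal (-1) l) by (unfold scal; simpl; unfold mult; simpl; ring).
  apply (is_derive_comp f (fun y => - y)); auto. auto_derive; auto.
Qed.

Lemma test_fun_reflect psi pt pxx : test_fun psi pt pxx ->
  test_fun (fun t x => psi t (- x)) (fun t x => pt t (- x)) (fun t x => pxx t (- x)).
Proof.
  intros (px & h1 & h2 & h3 & h4 & h5 & h6).
  assert (cr : forall g : R -> R -> R, (forall t x, continuous (fun p : R * R => g (fst p) (snd p)) (t, x)) ->
    forall t x, continuous (fun p : R * R => g (fst p) (- snd p)) (t, x)).
  { intros g hg t x.
    apply (continuous_comp_2 (fun p : R * R => fst p) (fun p : R * R => - snd p) g).
    - apply (continuous_fst (U := R_UniformSpace) (V := R_UniformSpace)).
    - apply (continuous_opp (fun p : R * R => snd p)). apply (continuous_snd (U := R_UniformSpace) (V := R_UniformSpace)).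
    - apply hg. }
  exists (fun t x => - px t (- x)). split; [|split; [|split; [|split; [|split]]]]; auto.
  - intros t x. apply is_derive_reflect, h2.
  - intros t x. replace (pxx t (- x)) with (- - pxx t (- x)) by ring. apply (is_derive_opp (fun y => px t (- y))).
    apply is_derive_reflect, h3.
  - intros t x. apply (continuous_opp (fun p : R * R => px (fst p) (- snd p))). apply cr; auto.
Qed.

(** The equation is invariant under [x -> - x]. Together with uniqueness this makes the solution
    with an even initial value even, which removes the sine term in [variance_certain]. *)
Lemma visc_sol_reflect a b phi u : visc_sol a b phi u -> visc_sol a b (fun x => phi (- x)) (fun t x => u t (- x)).
Proof.
  intros (h1 & h2 & h3 & h4). split; [|split; [|split]]; auto.
  - intros t x ht eps he. destruct (h1 t (- x) ht eps he) as (d & hd & h). exists d; split; auto.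
    intros s y hs hst hy. apply h; auto. replace (- y - - x) with (- (y - x)) by ring. rewrite Rabs_Ropp; auto.
  - intros t x psi pt pxx ht hp e (r & hr & hl).
    assert (h := h3 t (- x) (fun t x => psi t (- x)) _ _ ht (test_fun_reflect _ _ _ hp)).
    cbv beta in h. rewrite !Ropp_involutive in h. apply h; auto. exists r; split; auto. intros s y hs hst hy.
    specialize (hl s (- y) hs hst). rewrite ?Ropp_involutive in hl. apply hl.
    replace (- y - x) with (- (y - - x)) by ring. rewrite Rabs_Ropp; auto.
  - intros t x psi pt pxx ht hp e (r & hr & hl).
    assert (h := h4 t (- x) (fun t x => psi t (- x)) _ _ ht (test_fun_reflect _ _ _ hp)).
    cbv beta in h. rewrite !Ropp_involutive in h. apply h; auto. exists r; split; auto. intros s y hs hst hy.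
    specialize (hl s (- y) hs hst). rewrite ?Ropp_involutive in hl. apply hl.
    replace (- y - x) with (- (y - - x)) by ring. rewrite Rabs_Ropp; auto.
Qed.

(** [cos] is 1-Lipschitz, so it cannot fall to 0 within distance 1 of a maximum. *)
Lemma cos_pos_near x : cos x = 1 -> forall y, Rabs (y - x) < 1 -> 0 < cos y.
Proof.
  intros hx y hy.
  assert (hs : forall x, Rabs (- sin x) <= 1) by (intros z; rewrite Rabs_Ropp; apply Rabs_le, SIN_bound).
  assert (h := lip_of_derive cos (fun x => - sin x) 1 is_derive_cos hs y x).
  rewrite hx in h. assert (h' := Rabs_le_between (cos y - 1) (1 * Rabs (y - x))).
  apply h' in h. lra.
Qed.

Lemma cos_neg_near y : Rabs (y - PI) < 1 -> cos y < 0.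
Proof.
  intros hy. assert (h := cos_pos_near 0 cos_0 (y - PI)). rewrite Rminus_0_r in h. specialize (h hy).
  replace y with ((y - PI) + PI) by ring. rewrite neg_cos. lra.
Qed.

Lemma Gfun_pos a b y : 0 <= y -> Gfun a b y = b / 2 * y.
Proof. intros h. unfold Gfun. rewrite Rmax_left, Rmax_right by lra. field. Qed.

Lemma Gfun_neg a b y : y <= 0 -> Gfun a b y = a / 2 * y.
Proof. intros h. unfold Gfun. rewrite Rmax_right, Rmax_left by lra. field. Qed.

(** Both halves use the supersolution clause. A product [P t * cos x] touches the solution from
    below at [x = PI] when [P] touches [C] from above, and at [x = 0] when [P] touches [C] from
    below. As [C] is positive near time 0, the second derivative is positive at [PI] and negative at
    0, so [Gfun] reads off [b] and [a] respectively. The outcome is [C T * exp (b / 2 * T) <= 1 <= C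
    T * exp (a / 2 * T)]. *)
Lemma visc_separated a b (C : R -> R) : 
  visc_sol a b cos (fun t x => C t * cos x) -> (forall t, t <= 0 -> C t = C 0) -> b <= a.
Proof.
  intros (h1 & h2 & h3 & h4) hneg.
  assert (C0 : C 0 = 1) by (specialize (h2 0); rewrite cos_0 in h2; lra).
  (* Continuity at time 0 has to be two-sided; the constant extension to negative times provides
     it. *)
  assert (hC : forall t, 0 <= t -> continuity_pt C t).
  { intros t ht. apply continuity_pt_locally. intros eps.
    destruct (h1 t 0 ht eps (cond_pos eps)) as (d & hd & h).
    exists (mkposreal d hd). intros s hs. change (Rabs (s - t) < d) in hs.
    specialize (h (Rmax s 0) 0). rewrite cos_0, !Rmult_1_r in h.
    replace (C s) with (C (Rmax s 0)).
    - apply h; [apply Rmax_r| |rewrite Rminus_diag, Rabs_R0; auto].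
      eapply Rle_lt_trans; [|apply hs]. unfold Rmax; destruct Rle_dec; unfold Rabs; repeat destruct Rcase_abs; lra.
    - unfold Rmax; destruct Rle_dec; auto. rewrite (hneg s); auto. }
  destruct (proj1 (continuity_pt_locally C 0) (hC 0 (Rle_refl 0)) (mkposreal 1 Rlt_0_1)) as [d hd]. simpl in hd.
  (* [T] is small enough for [C] to stay positive on [[0, 2 T]], which decides the branch of
     [Gfun]. *)
  set (T := d / 4). assert (hT : 0 < T) by (unfold T; assert (h := cond_pos d); lra).
  assert (Cpos : forall t, 0 <= t <= 2 * T -> 0 < C t).
  { intros t ht. assert (h := hd t). rewrite C0 in h. assert (Rabs (C t - 1) < 1).
    - apply h. change (Rabs (t - 0) < d). assert (h' := cond_pos d). rewrite Rabs_right; unfold T in *; lra.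
    - apply Rabs_lt_between in H; lra. }
  assert (hexp : forall k t, continuity_pt (fun t => exp (k * t)) t).
  { intros k t. apply continuity_pt_filterlim, (ex_derive_continuous (fun t => exp (k * t))). auto_derive; auto. }
  assert (hA : C T * exp (b / 2 * T) <= 1).
  { apply Rnot_lt_le; intros hlt.
    destruct (increasing_touch (fun t => C t * exp (b / 2 * t)) T hT) as (q & dq & m & hm & hq & hdq & hpos & e & hle).
    - intros t ht. apply continuity_pt_mult; auto. apply hC; lra.
    - rewrite C0, Rmult_0_r, exp_0. lra.
    (* Undoing the integrating factor makes [dP] equal to [- b / 2 * P] plus a term that is positive
       at [m]; the supersolution inequality at [PI] would make that term nonpositive. *)
    - set (P := fun t => q t * exp (- (b / 2) * t)).
      set (dP := fun t => dq t * exp (- (b / 2) * t) - b / 2 * P t).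
      assert (hPd : forall t, is_derive P t (dP t)).
      { intros t. unfold dP, P. auto_derive; [eexists; apply hq|].
        replace (Derive (fun x : R => q x) t) with (dq t) by (symmetry; apply is_derive_unique, hq). unfold Rdiv; ring. }
      assert (hCP : forall t, C t = C t * exp (b / 2 * t) * exp (- (b / 2) * t)).
      { intros t. rewrite Rmult_assoc, <- exp_plus. replace (b / 2 * t + - (b / 2) * t) with 0 by ring. rewrite exp_0; ring. }
      assert (Pm : P m = C m) by (rewrite hCP, e; auto).
      assert (h := h4 m PI _ _ _ (proj1 hm) (test_fun_cos P dP hPd
        (fun t => ltac:(apply (ex_derive_continuous dP); unfold dP, P; auto_derive; repeat split; auto; eexists; apply hq)))).
      cbv beta in h. rewrite Pm in h. specialize (h eq_refl).
      rewrite cos_PI, Gfun_pos in h by (specialize (Cpos m ltac:(lra)); lra).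
      assert (0 < exp (- (b / 2) * m)) by apply exp_pos.
      assert (0 < dq m * exp (- (b / 2) * m)) by (apply Rmult_lt_0_compat; auto).
      assert (hh : dP m * -1 - b / 2 * (- C m * -1) >= 0); [|unfold dP in hh; rewrite Pm in hh; lra].
      apply h. exists (Rmin 1 (Rmin m (2 * T - m))). split; [repeat apply Rmin_glb_lt; lra|].
      intros s y hs hsm hy.
      assert (hr : forall z, z < Rmin 1 (Rmin m (2 * T - m)) -> z < 1 /\ z < m /\ z < 2 * T - m).
      { intros z hz. repeat split; eapply Rlt_le_trans; try apply hz.
        - apply Rmin_l. 
        - eapply Rle_trans; [apply Rmin_r|apply Rmin_l].
        - eapply Rle_trans; [apply Rmin_r|apply Rmin_r]. }
      apply hr in hsm; apply hr in hy. 
      assert (cos y < 0) by (apply cos_neg_near; lra).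
      assert (0 <= s <= 2 * T) by (destruct hsm as (_ & k1 & k2); apply Rabs_lt_between in k1; apply Rabs_lt_between in k2; lra).
      assert (C s <= P s).
      { rewrite hCP. unfold P. apply Rmult_le_compat_r; [left; apply exp_pos|]. apply hle; auto. }
      nra. }
  (* The same argument at [x = 0], where the sign of [cos] is reversed; hence the touching function
     is found for the negated product. *)
  assert (hB : 1 <= C T * exp (a / 2 * T)).
  { apply Rnot_lt_le; intros hlt.
    destruct (increasing_touch (fun t => - (C t * exp (a / 2 * t))) T hT) as (q & dq & m & hm & hq & hdq & hpos & e & hle).
    - intros t ht. apply continuity_pt_opp, continuity_pt_mult; auto. apply hC; lra.
    - rewrite C0, Rmult_0_r, exp_0. lra.
    - set (P := fun t => - q t * exp (- (a / 2) * t)).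
      set (dP := fun t => - dq t * exp (- (a / 2) * t) - a / 2 * P t).
      assert (hPd : forall t, is_derive P t (dP t)).
      { intros t. unfold dP, P. auto_derive; [eexists; apply hq|].
        replace (Derive (fun x : R => q x) t) with (dq t) by (symmetry; apply is_derive_unique, hq). unfold Rdiv; ring. }
      assert (hCP : forall t, C t = C t * exp (a / 2 * t) * exp (- (a / 2) * t)).
      { intros t. rewrite Rmult_assoc, <- exp_plus. replace (a / 2 * t + - (a / 2) * t) with 0 by ring. rewrite exp_0; ring. }
      assert (Pm : P m = C m) by (rewrite hCP; unfold P; rewrite <- e; ring).
      assert (h := h4 m 0 _ _ _ (proj1 hm) (test_fun_cos P dP hPd
        (fun t => ltac:(apply (ex_derive_continuous dP); unfold dP, P; auto_derive; repeat split; auto; eexists; apply hq)))).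
      cbv beta in h. rewrite Pm in h. specialize (h eq_refl).
      rewrite cos_0, Gfun_neg in h by (specialize (Cpos m ltac:(lra)); lra).
      assert (0 < exp (- (a / 2) * m)) by apply exp_pos.
      assert (0 < dq m * exp (- (a / 2) * m)) by (apply Rmult_lt_0_compat; auto).
      assert (hh : dP m * 1 - a / 2 * (- C m * 1) >= 0); [|unfold dP in hh; rewrite Pm in hh; lra].
      apply h. exists (Rmin 1 (Rmin m (2 * T - m))). split; [repeat apply Rmin_glb_lt; lra|].
      intros s y hs hsm hy.
      assert (hr : forall z, z < Rmin 1 (Rmin m (2 * T - m)) -> z < 1 /\ z < m /\ z < 2 * T - m).
      { intros z hz. repeat split; eapply Rlt_le_trans; try apply hz.
        - apply Rmin_l. 
        - eapply Rle_trans; [apply Rmin_r|apply Rmin_l].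
        - eapply Rle_trans; [apply Rmin_r|apply Rmin_r]. }
      apply hr in hsm; apply hr in hy. 
      assert (0 < cos y) by (apply (cos_pos_near 0); [apply cos_0|lra]).
      assert (0 <= s <= 2 * T) by (destruct hsm as (_ & k1 & k2); apply Rabs_lt_between in k1; apply Rabs_lt_between in k2; lra).
      assert (P s <= C s).
      { rewrite (hCP s). unfold P. apply Rmult_le_compat_r; [left; apply exp_pos|]. specialize (hle s H2). lra. }
      nra. }
  apply Rnot_lt_le; intros hab.
  assert (exp (a / 2 * T) < exp (b / 2 * T)) by (apply exp_increasing; apply Rmult_lt_compat_r; lra).
  specialize (Cpos T ltac:(lra)). nra.
Qed.

(** If the second derivative were negative, [g'] would be negative just to the right of [x], against
    minimality by the mean value theorem. *)
Lemma local_min_test (g g' : R -> R) x g2 r : 0 < r -> (forall y, is_derive g y (g' y)) -> is_derive g' x g2 ->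
  (forall y, Rabs (y - x) < r -> g x <= g y) -> g' x = 0 /\ 0 <= g2.
Proof.
  intros hr hg hg2 hmin.
  assert (e : g' x = 0).
  { assert (pr : derivable_pt g x) by (exists (g' x); apply is_derive_Reals, hg).
    assert (h := deriv_minimum g (x - r) (x + r) x pr ltac:(lra) ltac:(lra)).
    rewrite (derive_pt_eq_0 g x (g' x) pr) in h; [apply h|apply is_derive_Reals, hg].
    intros y h1 h2. apply hmin. apply Rabs_def1; lra. }
  split; auto. apply Rnot_lt_le; intros hn.
  apply is_derive_Reals in hg2. destruct (hg2 (- g2 / 2) ltac:(lra)) as [d hd].
  set (y := x + Rmin d r / 2).
  assert (hdp := cond_pos d). assert (0 < Rmin d r) by (apply Rmin_glb_lt; auto).
  assert (Rmin d r <= d) by apply Rmin_l. assert (Rmin d r <= r) by apply Rmin_r.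
  destruct (MVT_cor2 g g' x y) as (c & ec & hc).
  - unfold y; lra.
  - intros z hz. apply is_derive_Reals, hg.
  - assert (g x <= g y) by (apply hmin; unfold y; apply Rabs_def1; lra).
    assert (hyx : 0 < y - x) by (unfold y; lra).
    assert (hgc : 0 <= g' c) by (apply Rnot_lt_le; intros hl; nra).
    specialize (hd (c - x) ltac:(lra)). rewrite e in hd.
    replace (x + (c - x)) with c in hd by ring.
    assert (hcy : Rabs (c - x) < d) by (rewrite Rabs_right; unfold y in *; lra).
    specialize (hd hcy). rewrite Rminus_0_r in hd. apply Rabs_lt_between in hd.
    assert (0 <= g' c / (c - x)) by (apply Rmult_le_pos; auto; left; apply Rinv_0_lt_compat; lra). lra.
Qed.

(** With equal variances [Gfun] is linear. Touching is tested separately along the time line and the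
    space line, and the two resulting conditions add up to the viscosity inequality. *)
Lemma classical_visc_sol a phi v (vt vx vxx : R -> R -> R) : 0 <= a ->
  (forall t x, 0 <= t -> continuous (fun p : R * R => v (fst p) (snd p)) (t, x)) ->
  (forall x, v 0 x = phi x) ->
  (forall t x, 0 < t -> is_derive (fun s => v s x) t (vt t x)) ->
  (forall t x, 0 < t -> is_derive (fun y => v t y) x (vx t x)) ->
  (forall t x, 0 < t -> is_derive (fun y => vx t y) x (vxx t x)) ->
  (forall t x, 0 < t -> vt t x = a / 2 * vxx t x) -> visc_sol a a phi v.
Proof.
  intros ha hc h0 ht hx hxx hpde.
  assert (hG : forall y, Gfun a a y = a / 2 * y).
  { intros y. destruct (Rle_dec 0 y); [apply Gfun_pos|apply Gfun_neg]; lra. }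
  assert (hmin : forall (g : R -> R) t l r, 0 < r -> 0 < t -> is_derive g t l ->
    (forall s, 0 < s -> Rabs (s - t) < r -> g t <= g s) -> l = 0).
  { intros g t l r hr htp hd hm.
    assert (pr : derivable_pt g t) by (exists l; apply is_derive_Reals, hd).
    assert (0 < Rmin r t) by (apply Rmin_glb_lt; auto).
    assert (k1 := Rmin_l r t). assert (k2 := Rmin_r r t).
    assert (h := deriv_minimum g (t - Rmin r t) (t + Rmin r t) t pr ltac:(lra) ltac:(lra)).
    rewrite (derive_pt_eq_0 g t l pr) in h; [apply h|apply is_derive_Reals, hd].
    intros y h1 h2. apply hm; [lra|]. apply Rabs_def1; lra. }
  split; [|split; [|split]]; auto.
  - intros t x htp eps he.
    destruct (proj1 (filterlim_locally _ _) (hc t x htp) (mkposreal eps he)) as [d hd].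
    exists d. split; [apply cond_pos|]. intros s y hs hst hyx.
    apply (hd (s, y)). split; auto.
  - intros t x psi pt pxx htp (px & p1 & p2 & p3 & _) e (r & hr & hl).
    assert (e1 : pt t x - vt t x = 0).
    { apply (hmin (fun s => psi s x - v s x) t _ r); auto.
      - apply (is_derive_minus (fun s => psi s x) (fun s => v s x)); auto.
      - intros s hs hst. rewrite e, Rminus_diag. specialize (hl s x hs hst). rewrite Rminus_diag, Rabs_R0 in hl. specialize (hl hr). lra. }
    assert (e2 : 0 <= pxx t x - vxx t x).
    { apply (local_min_test (fun y => psi t y - v t y) (fun y => px t y - vx t y) x _ r hr).
      - intros y. apply (is_derive_minus (fun y => psi t y) (fun y => v t y)); auto.
      - apply (is_derive_minus (fun y => px t y) (fun y => vx t y)); auto.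
      - intros y hy. rewrite e, Rminus_diag. specialize (hl t y htp). rewrite Rminus_diag, Rabs_R0 in hl. specialize (hl hr hy). lra. }
    rewrite hG. specialize (hpde t x htp).
    assert (0 <= a / 2 * (pxx t x - vxx t x)) by (apply Rmult_le_pos; lra). lra.
  - intros t x psi pt pxx htp (px & p1 & p2 & p3 & _) e (r & hr & hl).
    assert (e1 : vt t x - pt t x = 0).
    { apply (hmin (fun s => v s x - psi s x) t _ r); auto.
      - apply (is_derive_minus (fun s => v s x) (fun s => psi s x)); auto.
      - intros s hs hst. rewrite e, Rminus_diag. specialize (hl s x hs hst). rewrite Rminus_diag, Rabs_R0 in hl. specialize (hl hr). lra. }
    assert (e2 : 0 <= vxx t x - pxx t x).
    { apply (local_min_test (fun y => v t y - psi t y) (fun y => vx t y - px t y) x _ r hr).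
      - intros y. apply (is_derive_minus (fun y => v t y) (fun y => psi t y)); auto.
      - apply (is_derive_minus (fun y => vx t y) (fun y => px t y)); auto.
      - intros y hy. rewrite e, Rminus_diag. specialize (hl t y htp). rewrite Rminus_diag, Rabs_R0 in hl. specialize (hl hr hy). lra. }
    rewrite hG. specialize (hpde t x htp).
    assert (0 <= a / 2 * (vxx t x - pxx t x)) by (apply Rmult_le_pos; lra). lra.
Qed.

(* The Gaussian density of variance [d], up to the factor [sqrt (2 * PI)]. *)
Definition gauss (d x : R) : R := exp (- ln d / 2 - x ^ 2 / (2 * d)).

Lemma gauss_pos d x : 0 < gauss d x.
Proof. apply exp_pos. Qed.

Lemma gauss_le d x : 0 < d -> gauss d x <= exp (- ln d / 2).
Proof.
  intros hd. unfold gauss. assert (0 <= x ^ 2 / (2 * d)).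
  { apply Rmult_le_pos; [nra|]. left; apply Rinv_0_lt_compat; lra. }
  destruct (Req_dec (- ln d / 2 - x ^ 2 / (2 * d)) (- ln d / 2)) as [->|]; [lra|].
  left; apply exp_increasing; lra.
Qed.

Lemma is_derive_exp_comp (f : R -> R) x l : is_derive f x l -> is_derive (fun y => exp (f y)) x (l * exp (f x)).
Proof. intros h. apply (is_derive_comp exp f); auto. apply is_derive_exp. Qed.

Lemma gauss_d_x d x : 0 < d -> is_derive (gauss d) x (- (x / d) * gauss d x).
Proof. intros hd. apply (is_derive_exp_comp (fun x => - ln d / 2 - x ^ 2 / (2 * d))). auto_derive; [lra|]. field; lra. Qed.

Lemma gauss_bl d : 0 < d -> bdd_lip1 (gauss d).
Proof.
  intros hd. split.
  - exists (exp (- ln d / 2)). intros x. rewrite Rabs_right; [apply gauss_le; auto|apply Rle_ge; left; apply gauss_pos].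
  - exists ((1 + 2 * d) / d * exp (- ln d / 2)). apply (lip_of_derive _ _ _ (fun x => gauss_d_x d x hd)).
    intros x. rewrite Rabs_mult, Rabs_Ropp, (Rabs_right (gauss d x)) by (apply Rle_ge; left; apply gauss_pos).
    unfold gauss. replace (- ln d / 2 - x ^ 2 / (2 * d)) with (- ln d / 2 + - (x ^ 2 / (2 * d))) by ring. rewrite exp_plus, exp_Ropp.
    set (A := exp (- ln d / 2)). assert (hA : 0 < A) by apply exp_pos.
    set (y := x ^ 2 / (2 * d)). assert (h1 := exp_ineq1_le y). 
    assert (hy : x ^ 2 = 2 * d * y) by (unfold y; field; lra).
    assert (hy0 : 0 <= y) by (apply Rmult_le_pos; [nra|]; left; apply Rinv_0_lt_compat; lra).
    (* The chain [|x| <= 1 + x^2 = 1 + 2 d y <= (1 + 2 d) exp y] lets the Gaussian decay absorb the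
       linear factor of the derivative. *)
    assert (hax : Rabs x <= 1 + x ^ 2) by (rewrite <- pow2_abs; assert (h := Rabs_pos x); nra).
    assert (hx : Rabs x <= (1 + 2 * d) * exp y) by (rewrite hy in hax; nra).
    unfold Rdiv at 1. rewrite Rabs_mult, (Rabs_right (/ d)) by (apply Rle_ge; left; apply Rinv_0_lt_compat; auto).
    assert (0 < / d) by (apply Rinv_0_lt_compat; auto).
    assert (0 < / exp y) by (apply Rinv_0_lt_compat, exp_pos).
    replace ((1 + 2 * d) / d * A) with ((1 + 2 * d) * exp y * (/ d * (A * / exp y))) by (field; split; [lra|apply Rgt_not_eq, exp_pos]).
    rewrite Rmult_assoc. apply Rmult_le_compat_r; auto. apply Rmult_le_pos; [lra|]. apply Rmult_le_pos; lra.
Qed.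

(** The heat flow adds [a * t] to the variance of a Gaussian; the normalising term [- ln d / 2] in
    [gauss] is what makes this exact. *)
Lemma heat_gauss a d : 0 <= a -> 0 < d -> visc_sol a a (gauss d) (fun t x => gauss (d + a * t) x).
Proof.
  intros ha hd.
  assert (hp : forall t, 0 <= t -> 0 < d + a * t) by (intros t ht; assert (0 <= a * t) by (apply Rmult_le_pos; auto); lra).
  apply (classical_visc_sol a (gauss d) _
    (fun t x => (- (a / (2 * (d + a * t))) + a * x ^ 2 / (2 * (d + a * t) ^ 2)) * gauss (d + a * t) x)
    (fun t x => - (x / (d + a * t)) * gauss (d + a * t) x)
    (fun t x => (x ^ 2 / (d + a * t) ^ 2 - / (d + a * t)) * gauss (d + a * t) x)); auto.
  - intros t x ht. specialize (hp t ht). unfold gauss.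
    apply (continuous_comp (fun p : R * R => - ln (d + a * fst p) / 2 - snd p ^ 2 / (2 * (d + a * fst p))) exp); [|apply continuous_exp].
    assert (c1 : continuous (fun s => - ln (d + a * s) / 2) t) by (apply (ex_derive_continuous (fun s => - ln (d + a * s) / 2)); auto_derive; auto).
    assert (c2 : continuous (fun s => / (2 * (d + a * s))) t) by (apply (ex_derive_continuous (fun s => / (2 * (d + a * s)))); auto_derive; lra).
    assert (c3 : continuous (fun y => y ^ 2) x) by (apply (ex_derive_continuous (fun y => y ^ 2)); auto_derive; auto).
    assert (f1 := continuous_fst (U := R_UniformSpace) (V := R_UniformSpace) t x).
    apply (continuous_minus (fun p : R * R => - ln (d + a * fst p) / 2) (fun p : R * R => snd p ^ 2 / (2 * (d + a * fst p)))).
    + apply (continuous_comp (fun p : R * R => fst p) (fun s => - ln (d + a * s) / 2) (t, x)); auto.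
    + apply (continuous_mult (fun p : R * R => snd p ^ 2) (fun p : R * R => / (2 * (d + a * fst p)))).
      * apply (continuous_comp (fun p : R * R => snd p) (fun y => y ^ 2) (t, x)); auto.
        apply (continuous_snd (U := R_UniformSpace) (V := R_UniformSpace)).
      * apply (continuous_comp (fun p : R * R => fst p) (fun s => / (2 * (d + a * s))) (t, x)); auto.
  - intros x. rewrite Rmult_0_r, Rplus_0_r; auto.
  - intros t x ht. specialize (hp t ltac:(lra)).
    apply (is_derive_exp_comp (fun s => - ln (d + a * s) / 2 - x ^ 2 / (2 * (d + a * s)))).
    auto_derive; [repeat split; lra|]. field; lra.
  - intros t x ht. apply gauss_d_x. apply hp; lra.
  - intros t x ht. specialize (hp t ltac:(lra)).
    replace ((x ^ 2 / (d + a * t) ^ 2 - / (d + a * t)) * gauss (d + a * t) x) with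
      (- / (d + a * t) * gauss (d + a * t) x + - (x / (d + a * t)) * (- (x / (d + a * t)) * gauss (d + a * t) x)) by (field; lra).
    apply (is_derive_mult (fun y => - (y / (d + a * t))) (gauss (d + a * t))).
    + auto_derive; [lra|]. field; lra.
    + apply gauss_d_x; auto.
    + intros; apply Rmult_comm.
  - intros t x ht. specialize (hp t ltac:(lra)). simpl. field; lra.
Qed.

Section Variance.
Context {Omega : Type} {F : (Omega -> Prop) -> Prop}
  {H : (Omega -> R) -> Prop} {E : (Omega -> R) -> Rbar}
  {X0 : Omega -> R} {X : nat -> Omega -> R} (ST : setting F H E X0 X).
Local Notation V := (Vcap H E).
Local Notation EE := (Eseq (E:=E) (X:=X)).
Local Notation E0 := (Eone (E:=E) (X0:=X0)).

Lemma variance_certain a b : G_normal E a b X0 -> b <= a.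
Proof.
  intros hG. destruct (hG cos bl_cos) as [hv hu].
  set (u := fun t x => real (E (fun w => cos (x + sqrt t * X0 w)))) in *.
  (* [C] and [D] are the coefficients in the addition formula for [cos], which linearity of [E0]
     lets through. *)
  set (C := fun t => E0 (fun y => cos (sqrt t * y))).
  set (D := fun t => E0 (fun y => sin (sqrt t * y))).
  assert (hbl : forall f t, bdd_lip1 f -> bdd_lip1 (fun y => f (sqrt t * y))).
  { intros f t hf. assert (h := bl_affine f 0 (sqrt t) hf).
    replace (fun y => f (sqrt t * y)) with (fun y => f (0 + sqrt t * y)); auto.
    apply functional_extensionality; intros; f_equal; ring. }
  assert (e : forall t x, u t x = cos x * C t - sin x * D t).
  { intros t x. unfold u, C, D.
    change (E0 (fun y => cos (x + sqrt t * y)) = cos x * E0 (fun y => cos (sqrt t * y)) - sin x * E0 (fun y => sin (sqrt t * y))).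
    rewrite <- (E0_mult ST (cos x)) by (apply (hbl cos), bl_cos).
    transitivity (E0 (fun y => cos x * cos (sqrt t * y)) + E0 (fun y => - sin x * sin (sqrt t * y))).
    - rewrite <- (E0_plus ST).
      + f_equal. apply functional_extensionality; intros y. rewrite cos_plus. ring.
      + apply bl_mult; [apply bl_const|apply (hbl cos), bl_cos].
      + apply bl_mult; [apply bl_const|apply (hbl sin), bl_sin].
    - rewrite (E0_mult ST (- sin x)) by (apply (hbl sin), bl_sin). ring. }
  (* At [PI / 2] and [- (PI / 2)] the cosine vanishes and [u] equals [- D t] and [D t]; evenness of
     [u] gives [D t = 0]. *)
  assert (hD : forall t, 0 <= t -> D t = 0).
  { intros t ht. assert (hr := visc_sol_reflect a b cos u hv).
    replace (fun x => cos (- x)) with cos in hr by (apply functional_extensionality; intros; rewrite cos_neg; auto).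
    assert (h := hu _ hr). assert (h' : u t (- (PI / 2)) = u t (PI / 2)).
    { apply h; auto. exists 1, O. intros s x hs. simpl. replace (1 * (1 + 1)) with 2 by ring.
      unfold u. eapply Rle_trans; [apply (E_finite (set_sl _ _ _ _ _ ST) _ 1)|lra].
      - apply (H_bl ST (fun y => cos (- x + sqrt s * y))). apply bl_affine, bl_cos.
      - intros w. apply Rabs_le, COS_bound. }
    rewrite !e, cos_neg, sin_neg, cos_PI2, sin_PI2 in h'. lra. }
  apply (visc_separated a b C).
  - assert (hD' : forall t x, u t x = C t * cos x).
    { intros t x. rewrite e. destruct (Rle_dec 0 t) as [ht|ht]; [rewrite (hD t ht); ring|].
      assert (D t = D 0) by (unfold D; rewrite sqrt_0, sqrt_neg_0 by lra; auto).
      rewrite H0, (hD 0) by lra. ring. }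
    replace (fun t x => C t * cos x) with u; auto.
    apply functional_extensionality; intros t; apply functional_extensionality; intros x; auto.
  - intros t ht. unfold C. rewrite sqrt_0, sqrt_neg_0 by lra. auto.
Qed.

(** Uniqueness for the heat equation, read at time 1. The growth condition holds because the peak of
    the Gaussian decreases with its variance. *)
Lemma E0_gauss a d x : G_normal E a a X0 -> 0 <= a -> 0 < d -> E0 (fun y => gauss d (x + y)) = gauss (d + a) x.
Proof.
  intros hG ha hd. destruct (hG (gauss d) (gauss_bl d hd)) as [_ hu].
  assert (h := hu _ (heat_gauss a d ha hd)). cbv beta in h.
  specialize (fun h1 => h h1 1 x Rle_0_1). rewrite Rmult_1_r, sqrt_1 in h. rewrite h.
  - unfold Eone. do 2 f_equal. apply functional_extensionality; intros w. rewrite Rmult_1_l; auto.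
  - exists (exp (- ln d / 2)), O. intros t y ht. simpl.
    assert (0 <= a * t) by (apply Rmult_le_pos; auto).
    rewrite Rabs_right by (apply Rle_ge; left; apply gauss_pos).
    assert (gauss (d + a * t) y <= exp (- ln (d + a * t) / 2)) by (apply gauss_le; lra).
    assert (exp (- ln (d + a * t) / 2) <= exp (- ln d / 2)).
    { assert (ln d <= ln (d + a * t)) by (apply ln_le; lra).
      destruct (Req_dec (ln d) (ln (d + a * t))) as [->|]; [lra|]. left; apply exp_increasing; lra. }
    assert (hp := exp_pos (- ln d / 2)). lra.
Qed.

Lemma EE_gauss a d n : forall x, G_normal E a a X0 -> 0 <= a -> 0 < d ->
  EE (fun z => gauss d (x + psum z n)) = gauss (d + INR n * a) x.
Proof.
  revert d. induction n as [|n IH]; intros d x hG ha hd.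
  - simpl psum. rewrite (EE_const ST). simpl. f_equal; ring.
  - rewrite (EE_step ST n).
    + transitivity (EE (fun z => gauss (d + a) (x + psum z n))).
      * f_equal. apply functional_extensionality; intros z. rewrite <- (E0_gauss a d) by auto.
        f_equal. apply functional_extensionality; intros y. simpl. rewrite ext_eq.
        rewrite (psum_ext (ext n z y) z n) by (intros; apply ext_lt; auto). f_equal; ring.
      * rewrite IH by (auto; lra). f_equal. rewrite S_INR. ring.
    + apply (BL_psum (fun s => gauss d (x + s))).
      assert (h := bl_affine (gauss d) x 1 (gauss_bl d hd)).
      replace (fun s => gauss d (x + s)) with (fun s => gauss d (x + 1 * s)); auto.
      apply functional_extensionality; intros; f_equal; ring.
Qed.

End Variance.

(** * Maximal inequality and Gaussian tails *)

Section Tails.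
Context {Omega : Type} {F : (Omega -> Prop) -> Prop}
  {H : (Omega -> R) -> Prop} {E : (Omega -> R) -> Rbar}
  {X0 : Omega -> R} {X : nat -> Omega -> R} (ST : setting F H E X0 X).
Local Notation V := (Vcap H E).
Local Notation EE := (Eseq (E:=E) (X:=X)).
Local Notation E0 := (Eone (E:=E) (X0:=X0)).
Let SL := set_sl _ _ _ _ _ ST.
Let CV := set_cont _ _ _ _ _ ST.

Definition clamp01 (u : R) : R := Rmin (Rmax u 0) 1.

Lemma clamp01_bounds u : 0 <= clamp01 u <= 1.
Proof. unfold clamp01, Rmin, Rmax; repeat destruct Rle_dec; lra. Qed.

(** Equal to 1 while [M j <= 1] for all [j < m], to 0 once some such [M j] reaches 2, and Lipschitz
    in between. *)
Fixpoint survive (M : nat -> (nat -> R) -> R) (m : nat) (x : nat -> R) : R :=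
  match m with O => 1 | S m => survive M m x * (1 - clamp01 (M m x - 1)) end.

Lemma survive_bounds M m x : 0 <= survive M m x <= 1.
Proof.
  induction m; simpl; [lra|]. assert (h := clamp01_bounds (M m x - 1)). nra.
Qed.

Lemma survive_BL M m : (forall j, BL j (M j)) -> BL m (survive M (S m)).
Proof.
  intros hM.
  assert (h1 : forall j, BL j (fun x => 1 - clamp01 (M j x - 1))).
  { intros j. apply BL_minus; [apply BL_const|].
    apply (BL_comp j (fun u => Rmin u 1)); [apply loc_lip_min|].
    apply (BL_comp j (fun u => Rmax u 0)); [apply loc_lip_max|].
    apply BL_minus; auto; apply BL_const. }
  induction m.
  - simpl. apply BL_mult; [apply BL_const|apply h1].
  - change (BL (S m) (fun x => survive M (S m) x * (1 - clamp01 (M (S m) x - 1)))).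
    apply BL_mult; [apply (BL_weaken m); auto|apply h1].
Qed.

Lemma survive_zero M m j x : (j < m)%nat -> 2 <= M j x -> survive M m x = 0.
Proof.
  intros hj h. induction m; [lia|]. simpl. destruct (Nat.eq_dec j m) as [->|].
  - replace (clamp01 (M m x - 1)) with 1; [ring|]. unfold clamp01, Rmin, Rmax; repeat destruct Rle_dec; lra.
  - rewrite IHm by lia; ring.
Qed.

(** One step of fractional stopping: a positive fraction is stopped only where [u >= 1], so
    replacing [u] by 1 on that fraction does not increase the value. *)
Lemma clamp_le_mul u : 0 <= u -> clamp01 (u - 1) + (1 - clamp01 (u - 1)) * u <= u.
Proof. intros hu. unfold clamp01, Rmin, Rmax; repeat destruct Rle_dec; nra. Qed.

(* The indicator of the hitting event is smoothed by [survive], since [EE] only acts on Lipschitz functions. *)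
Lemma maximal_inequality (M : nat -> (nat -> R) -> R) n : (forall j, BL j (M j)) -> (forall j x, 0 <= M j x) ->
  (forall j x, (j < n)%nat -> E0 (fun y => M (S j) (ext j x y)) <= M j x) ->
  V (fun w => exists j, (j <= n)%nat /\ 2 <= M j (Xp (X:=X) w)) <= EE (M O).
Proof.
  intros hM h0 hs.
  (* The smoothly stopped process: the stopped mass counts 1, the surviving mass counts [M m]. *)
  set (Q := fun m x => 1 - survive M (S m) x + survive M (S m) x * M m x).
  assert (hQ : forall m, BL m (Q m)).
  { intros m. apply BL_plus; [apply BL_minus; [apply BL_const|apply survive_BL; auto]|].
    apply BL_mult; auto. apply survive_BL; auto. }
  assert (hQn : forall m, (m <= n)%nat -> EE (Q m) <= EE (M O)).
  { induction m; intros hm.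
    - apply (EE_mono ST O O); auto. intros x. unfold Q. simpl.
      assert (h := clamp_le_mul (M O x) (h0 O x)). lra.
    - eapply Rle_trans; [|apply IHm; lia].
      (* The process after the next variable is revealed but before the stopping rule at [S m] acts;
         the supermartingale inequality compares its conditional mean with [Q m]. *)
      set (R1 := fun x => survive M (S m) x * M (S m) x + (1 - survive M (S m) x)).
      assert (hR1 : BL (S m) R1).
      { apply BL_plus; [apply BL_mult; auto|apply BL_minus; [apply BL_const|]]; apply (BL_weaken m); auto using survive_BL. }
      apply Rle_trans with (EE R1).
      + apply (EE_mono ST (S m) (S m)); auto. intros x. unfold Q, R1.
        change (survive M (S (S m)) x) with (survive M (S m) x * (1 - clamp01 (M (S m) x - 1))).
        assert (h := clamp_le_mul (M (S m) x) (h0 (S m) x)). assert (h' := survive_bounds M (S m) x). nra.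
      + rewrite (EE_step ST m R1 hR1). apply (EE_mono ST m m); auto; [apply (BL_integrate ST); auto|].
        intros x. unfold R1.
        replace (fun y => survive M (S m) (ext m x y) * M (S m) (ext m x y) + (1 - survive M (S m) (ext m x y)))
          with (fun y => survive M (S m) x * M (S m) (ext m x y) + (1 - survive M (S m) x)).
        * assert (hb : bdd_lip1 (fun y => M (S m) (ext m x y))) by (apply BL_section; auto).
          assert (h' := survive_bounds M (S m) x).
          rewrite (E0_translate ST) by (apply bl_mult; auto using bl_const).
          rewrite (E0_mult ST) by auto. specialize (hs m x ltac:(lia)). unfold Q. nra.
        * apply functional_extensionality; intros y.
          rewrite (BL_local m (survive M (S m)) (ext m x y) x); auto using survive_BL. intros; apply ext_lt; auto. }
  eapply Rle_trans; [|apply (hQn n); auto].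
  apply Rle_trans with (EE (fun x => 1 - survive M (S n) x)).
  - apply (V_le_EE ST n).
    + apply BL_minus; [apply BL_const|apply survive_BL; auto].
    + intros w. assert (h := survive_bounds M (S n) (Xp (X:=X) w)). lra.
    + intros w (j & hj & hw). rewrite (survive_zero M (S n) j (Xp (X:=X) w)) by (auto; lia). lra.
  - apply (EE_mono ST n n); auto; [apply BL_minus; [apply BL_const|apply survive_BL; auto]|].
    intros x. unfold Q. assert (h := survive_bounds M (S n) x). specialize (h0 n x). nra.
Qed.

Context (a : R) (ha : 0 < a) (hG : G_normal E a a X0).

Lemma gauss_shift_bl d x e : 0 < d -> bdd_lip1 (fun s => gauss d (e * s + x)).
Proof.
  intros hd. assert (h := bl_affine (gauss d) x e (gauss_bl d hd)).
  replace (fun s => gauss d (e * s + x)) with (fun s => gauss d (x + e * s)); auto.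
  apply functional_extensionality; intros; f_equal; ring.
Qed.

Lemma gauss_sign d x e : e = 1 \/ e = -1 -> gauss d (e * x) = gauss d x.
Proof. intros [-> | ->]; unfold gauss; do 2 f_equal; f_equal; ring. Qed.

Lemma E0_gauss_sign d x e : e = 1 \/ e = -1 -> 0 < d -> E0 (fun y => gauss d (e * y + x)) = gauss (d + a) x.
Proof.
  intros he hd. rewrite <- (gauss_sign (d + a) x e he), <- (E0_gauss (E:=E) (X0:=X0) a) by (auto; lra).
  f_equal. apply functional_extensionality; intros y. rewrite <- (gauss_sign d (e * y + x) e he). f_equal.
  destruct he as [-> | ->]; ring.
Qed.

Lemma H_Sn n : H (Sn X n).
Proof.
  induction n.
  - apply (sl_zero _ _ _ SL).
  - apply (sl_add _ _ _ SL (Sn X n) (X n)); auto. apply (set_H _ _ _ _ _ ST).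
Qed.

(* The factor 4 covers both the threshold 2 of [maximal_inequality] and the normalisation lost between variances [d] and [2 d]. *)
Lemma gauss_window d D r y : 0 < d -> d <= D <= 2 * d -> Rabs y <= r ->
  2 <= 4 * exp (ln d / 2 + r ^ 2 / (2 * d)) * gauss D y.
Proof.
  intros hd hD hy. unfold gauss. rewrite Rmult_assoc, <- exp_plus.
  assert (h1 : ln D <= ln d + 1).
  { rewrite <- (ln_exp 1) at 1. rewrite <- ln_mult by (auto using exp_pos).
    apply ln_le; [lra|]. assert (h := exp_ineq1_le 1). nra. }
  assert (h2 : y ^ 2 / (2 * D) <= r ^ 2 / (2 * d)).
  { assert (y ^ 2 <= r ^ 2) by (rewrite <- pow2_abs; apply pow_incr; split; auto using Rabs_pos).
    unfold Rdiv. apply Rmult_le_compat; auto; [nra|left; apply Rinv_0_lt_compat; lra|apply Rinv_le_contravar; lra]. }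
  assert (h3 := exp_ineq1_le (ln d / 2 + r ^ 2 / (2 * d) + (- ln D / 2 - y ^ 2 / (2 * D)))). lra.
Qed.

(** The half width [A d / v] is chosen so that the exponents combine to exactly [A^2 / (2 v)],
    whatever [d] is. At the origin, a Gaussian of variance [d + v] centred at [A + A d / v] has
    logarithmic slope [A / v], that of the optimal exponential tilt. *)
Lemma gauss_initial d v A : 0 < d -> 0 < v ->
  4 * exp (ln d / 2 + (A * d / v) ^ 2 / (2 * d)) * gauss (d + v) (- (A + A * d / v)) <= 4 * exp (- (A ^ 2 / (2 * v))).
Proof.
  intros hd hv. unfold gauss. rewrite Rmult_assoc, <- exp_plus. apply Rmult_le_compat_l; [lra|].
  assert (ln d <= ln (d + v)) by (apply ln_le; lra).
  replace (ln d / 2 + (A * d / v) ^ 2 / (2 * d) + (- ln (d + v) / 2 - (- (A + A * d / v)) ^ 2 / (2 * (d + v))))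
    with ((ln d - ln (d + v)) / 2 + - (A ^ 2 / (2 * v))) by (field; lra).
  destruct (Req_dec ((ln d - ln (d + v)) / 2 + - (A ^ 2 / (2 * v))) (- (A ^ 2 / (2 * v)))) as [->|]; [lra|].
  left; apply exp_increasing; lra.
Qed.

(** The windows from [A] to [A + 2 r] exhaust the half line as [N] grows while the bound does not
    depend on [N], so continuity from below concludes. In each window the martingale is a Gaussian
    of the partial sum whose variance drops by [a] with every revealed variable. *)
Lemma V_max_tail n e A : (0 < n)%nat -> e = 1 \/ e = -1 -> 0 < A ->
  V (fun w => exists j, (j <= n)%nat /\ A <= e * Sn X j w) <= 4 * exp (- (A ^ 2 / (2 * (INR n * a)))).
Proof.
  intros hn he hA.
  assert (hnp : 0 < INR n) by (apply lt_0_INR; auto).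
  set (v := INR n * a). assert (hv : 0 < v) by (apply Rmult_lt_0_compat; auto).
  set (Ev := fun N w => exists j, (j <= n)%nat /\ A <= e * Sn X j w /\ e * Sn X j w <= A + 2 * (A * INR (S N))).
  apply Rle_trans with (V (fun w => exists N, Ev N w)).
  { apply (V_mono SL). intros w (j & hj & h).
    destruct (INR_unbounded ((e * Sn X j w) / A)) as [N hN]. exists N, j. repeat split; auto.
    apply Rlt_le in hN. apply Rmult_le_compat_r with (r := A) in hN; [|lra].
    unfold Rdiv in hN; rewrite Rmult_assoc, Rinv_l, Rmult_1_r in hN by lra. rewrite S_INR.
    assert (0 <= INR N) by apply pos_INR. nra. }
  apply (V_exists_le SL CV).
  { intros N. apply (F_exists SL). intros j. apply (F_and SL); [apply (F_const SL)|].
    apply (F_and SL); [apply (F_ge SL)|apply (F_le SL)]; apply (sl_scal _ _ _ SL); apply H_Sn. }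
  { intros N w (j & hj & h1 & h2). exists j; repeat split; auto. rewrite (S_INR (S N)). lra. }
  (* A multiple of [v] by at least 1 keeps all variances between [d] and [2 d], as [gauss_window]
     requires; growth with [N] widens the window. *)
  intros N. set (d := v * INR (S N)).
  assert (hS : 1 <= INR (S N)) by (rewrite S_INR; assert (h := pos_INR N); lra).
  assert (hd : 0 < d) by (apply Rmult_lt_0_compat; lra).
  assert (hvd : v <= d) by (unfold d; nra).
  assert (hadv : A * d / v = A * INR (S N)) by (unfold d; field; lra).
  set (r := A * d / v). set (K := 4 * exp (ln d / 2 + r ^ 2 / (2 * d))).
  assert (hK : 0 < K) by (apply Rmult_lt_0_compat; [lra|apply exp_pos]).
  set (M := fun j x => K * gauss (d + INR (n - j) * a) (e * psum x j + - (A + r))).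
  assert (hDj : forall j, 0 <= INR (n - j) * a <= v).
  { intros j. split; [apply Rmult_le_pos; [apply pos_INR|lra]|]. unfold v. apply Rmult_le_compat_r; [lra|]. apply le_INR; lia. }
  assert (hM := maximal_inequality M n).
  eapply Rle_trans; [|eapply Rle_trans; [apply hM|]].
  - apply (V_mono SL). intros w (j & hj & h1 & h2). exists j; split; auto.
    unfold M, K. apply gauss_window; auto; [specialize (hDj j); lra|].
    change (psum (Xp w) j) with (Sn X j w). rewrite <- hadv in h2. fold r in h2. apply Rabs_le. lra.
  - intros j. unfold M. apply BL_scal. apply (BL_psum (fun s => gauss (d + INR (n - j) * a) (e * s + - (A + r)))).
    apply gauss_shift_bl. specialize (hDj j); lra.
  - intros j x. apply Rmult_le_pos; [lra|left; apply gauss_pos].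
  - intros j x hj. unfold M. right.
    replace (fun y => K * gauss (d + INR (n - S j) * a) (e * psum (ext j x y) (S j) + - (A + r)))
      with (fun y => K * gauss (d + INR (n - S j) * a) (e * y + (e * psum x j + - (A + r)))).
    + specialize (hDj (S j)). rewrite (E0_mult ST) by (apply gauss_shift_bl; lra).
      rewrite E0_gauss_sign by (auto; lra). f_equal. f_equal.
      replace (n - j)%nat with (S (n - S j)) by lia. rewrite (S_INR (n - S j)). ring.
    + apply functional_extensionality; intros y. simpl. rewrite ext_eq.
      rewrite (psum_ext (ext j x y) x j) by (intros; apply ext_lt; auto). do 2 f_equal. ring.
  - unfold M. simpl psum. rewrite (EE_const ST), Nat.sub_0_r. fold v. rewrite Rmult_0_r, Rplus_0_l.
    apply gauss_initial; auto.
Qed.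

Lemma V_coord_le f i A : bdd_lip1 f -> (forall y, 0 <= f y) -> (forall w, A w -> 1 <= f (X i w)) -> V A <= E0 f.
Proof.
  intros hf h0 h1. apply (V_le_E SL A (fun w => f (X i w))).
  - apply (H_BL ST (S i) (fun x => f (x i))). apply BL_coord; auto.
  - intros w; apply indic_le; auto.
  - rewrite (E_coord ST f i hf). apply Rle_refl.
Qed.

(** The windows of [V_max_tail] again, with one variable and no stopping. *)
Lemma V_coord_tail i e A : e = 1 \/ e = -1 -> 0 < A -> V (fun w => A <= e * X i w) <= 4 * exp (- (A ^ 2 / (2 * a))).
Proof.
  intros he hA.
  set (Ev := fun N w => A <= e * X i w /\ e * X i w <= A + 2 * (A * INR (S N))).
  apply Rle_trans with (V (fun w => exists N, Ev N w)).
  { apply (V_mono SL). intros w h.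
    destruct (INR_unbounded ((e * X i w) / A)) as [N hN]. exists N. split; auto.
    apply Rlt_le in hN. apply Rmult_le_compat_r with (r := A) in hN; [|lra].
    unfold Rdiv in hN; rewrite Rmult_assoc, Rinv_l, Rmult_1_r in hN by lra. rewrite S_INR.
    assert (0 <= INR N) by apply pos_INR. nra. }
  apply (V_exists_le SL CV).
  { intros N. apply (F_and SL); [apply (F_ge SL)|apply (F_le SL)]; apply (sl_scal _ _ _ SL); apply (set_H _ _ _ _ _ ST). }
  { intros N w (h1 & h2). split; auto. rewrite (S_INR (S N)). lra. }
  intros N. set (d := a * INR (S N)).
  assert (hS : 1 <= INR (S N)) by (rewrite S_INR; assert (h := pos_INR N); lra).
  assert (hd : 0 < d) by (apply Rmult_lt_0_compat; lra).
  assert (hadv : A * d / a = A * INR (S N)) by (unfold d; field; lra).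
  eapply Rle_trans; [|apply (gauss_initial d a A hd ha)].
  set (r := A * d / a). set (K := 4 * exp (ln d / 2 + r ^ 2 / (2 * d))).
  assert (hK : 0 < K) by (apply Rmult_lt_0_compat; [lra|apply exp_pos]).
  rewrite <- (E0_gauss_sign d _ e) by auto. rewrite <- (E0_mult ST) by (apply gauss_shift_bl; auto).
  apply (V_coord_le _ i).
  - apply bl_mult; [apply bl_const|apply gauss_shift_bl; auto].
  - intros y. apply Rmult_le_pos; [lra|left; apply gauss_pos].
  - intros w (h1 & h2). apply Rle_trans with 2; [lra|]. apply gauss_window; auto; [lra|].
    rewrite <- hadv in h2. fold r in h2. apply Rabs_le. lra.
Qed.

End Tails.

(** * Upper bound in the law of the iterated logarithm *)

Lemma exp_le x y : x <= y -> exp x <= exp y.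
Proof. intros [h| ->]; [left; apply exp_increasing; auto|lra]. Qed.

Lemma ln_le_sub1 x : 0 < x -> ln x <= x - 1.
Proof. intros h. assert (h' := exp_ineq1_le (ln x)). rewrite exp_ln in h'; lra. Qed.

Lemma psum_scal c f n : psum (fun k => c * f k) n = c * psum f n.
Proof. induction n; simpl; [ring|]. rewrite IHn; ring. Qed.

Lemma psum_geom r n : 0 <= r < 1 -> psum (fun k => r ^ k) n <= / (1 - r).
Proof.
  intros hr. assert (h : psum (fun k => r ^ k) n = (1 - r ^ n) * / (1 - r)).
  { induction n; simpl; [ring|]. rewrite IHn. field; lra. }
  rewrite h. assert (0 <= r ^ n) by (apply pow_le; lra).
  assert (0 < / (1 - r)) by (apply Rinv_0_lt_compat; lra). nra.
Qed.

(** The comparison of [sum n^(-1-e)] with an integral, done by telescoping: each term after the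
    first is at most [/ e] times the drop of [n^(-e)]. Real powers are written with [exp] and
    [ln]. *)
Lemma psum_zeta e n : 0 < e -> psum (fun k => exp (- (1 + e) * ln (INR (S k)))) n <= 1 + / e.
Proof.
  intros he. assert (hie : 0 < / e) by (apply Rinv_0_lt_compat; auto).
  destruct n as [|n]; [simpl; lra|].
  assert (h : psum (fun k => exp (- (1 + e) * ln (INR (S k)))) (S n) <= 1 + / e * (1 - exp (- e * ln (INR (S n))))).
  { induction n.
    - simpl. rewrite ln_1, !Rmult_0_r, exp_0. lra.
    - change (psum (fun k => exp (- (1 + e) * ln (INR (S k)))) (S n) + exp (- (1 + e) * ln (INR (S (S n))))
        <= 1 + / e * (1 - exp (- e * ln (INR (S (S n)))))).
      set (x := INR (S (S n))) in *. assert (hx : INR (S n) = x - 1) by (unfold x; rewrite (S_INR (S n)); ring).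
      assert (hx1 : 0 < x - 1) by (rewrite <- hx; apply lt_0_INR; lia).
      assert (hl : ln (INR (S n)) <= ln x - / x).
      { rewrite hx. replace (x - 1) with (x * (1 - / x)) by (field; lra).
        assert (0 < 1 - / x) by (apply Rmult_lt_reg_r with x; [lra|]; field_simplify; lra).
        rewrite ln_mult by lra. assert (h := ln_le_sub1 (1 - / x) H). lra. }
      assert (h1 : exp (- e * ln x) * (1 + e * / x) <= exp (- e * ln (INR (S n)))).
      { apply Rle_trans with (exp (- e * ln x) * exp (e * / x)).
        - apply Rmult_le_compat_l; [left; apply exp_pos|apply exp_ineq1_le].
        - rewrite <- exp_plus. apply exp_le. nra. }
      assert (h2 : exp (- (1 + e) * ln x) = exp (- e * ln x) * / x).
      { rewrite <- (exp_ln x) at 3 by lra. rewrite <- exp_Ropp, <- exp_plus. f_equal; ring. }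
      rewrite h2.
      assert (h3 : / e * (exp (- e * ln x) * (1 + e * / x)) <= / e * exp (- e * ln (INR (S n)))) by (apply Rmult_le_compat_l; lra).
      replace (/ e * (exp (- e * ln x) * (1 + e * / x))) with (/ e * exp (- e * ln x) + exp (- e * ln x) * / x) in h3 by (field; lra).
      lra. }
  assert (0 < exp (- e * ln (INR (S n)))) by apply exp_pos. nra.
Qed.

Lemma exp_pow_n x n : exp x ^ n = exp (INR n * x).
Proof.
  induction n; [simpl; rewrite Rmult_0_l, exp_0; auto|].
  simpl pow. rewrite IHn, <- exp_plus, S_INR. f_equal; ring.
Qed.

Lemma exp_neg_le_inv z : 0 < z -> exp (- z) <= / z.
Proof.
  intros hz. rewrite exp_Ropp. apply Rinv_le_contravar; auto.
  assert (h := exp_ineq1_le z). lra.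
Qed.

(** [exp_neg_le_inv] at [z / INR p], raised to the power [p]. *)
Lemma exp_neg_le_inv_pow p z : (0 < p)%nat -> 0 < z -> exp (- z) <= (INR p / z) ^ p.
Proof.
  intros hp hz. assert (h0 : 0 < INR p) by (apply lt_0_INR; auto).
  assert (h : exp (- z) = exp (- (z / INR p)) ^ p).
  { rewrite exp_pow_n. f_equal. field. lra. }
  rewrite h. apply pow_incr. split; [left; apply exp_pos|].
  replace (INR p / z) with (/ (z / INR p)) by (field; split; lra).
  apply exp_neg_le_inv. apply Rdiv_lt_0_compat; auto.
Qed.

Section Laws.
Context {Omega : Type} {F : (Omega -> Prop) -> Prop}
  {H : (Omega -> R) -> Prop} {E : (Omega -> R) -> Rbar}
  {X0 : Omega -> R} {X : nat -> Omega -> R} (ST : setting F H E X0 X).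
Local Notation V := (Vcap H E).
Local Notation EE := (Eseq (E:=E) (X:=X)).
Local Notation E0 := (Eone (E:=E) (X0:=X0)).
Local Notation as_ := (almost_surely (F:=F) (H:=H) (E:=E)).
Let SL := set_sl _ _ _ _ _ ST.
Let CV := set_cont _ _ _ _ _ ST.
Context (a : R) (ha : 0 < a) (hG : G_normal E a a X0).

(** The level [A k] is read at the left end of the [k]-th time block, while the maximal inequality
    runs to its right end. The ratio of the ends consumes one of the two factors [1 + eps] in
    [A k ^ 2]; the other one leaves the summable order [k^(-1-eps)]. *)
Proposition lil_upper e eps : e = 1 \/ e = -1 -> 0 < eps ->
  as_ (fun w => exists N, forall n, (N <= n)%nat ->
    e * Sn X n w <= (1 + eps) * sqrt (2 * a * (INR n * ln (ln (INR n))))).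
Proof.
  intros he heps.
  (* One half of [ln (1 + eps)] pays for the ratio of consecutive times, the other half for rounding
     up to an integer. *)
  set (dl := ln (1 + eps) / 2).
  assert (hdl : 0 < dl) by (unfold dl; assert (h := ln_increasing 1 (1 + eps) Rlt_0_1); rewrite ln_1 in h; lra).
  assert (hnk : forall k, exists n : nat, exp (INR (S k) * dl) < INR n <= exp (INR (S k) * dl) + 1).
  { intros k. destruct (nfloor_ex (exp (INR (S k) * dl))) as [m hm]; [left; apply exp_pos|].
    exists (S m). rewrite (S_INR m). lra. }
  destruct (ClassicalEpsilon.choice _ hnk) as [nk hn]. clear hnk.
  set (A := fun k => (1 + eps) * sqrt (2 * a * (exp (INR k * dl) * ln (INR k * dl)))).
  destruct (INR_unbounded (1 + / dl + / (dl * dl))) as [k0 hk0].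
  assert (hidl : 0 < / dl) by (apply Rinv_0_lt_compat; auto).
  assert (hidl2 : 0 < / (dl * dl)) by (apply Rinv_0_lt_compat; nra).
  (* The second bound makes the iterated logarithm positive; the third absorbs the rounding in
     [nk k]. *)
  assert (hk : forall k, (k0 <= k)%nat -> 1 <= INR k /\ 1 < INR k * dl /\ 1 <= INR k * (dl * dl)).
  { intros k hk. apply le_INR in hk. split; [lra|]. split.
    - apply Rlt_le_trans with (/ dl * dl + dl); [rewrite Rinv_l; lra|]. nra.
    - apply Rle_trans with (/ (dl * dl) * (dl * dl)); [rewrite Rinv_l; nra|].
      apply Rmult_le_compat_r; nra. }
  set (Cst := 4 * exp (- (1 + eps) * ln (dl / 2))).
  assert (hC : 0 < Cst) by (apply Rmult_lt_0_compat; [lra|apply exp_pos]).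
  assert (hbc : as_ (fun w => exists n, forall k, (n <= k)%nat -> ~ exists j, (j <= nk k)%nat /\ A k <= e * Sn X j w)).
  { apply (borel_cantelli SL CV (fun k w => exists j, (j <= nk k)%nat /\ A k <= e * Sn X j w)
      (fun k => Cst * exp (- (1 + eps) * ln (INR (S k)))) (Cst * (1 + / eps))).
    - intros k. apply (F_exists SL); intros j. apply (F_and SL); [apply (F_const SL)|]. apply (F_ge SL).
      apply (sl_scal _ _ _ SL). apply (H_Sn ST).
    - intros n. rewrite psum_scal. apply Rmult_le_compat_l; [lra|]. apply psum_zeta; auto.
    - intros k. apply Rmult_le_pos; [lra|left; apply exp_pos].
    - exists k0. intros k hkk. destruct (hk k hkk) as (h1 & h2 & h3).
      assert (hnp := hn k).
      assert (hlp : 0 < ln (INR k * dl)) by (rewrite <- ln_1; apply ln_increasing; lra).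
      assert (hep := exp_pos (INR k * dl)).
      assert (hin : 0 < 2 * a * (exp (INR k * dl) * ln (INR k * dl))).
      { apply Rmult_lt_0_compat; [lra|]. apply Rmult_lt_0_compat; auto. }
      assert (hA : 0 < A k) by (apply Rmult_lt_0_compat; [lra|apply sqrt_lt_R0; auto]).
      assert (hnpos : 0 < INR (nk k)) by (assert (h := exp_pos (INR (S k) * dl)); lra).
      eapply Rle_trans; [apply (V_max_tail ST a ha hG); auto; apply INR_lt; auto|].
      unfold Cst. rewrite Rmult_assoc, <- exp_plus. apply Rmult_le_compat_l; [lra|]. apply exp_le.
      assert (hA2 : A k ^ 2 = (1 + eps) ^ 2 * (2 * a * (exp (INR k * dl) * ln (INR k * dl)))).
      { unfold A. rewrite Rpow_mult_distr, pow2_sqrt; lra. }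
      assert (hnle : INR (nk k) <= exp (INR k * dl) * (1 + eps)).
      { assert (h1e : exp dl * exp dl = 1 + eps).
        { rewrite <- exp_plus. unfold dl. replace (ln (1 + eps) / 2 + ln (1 + eps) / 2) with (ln (1 + eps)) by field. apply exp_ln; lra. }
        assert (hS : exp (INR (S k) * dl) = exp (INR k * dl) * exp dl).
        { rewrite <- exp_plus. f_equal. rewrite S_INR; ring. }
        assert (g1 := exp_ineq1_le dl). assert (g2 := exp_ineq1_le (INR k * dl)).
        assert (1 <= exp (INR k * dl) * exp dl * dl).
        { apply Rle_trans with (INR k * dl * 1 * dl); [nra|]. apply Rmult_le_compat_r; [lra|].
          apply Rmult_le_compat; nra. }
        rewrite <- h1e. rewrite <- Rmult_assoc, <- hS. rewrite <- hS in H0. assert (hx := exp_pos (INR (S k) * dl)). nra. }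
      assert (hmain : (1 + eps) * ln (INR k * dl) <= A k ^ 2 / (2 * (INR (nk k) * a))).
      { apply Rmult_le_reg_r with (2 * (INR (nk k) * a)); [nra|].
        replace (A k ^ 2 / (2 * (INR (nk k) * a)) * (2 * (INR (nk k) * a))) with (A k ^ 2) by (field; lra). rewrite hA2.
        apply Rle_trans with ((1 + eps) * ln (INR k * dl) * (2 * (exp (INR k * dl) * (1 + eps) * a))).
        - apply Rmult_le_compat_l; [nra|]. nra.
        - right; ring. }
      (* [INR k >= INR (S k) / 2] passes to the index used by [psum_zeta], at the price of the
         constant [Cst]. *)
      assert (hln : ln (dl / 2) + ln (INR (S k)) <= ln (INR k * dl)).
      { rewrite <- ln_mult; [|lra|rewrite S_INR; lra]. apply ln_le.
        - apply Rmult_lt_0_compat; [lra|rewrite S_INR; lra].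
        - rewrite S_INR. nra. }
      nra. }
  apply (as_mono _ _ hbc). intros w [k1 hw].
  set (k2 := max k0 k1).
  destruct (INR_unbounded (exp (INR (S k2) * dl))) as [N hN].
  exists N. intros n hNn.
  assert (hn1 : exp (INR (S k2) * dl) < INR n) by (apply le_INR in hNn; lra).
  assert (hnp : 0 < INR n) by (assert (h := exp_pos (INR (S k2) * dl)); lra).
  assert (hln : INR (S k2) * dl < ln (INR n)).
  { rewrite <- (ln_exp (INR (S k2) * dl)). apply ln_increasing; auto. apply exp_pos. }
  assert (hq : INR (S k2) < ln (INR n) / dl).
  { apply Rmult_lt_reg_r with dl; auto. unfold Rdiv. rewrite Rmult_assoc, Rinv_l by lra. lra. }
  (* [k] is the block of [n]: [exp (k dl) <= n < exp ((k + 1) dl)]. *)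
  destruct (nfloor_ex (ln (INR n) / dl)) as [k [hka hkb]].
  { assert (h := pos_INR (S k2)). lra. }
  assert (hk2 : (k2 <= k)%nat).
  { assert (S k2 < S k)%nat; [|lia]. apply INR_lt. rewrite (S_INR k). lra. }
  assert (hka' : INR k * dl <= ln (INR n)).
  { apply Rmult_le_compat_r with (r := dl) in hka; [|lra]. unfold Rdiv in hka. rewrite Rmult_assoc, Rinv_l in hka by lra. lra. }
  assert (hkb' : ln (INR n) < INR (S k) * dl).
  { rewrite S_INR. apply Rmult_lt_compat_r with (r := dl) in hkb; [|lra]. unfold Rdiv in hkb. rewrite Rmult_assoc, Rinv_l in hkb by lra. lra. }
  destruct (hk k) as (g1 & g2 & _); [unfold k2 in *; lia|].
  apply Rnot_lt_le; intros hlt. apply (hw k); [unfold k2 in *; lia|].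
  exists n. split.
  - apply INR_le. left. eapply Rlt_trans; [|apply hn]. rewrite <- (exp_ln (INR n)) by auto. apply exp_increasing; auto.
  - eapply Rle_trans; [|left; apply hlt]. unfold A. apply Rmult_le_compat_l; [lra|]. apply sqrt_le_1_alt.
    apply Rmult_le_compat_l; [lra|].
    assert (0 < ln (INR k * dl)) by (rewrite <- ln_1; apply ln_increasing; lra).
    apply Rmult_le_compat; [left; apply exp_pos|lra| |].
    + rewrite <- (exp_ln (INR n)) by auto. apply exp_le; auto.
    + apply ln_le; lra.
Qed.

End Laws.

(** * Sums of squares *)

(** The Gaussian rescaled to the value 1 at the origin; its mean is the Laplace transform of the
    squared variable at [1 / (2 d)]. *)
Definition laplace (d x : R) : R := exp (ln d / 2) * gauss d x.

Lemma laplace_eq d x : laplace d x = exp (- (x ^ 2 / (2 * d))).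
Proof. unfold laplace, gauss. rewrite <- exp_plus. f_equal. lra. Qed.

Lemma laplace_bl d : 0 < d -> bdd_lip1 (laplace d).
Proof. intros hd. apply bl_mult; [apply bl_const|apply gauss_bl; auto]. Qed.

Definition clip (c x : R) : R := Rmax (- c) (Rmin x c).

Lemma clip_bl c : 0 <= c -> bdd_lip1 (clip c).
Proof.
  intros hc. split.
  - exists c. intros x. unfold clip. apply Rabs_le. unfold Rmin, Rmax; repeat destruct Rle_dec; lra.
  - exists 1. intros x y. rewrite Rmult_1_l. unfold clip, Rmin, Rmax; repeat destruct Rle_dec; unfold Rabs; repeat destruct Rcase_abs; lra.
Qed.

Lemma loc_lip_sq : loc_lip (fun u => u ^ 2).
Proof.
  intros M. exists (2 * Rabs M). split; [assert (h := Rabs_pos M); lra|]. intros u v hu hv.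
  replace (u ^ 2 - v ^ 2) with ((u + v) * (u - v)) by ring. rewrite Rabs_mult.
  apply Rmult_le_compat_r; [apply Rabs_pos|]. eapply Rle_trans; [apply Rabs_triang|].
  assert (h := Rle_abs M). lra.
Qed.

Definition sq_clip (c x : R) : R := clip c x ^ 2.

Lemma sq_clip_bl c : 0 <= c -> bdd_lip1 (sq_clip c).
Proof. intros hc. apply (bl_comp (fun u => u ^ 2) (clip c)); [apply loc_lip_sq|apply clip_bl; auto]. Qed.

Lemma sq_clip_bounds c x : 0 <= c -> 0 <= sq_clip c x <= c ^ 2 /\ sq_clip c x <= x ^ 2.
Proof.
  intros hc. unfold sq_clip. split; [split; [apply pow2_ge_0|]|];
  unfold clip, Rmin, Rmax; repeat destruct Rle_dec; nra.
Qed.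

Lemma sq_clip_eq c x : Rabs x <= c -> sq_clip c x = x ^ 2.
Proof.
  intros h. apply Rabs_le_between in h. unfold sq_clip, clip.
  rewrite Rmin_left, Rmax_right by lra. auto.
Qed.

Lemma prodn_exp (f g : R -> R) n x : (forall y, f y = exp (g y)) -> prodn f n x = exp (psum (fun j => g (x j)) n).
Proof.
  intros h. unfold prodn. induction n; simpl; [rewrite exp_0; auto|]. rewrite exp_plus, IHn, h; auto.
Qed.

Section Squares.
Context {Omega : Type} {F : (Omega -> Prop) -> Prop}
  {H : (Omega -> R) -> Prop} {E : (Omega -> R) -> Rbar}
  {X0 : Omega -> R} {X : nat -> Omega -> R} (ST : setting F H E X0 X).
Local Notation V := (Vcap H E).
Local Notation EE := (Eseq (E:=E) (X:=X)).
Local Notation E0 := (Eone (E:=E) (X0:=X0)).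
Local Notation as_ := (almost_surely (F:=F) (H:=H) (E:=E)).
Let SL := set_sl _ _ _ _ _ ST.
Let CV := set_cont _ _ _ _ _ ST.
Context (a : R) (ha : 0 < a) (hG : G_normal E a a X0).

Lemma E0_laplace d : 0 < d -> E0 (laplace d) = exp (- ln (1 + a / d) / 2).
Proof.
  intros hd. unfold laplace. rewrite (E0_mult ST) by (apply gauss_bl; auto).
  replace (gauss d) with (fun y => gauss d (1 * y + 0)) by (apply functional_extensionality; intros; f_equal; ring).
  rewrite (E0_gauss_sign a ha hG) by auto. unfold gauss. rewrite <- exp_plus.
  assert (h : ln (d + a) = ln d + ln (1 + a / d)).
  { assert (0 < a / d) by (apply Rdiv_lt_0_compat; auto). rewrite <- ln_mult by lra. f_equal. field. lra. }
  rewrite h. f_equal. field. lra.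
Qed.

(** The square has polynomial growth of exponent 1 in the sense of [lip_poly], so [sl_closed_lip]
    covers it although it is unbounded. *)
Lemma H_sumsq n : H (fun w => psum (fun i => X i w ^ 2) n).
Proof.
  induction n; [apply (sl_zero _ _ _ SL)|].
  apply (sl_add _ _ _ SL (fun w => psum (fun i => X i w ^ 2) n) (fun w => X n w ^ 2)); auto.
  apply (sl_closed_lip _ _ _ SL 1 (fun x => x O ^ 2) (fun _ => X n)).
  - intros; apply (set_H _ _ _ _ _ ST).
  - assert (hs : forall v, normn 1 v = Rabs (v O)).
    { intros v. unfold normn. simpl sumsq. rewrite <- sqrt_Rsqr_abs. f_equal. unfold Rsqr; ring. }
    exists 1, 1%nat. intros x y. rewrite !hs, !pow_1. unfold vsub.
    replace (x O ^ 2 - y O ^ 2) with ((x O + y O) * (x O - y O)) by ring. rewrite Rabs_mult.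
    apply Rmult_le_compat_r; [apply Rabs_pos|].
    assert (h := Rabs_triang (x O) (y O)). lra.
Qed.

(** A Chernoff bound with Laplace parameter [eps / (2 a)]. The lower tail uses a bounded test
    function directly, and the bound [r ^ n] is summable over all times. *)
Proposition sumsq_lower eps : 0 < eps < 1 ->
  as_ (fun w => exists N, forall n, (N <= n)%nat -> (1 - eps) * (INR n * a) <= psum (fun i => X i w ^ 2) n).
Proof.
  intros he. set (d := a / eps). assert (hd : 0 < d) by (apply Rdiv_lt_0_compat; lra).
  (* The bound per variable; it is below 1 because [ln (1 + eps) >= eps / (1 + eps)], which exceeds
     [(1 - eps) eps]. *)
  set (r := exp ((1 - eps) * eps / 2 - ln (1 + eps) / 2)).
  assert (hr : 0 <= r < 1).
  { split; [left; apply exp_pos|]. apply Rlt_le_trans with (exp 0); [|rewrite exp_0; lra]. apply exp_increasing.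
    assert (h := ln_le_sub1 (/ (1 + eps)) ltac:(apply Rinv_0_lt_compat; lra)). rewrite ln_Rinv in h by lra.
    assert ((1 - eps) * eps < 1 - / (1 + eps)); [|lra].
    apply Rmult_lt_reg_r with (1 + eps); [lra|]. replace ((1 - / (1 + eps)) * (1 + eps)) with eps by (field; lra).
    assert (0 < eps * eps * eps) by (repeat apply Rmult_lt_0_compat; lra). lra. }
  apply (as_mono (fun w => exists n, forall k, (n <= k)%nat -> ~ psum (fun i => X i w ^ 2) k < (1 - eps) * (INR k * a))).
  2:{ intros w [N hN]. exists N. intros n hn. apply Rnot_lt_le; auto. }
  apply (borel_cantelli SL CV (fun k w => psum (fun i => X i w ^ 2) k < (1 - eps) * (INR k * a)) (fun k => r ^ k) (/ (1 - r))).
  - intros k. apply (F_lt SL (fun w => psum (fun i => X i w ^ 2) k)), H_sumsq.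
  - intros n; apply psum_geom; auto.
  - intros k; apply pow_le; lra.
  - exists O. intros k _.
    assert (hL := laplace_bl d hd).
    assert (hL0 : forall y, 0 <= laplace d y) by (intros; rewrite laplace_eq; left; apply exp_pos).
    set (K := exp ((1 - eps) * eps / 2 * INR k)).
    apply Rle_trans with (EE (fun x => K * prodn (laplace d) k x)).
    + apply (V_le_EE ST k).
      * apply BL_scal, BL_prodn; auto.
      * intros w. apply Rmult_le_pos; [left; apply exp_pos|apply prodn_nonneg; auto].
      * intros w hw. rewrite (prodn_exp _ _ _ _ (laplace_eq d)). unfold K. rewrite <- exp_plus.
        apply Rle_trans with (exp 0); [rewrite exp_0; lra|]. apply exp_le.
        rewrite (psum_ext _ (fun j => - / (2 * d) * (Xp (X:=X) w j) ^ 2)) by (intros; field; lra).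
        rewrite psum_scal. change (fun k => Xp w k ^ 2) with (fun i => X i w ^ 2).
        assert (h2d : / (2 * d) = eps / (2 * a)) by (unfold d; field; lra). rewrite h2d.
        apply Rmult_lt_compat_l with (r := eps / (2 * a)) in hw; [|apply Rdiv_lt_0_compat; lra].
        replace (eps / (2 * a) * ((1 - eps) * (INR k * a))) with ((1 - eps) * eps / 2 * INR k) in hw by (field; lra). lra.
    + rewrite (EE_scal ST k) by (try apply BL_prodn; auto; left; apply exp_pos).
      rewrite (EE_prodn ST) by auto. rewrite E0_laplace by auto.
      replace (a / d) with eps by (unfold d; field; lra).
      unfold K, r. rewrite !exp_pow_n, <- exp_plus. apply exp_le. right; field.
Qed.

(** [2 d (1 - laplace d y)] tends to [y^2] as [d] grows and has an explicit mean. Up to an error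
    [K^2 / d] it dominates the truncated square. *)
Lemma E0_sq_clip c : 0 <= c -> E0 (sq_clip c) <= a.
Proof.
  intros hc. apply le_epsilon. intros eta heta.
  set (K := c ^ 2). assert (hK : 0 <= K) by (unfold K; nra).
  (* Large enough for [K^2 / d <= eta]. *)
  set (d := (K ^ 2 + 1) / eta + K). assert (0 < (K ^ 2 + 1) / eta) by (apply Rdiv_lt_0_compat; nra).
  assert (hd : 0 < d) by (unfold d; lra).
  assert (hid : 0 < / d) by (apply Rinv_0_lt_compat; auto).
  assert (hb : bdd_lip1 (fun y => - (2 * d) * laplace d y)) by (apply bl_mult; [apply bl_const|apply laplace_bl; auto]).
  apply Rle_trans with (E0 (fun y => - (2 * d) * laplace d y + (2 * d + K ^ 2 / d))).
  - apply (E0_mono ST); [apply sq_clip_bl; auto|apply bl_plus; auto using bl_const|].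
    intros y. destruct (sq_clip_bounds c y hc) as [[h1 h2] h3]. fold K in h2. set (m := sq_clip c y) in *.
    rewrite laplace_eq.
    assert (e1 : exp (- (y ^ 2 / (2 * d))) <= exp (- (m / (2 * d)))).
    { apply exp_le. apply Ropp_le_contravar. apply Rmult_le_compat_r; auto. left; apply Rinv_0_lt_compat; lra. }
    assert (hm : 0 <= m / (2 * d)) by (apply Rmult_le_pos; auto; left; apply Rinv_0_lt_compat; lra).
    assert (e2 := exp_le_quadratic (- (m / (2 * d))) ltac:(lra)).
    assert (e3 : 2 * d * exp (- (y ^ 2 / (2 * d))) <= 2 * d * (1 + - (m / (2 * d)) + 2 * (- (m / (2 * d))) ^ 2)) by (apply Rmult_le_compat_l; lra).
    replace (2 * d * (1 + - (m / (2 * d)) + 2 * (- (m / (2 * d))) ^ 2)) with (2 * d - m + m ^ 2 / d) in e3 by (field; lra).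
    assert (m ^ 2 / d <= K ^ 2 / d) by (apply Rmult_le_compat_r; [lra|]; apply pow_incr; lra). lra.
  - rewrite (E0_translate ST), (E0_mult ST), E0_laplace by (auto; apply laplace_bl; auto).
    assert (had : 0 < a / d) by (apply Rdiv_lt_0_compat; auto).
    assert (h1 := exp_ineq1_le (- ln (1 + a / d) / 2)).
    assert (h2 := ln_le_sub1 (1 + a / d) ltac:(lra)).
    assert (h3 : 2 * d * (1 - a / d / 2) <= 2 * d * exp (- ln (1 + a / d) / 2)) by (apply Rmult_le_compat_l; lra).
    replace (2 * d * (1 - a / d / 2)) with (2 * d - a) in h3 by (field; lra).
    assert (K ^ 2 / d <= eta); [|lra].
    apply Rmult_le_reg_r with d; auto. unfold Rdiv; rewrite Rmult_assoc, Rinv_l by lra.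
    unfold d. rewrite Rmult_plus_distr_l. replace (eta * ((K ^ 2 + 1) / eta)) with (K ^ 2 + 1) by (field; lra). nra.
Qed.

(** The upper tail would need [exp (lam x^2)], which is unbounded, so the variables are cut at [c].
    The factor 8 is the 4 of [V_coord_tail] for each sign; the last term is the Chernoff bound for
    the truncated squares. *)
Lemma V_sumsq_upper n c eps : 0 < eps -> 0 < c -> eps * a <= 2 * c ^ 2 ->
  V (fun w => (1 + eps) * (INR n * a) < psum (fun i => X i w ^ 2) n) <=
  8 * INR n * exp (- (c ^ 2 / (2 * a))) + exp (- (INR n * (eps ^ 2 * a ^ 2) / (8 * c ^ 4))).
Proof.
  intros he hc hec.
  set (big := fun e w => exists i, (i < n)%nat /\ c <= e * X i w).
  assert (hbig : forall e, e = 1 \/ e = -1 -> V (big e) <= 4 * INR n * exp (- (c ^ 2 / (2 * a)))).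
  { intros e hee. eapply Rle_trans; [apply (V_finite_union_le SL (fun i w => c <= e * X i w) (fun _ => 4 * exp (- (c ^ 2 / (2 * a)))))|].
    - intros k. apply (V_coord_tail ST a ha hG); auto.
    - right. generalize (exp (- (c ^ 2 / (2 * a)))). clear. intros z. induction n; [simpl; ring|]. rewrite S_INR. simpl psum. rewrite IHn. ring. }
  (* The minimiser of the exponent per variable, [- lam eps a + 2 lam^2 c^4]. The hypothesis
     relating [eps * a] and [c] says exactly that [lam c^2 <= 1/2]. *)
  set (lam := eps * a / (4 * c ^ 4)).
  assert (hc2 : 0 < c ^ 2) by (apply pow_lt; auto). assert (hc4 : 0 < c ^ 4) by (apply pow_lt; auto).
  assert (hlam : 0 < lam) by (apply Rdiv_lt_0_compat; nra).
  assert (hlc : lam * c ^ 2 <= / 2).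
  { unfold lam. replace (eps * a / (4 * c ^ 4) * c ^ 2) with (eps * a / (4 * c ^ 2)) by (field; lra).
    apply Rmult_le_reg_r with (4 * c ^ 2); [lra|]. unfold Rdiv. rewrite Rmult_assoc, Rinv_l by lra. lra. }
  set (f := fun y => exp (lam * sq_clip c y)).
  assert (hf : bdd_lip1 f).
  { apply (bl_comp exp (fun y => lam * sq_clip c y)); [apply loc_lip_exp|].
    apply bl_mult; [apply bl_const|apply sq_clip_bl; lra]. }
  assert (hf0 : forall y, 0 <= f y) by (intros; left; apply exp_pos).
  assert (hEf : E0 f <= exp (lam * a + 2 * (lam * c ^ 2) ^ 2)).
  { apply Rle_trans with (E0 (fun y => lam * sq_clip c y + (1 + 2 * (lam * c ^ 2) ^ 2))).
    - apply (E0_mono ST); auto.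
      + apply bl_plus; [|apply bl_const]. apply bl_mult; [apply bl_const|apply sq_clip_bl; lra].
      + intros y. destruct (sq_clip_bounds c y) as [[h1 h2] _]; [lra|].
        assert (h3 : lam * sq_clip c y <= lam * c ^ 2) by (apply Rmult_le_compat_l; lra).
        assert (h4 := exp_le_quadratic (lam * sq_clip c y) ltac:(lra)). fold (f y) in h4.
        assert (0 <= lam * sq_clip c y) by (apply Rmult_le_pos; lra).
        assert ((lam * sq_clip c y) ^ 2 <= (lam * c ^ 2) ^ 2) by (apply pow_incr; lra). lra.
    - rewrite (E0_translate ST) by (apply bl_mult; [apply bl_const|apply sq_clip_bl; lra]).
      rewrite (E0_mult ST) by (apply sq_clip_bl; lra).
      assert (h := E0_sq_clip c ltac:(lra)). assert (h' := exp_ineq1_le (lam * a + 2 * (lam * c ^ 2) ^ 2)). nra. }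
  set (tr := fun w => (1 + eps) * (INR n * a) < psum (fun i => sq_clip c (X i w)) n).
  assert (htr : V tr <= exp (- (INR n * (eps ^ 2 * a ^ 2) / (8 * c ^ 4)))).
  { set (K := exp (- lam * ((1 + eps) * (INR n * a)))).
    apply Rle_trans with (EE (fun x => K * prodn f n x)).
    - apply (V_le_EE ST n).
      + apply BL_scal, BL_prodn; auto.
      + intros w. apply Rmult_le_pos; [left; apply exp_pos|apply prodn_nonneg; auto].
      + intros w hw. rewrite (prodn_exp f (fun y => lam * sq_clip c y)) by auto. unfold K. rewrite <- exp_plus.
        apply Rle_trans with (exp 0); [rewrite exp_0; lra|]. apply exp_le. rewrite psum_scal. unfold tr in hw. unfold Xp.
        apply Rmult_lt_compat_l with (r := lam) in hw; auto. lra.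
    - rewrite (EE_scal ST n) by (try apply BL_prodn; auto; left; apply exp_pos).
      rewrite (EE_prodn ST) by auto.
      apply Rle_trans with (K * exp (lam * a + 2 * (lam * c ^ 2) ^ 2) ^ n).
      + apply Rmult_le_compat_l; [left; apply exp_pos|]. apply pow_incr. split; auto. apply (E0_nonneg ST); auto.
      + unfold K. rewrite exp_pow_n, <- exp_plus. apply exp_le. right. unfold lam. field. lra. }
  assert (h1 := hbig 1 (or_introl eq_refl)). assert (h2 := hbig (-1) (or_intror eq_refl)).
  apply Rle_trans with (V (fun w => (big 1 w \/ big (-1) w) \/ tr w)).
  - apply (V_mono SL). intros w hw.
    destruct (classic (big 1 w \/ big (-1) w)) as [|hn]; auto. right. unfold tr.
    rewrite (psum_ext _ (fun i => X i w ^ 2)); auto. intros j hj. apply sq_clip_eq.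
    apply Rabs_le. split; apply Rnot_lt_le; intros hl; apply hn; [right|left]; exists j; split; auto; lra.
  - eapply Rle_trans; [apply (V_union SL)|]. assert (h3 := V_union SL (big 1) (big (-1))). lra.
Qed.

(** At time [(b ^ 8) ^ k] the truncation level [b ^ k] is the exact eighth root of the time. Both
    error terms are then of order [c^(-4)] with [c = b ^ k], which is geometric in [k]. *)
Proposition sumsq_upper b eps : (2 <= b)%nat -> 0 < eps ->
  as_ (fun w => exists N, forall k, (N <= k)%nat ->
    psum (fun i => X i w ^ 2) ((b ^ 8) ^ k) <= (1 + eps) * (INR ((b ^ 8) ^ k) * a)).
Proof.
  intros hb he. set (y := INR b). assert (hy : 2 <= y) by (apply (le_INR 2); auto).
  set (r := / y ^ 4).
  assert (hr : 0 <= r < 1).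
  { unfold r. split; [left; apply Rinv_0_lt_compat, pow_lt; lra|]. rewrite <- Rinv_1. apply Rinv_lt_contravar; [rewrite Rmult_1_l; apply pow_lt; lra|].
    apply Rlt_pow_R1; [lra|lia]. }
  set (C := 8 * (6 * (2 * a)) ^ 6 + 8 / (eps ^ 2 * a ^ 2)).
  apply (as_mono (fun w => exists n, forall k, (n <= k)%nat -> ~ (1 + eps) * (INR ((b ^ 8) ^ k) * a) < psum (fun i => X i w ^ 2) ((b ^ 8) ^ k))).
  2:{ intros w [N hN]. exists N. intros n hn. apply Rnot_lt_le; auto. }
  assert (hC : 0 < C).
  { unfold C. assert (0 < (6 * (2 * a)) ^ 6) by (apply pow_lt; lra).
    assert (0 < 8 / (eps ^ 2 * a ^ 2)) by (apply Rdiv_lt_0_compat; [lra|]; apply Rmult_lt_0_compat; apply pow_lt; auto). lra. }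
  apply (borel_cantelli SL CV
    (fun k w => (1 + eps) * (INR ((b ^ 8) ^ k) * a) < psum (fun i => X i w ^ 2) ((b ^ 8) ^ k)) (fun k => C * r ^ k) (C * / (1 - r))).
  - intros k. apply (F_gt SL (fun w => psum (fun i => X i w ^ 2) ((b ^ 8) ^ k))), H_sumsq.
  - intros n; rewrite psum_scal. apply Rmult_le_compat_l; [lra|]. apply psum_geom; auto.
  - intros k; apply Rmult_le_pos; [lra|]. apply pow_le; lra.
  - destruct (Pow_x_infinity y ltac:(rewrite Rabs_right; lra) (eps * a + 1)) as [k0 hk0].
    exists k0. intros k hk. specialize (hk0 k hk). set (c := y ^ k) in *.
    assert (hc : 0 < c) by (apply pow_lt; lra). rewrite Rabs_right in hk0 by lra.
    assert (hea : 0 < eps * a) by (apply Rmult_lt_0_compat; auto).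
    assert (hn : INR ((b ^ 8) ^ k) = c ^ 8).
    { rewrite !pow_INR. fold y. unfold c. rewrite <- !pow_mult. f_equal. lia. }
    eapply Rle_trans; [apply (V_sumsq_upper _ c); auto; nra|].
    assert (hrk : r ^ k = / c ^ 4).
    { unfold r, c. rewrite pow_inv, <- !pow_mult. do 2 f_equal. lia. }
    rewrite hn, hrk.
    assert (hc2 : 0 < c ^ 2) by (apply pow_lt; auto).
    (* The sixth power yields [c^(-12)], which beats the factor [c^8] by the desired [c^4]. *)
    assert (h1 := exp_neg_le_inv_pow 6 (c ^ 2 / (2 * a)) ltac:(lia) ltac:(apply Rdiv_lt_0_compat; lra)).
    assert (h2 := exp_neg_le_inv (c ^ 8 * (eps ^ 2 * a ^ 2) / (8 * c ^ 4))).
    assert (hea2 : 0 < eps ^ 2 * a ^ 2) by (apply Rmult_lt_0_compat; apply pow_lt; auto).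
    specialize (h2 ltac:(apply Rdiv_lt_0_compat; [apply Rmult_lt_0_compat; auto; apply pow_lt; auto|]; assert (h := pow_lt c 4 hc); lra)).
    replace (/ (c ^ 8 * (eps ^ 2 * a ^ 2) / (8 * c ^ 4))) with (8 / (eps ^ 2 * a ^ 2) * / c ^ 4) in h2 by (field; repeat split; lra).
    replace (INR 6 / (c ^ 2 / (2 * a))) with (6 * (2 * a) * / c ^ 2) in h1 by (simpl INR; field; repeat split; lra).
    rewrite Rpow_mult_distr in h1.
    assert (h3 : 8 * c ^ 8 * exp (- (c ^ 2 / (2 * a))) <= 8 * c ^ 8 * ((6 * (2 * a)) ^ 6 * (/ c ^ 2) ^ 6)).
    { apply Rmult_le_compat_l; auto. assert (h := pow_lt c 8 hc); lra. }
    replace (8 * c ^ 8 * ((6 * (2 * a)) ^ 6 * (/ c ^ 2) ^ 6)) with (8 * (6 * (2 * a)) ^ 6 * / c ^ 4) in h3.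
    + unfold C. lra.
    + set (Q := (6 * (2 * a)) ^ 6). field. lra.
Qed.

End Squares.

(** * Lower bound and cluster set *)

Lemma rprod_le_exp a e K : (forall k, 0 <= a k) -> (forall k, a k <= exp (- e k)) -> rprod a K <= exp (- psum e K).
Proof.
  intros h0 h. induction K; simpl; [rewrite Ropp_0, exp_0; lra|].
  rewrite Ropp_plus_distr, exp_plus. apply Rmult_le_compat; auto. apply rprod_nonneg; auto.
Qed.

(** Each increment [ln (k + 2) - ln (k + 1)] is at most [/ (k + 1)]. This is the divergence behind
    [lil_blocks]. *)
Lemma harmonic_tail_ge m th K : 0 <= th ->
  th * (ln (INR (S K)) - ln (INR (S m))) <= psum (fun k => if (k <? m)%nat then 0 else th / INR (S k)) K.
Proof.
  intros hth. induction K; cbn [psum].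
  - assert (ln (INR 1) <= ln (INR (S m))) by (apply ln_le; [apply lt_0_INR; lia|apply le_INR; lia]). nra.
  - destruct (Nat.ltb_spec K m).
    + assert (0 <= psum (fun k => if (k <? m)%nat then 0 else th / INR (S k)) K).
      { apply psum_nonneg. intros j _. destruct (j <? m)%nat; [lra|]. apply Rmult_le_pos; auto.
        left; apply Rinv_0_lt_compat, lt_0_INR; lia. }
      assert (ln (INR (S (S K))) <= ln (INR (S m))) by (apply ln_le; [apply lt_0_INR; lia|apply le_INR; lia]). nra.
    + assert (hp : 0 < INR (S K)) by (apply lt_0_INR; lia).
      assert (hi : 0 < / INR (S K)) by (apply Rinv_0_lt_compat; auto).
      assert (hl : ln (INR (S (S K))) <= ln (INR (S K)) + / INR (S K)).
      { replace (INR (S (S K))) with (INR (S K) * (1 + / INR (S K))) by (rewrite (S_INR (S K)); field; lra).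
        rewrite ln_mult by lra. assert (h := ln_le_sub1 (1 + / INR (S K)) ltac:(lra)). lra. }
      assert (th * ln (INR (S (S K))) <= th * (ln (INR (S K)) + / INR (S K))) by (apply Rmult_le_compat_l; auto).
      unfold Rdiv. lra.
Qed.

Lemma inv_sqrt_near th eps : 0 < eps <= / 2 -> 1 - eps <= th ->
  0 < sqrt th /\ / sqrt th <= 1 + 2 * eps /\ (th <= 1 + eps -> 1 - 2 * eps <= / sqrt th).
Proof.
  intros he ht.
  assert (hr : 1 - eps <= sqrt th).
  { rewrite <- (sqrt_pow2 (1 - eps)) by lra. apply sqrt_le_1_alt. nra. }
  assert (hp : 0 < sqrt th) by lra.
  assert (hi : sqrt th * / sqrt th = 1) by (apply Rinv_r; lra).
  assert (hip : 0 < / sqrt th) by (apply Rinv_0_lt_compat; auto).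
  repeat split; auto.
  - apply Rle_trans with (/ (1 - eps)); [apply Rinv_le_contravar; lra|].
    apply Rmult_le_reg_r with (1 - eps); [lra|]. rewrite Rinv_l by lra. nra.
  - intros hth. assert (h2 : sqrt th <= 1 + eps).
    { rewrite <- (sqrt_pow2 (1 + eps)) by lra. apply sqrt_le_1_alt. nra. }
    nra.
Qed.

(** Splits off the classical normalisation by the variance [v], leaving a factor that depends on
    [q / v] alone. *)
Lemma self_normalized_eq s q v l : 0 < v -> 0 < l -> 0 < q ->
  s / (sqrt q * sqrt (2 * l)) = s / sqrt (2 * (v * l)) * / sqrt (q / v).
Proof.
  intros hv hl hq.
  assert (hqv : 0 < q / v) by (apply Rdiv_lt_0_compat; auto).
  assert (e : sqrt q = sqrt v * sqrt (q / v)) by (rewrite <- sqrt_mult by lra; f_equal; field; lra).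
  replace (2 * (v * l)) with (v * (2 * l)) by ring. rewrite (sqrt_mult v), e by lra.
  assert (h1 := sqrt_lt_R0 v hv). assert (h2 := sqrt_lt_R0 (2 * l) ltac:(lra)). assert (h3 := sqrt_lt_R0 _ hqv).
  set (r := sqrt (q / v)) in *. field. repeat split; lra.
Qed.

(** Reduces the claim to countably many statements. The grid [-1 + i / (m + 1)] has mesh equal to
    the tolerance, and [Rmin 1] keeps every index [i] inside the interval. *)
Lemma cluster_of_dense (x : nat -> R) :
  (forall m, exists N, forall n, (N <= n)%nat -> Rabs (x n) <= 1 + / INR (S m)) ->
  (forall i m N, exists n, (N <= n)%nat /\ Rabs (x n - Rmin 1 (-1 + INR i / INR (S m))) <= / INR (S m)) ->
  cluster_to x (-1) 1.
Proof.
  intros hU hL.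
  assert (hsmall : forall eps, 0 < eps -> exists m, / INR (S m) < eps).
  { intros eps he. destruct (INR_unbounded (/ eps)) as [m hm]. exists m.
    rewrite <- (Rinv_inv eps). apply Rinv_lt_contravar.
    - apply Rmult_lt_0_compat; [apply Rinv_0_lt_compat; auto|apply lt_0_INR; lia].
    - rewrite S_INR; lra. }
  split.
  - apply is_lim_seq_spec. intros eps. destruct (hsmall eps (cond_pos eps)) as [m hm].
    destruct (hU m) as [N hN]. exists N. intros n hn. specialize (hN n hn).
    set (P := fun d => exists y, -1 <= y <= 1 /\ d = Rabs (x n - y)).
    destruct (Glb_Rbar_correct P) as [g1 g2].
    assert (b1 : Rbar_le 0 (Glb_Rbar P)) by (apply g2; intros d (y & _ & ->); apply Rabs_pos).
    assert (b2 : Rbar_le (Glb_Rbar P) (/ INR (S m))).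
    { eapply Rbar_le_trans; [apply (g1 (Rabs (x n - clip 1 (x n))))|].
      - exists (clip 1 (x n)). split; auto. unfold clip, Rmin, Rmax; repeat destruct Rle_dec; lra.
      - simpl. assert (0 < / INR (S m)) by (apply Rinv_0_lt_compat, lt_0_INR; lia).
        apply Rabs_le_between in hN. apply Rabs_le.
        change (match m with O => 1 | S _ => INR m + 1 end) with (INR (S m)).
        unfold clip, Rmin, Rmax; repeat destruct Rle_dec; lra. }
    destruct (Glb_Rbar P) as [g| |]; simpl in b1, b2; try tauto. cbn [real].
    change (match m with O => 1 | S _ => INR m + 1 end) with (INR (S m)) in b2.
    rewrite Rminus_0_r, Rabs_right; lra.
  - intros c. split.
    + intros hc. assert (hab : Rabs c <= 1).
      { apply Rnot_lt_le; intros hlt. destruct (hsmall ((Rabs c - 1) / 3) ltac:(lra)) as [m hm].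
        destruct (hU m) as [N hN]. destruct (hc ((Rabs c - 1) / 3) ltac:(lra) N) as (n & hn & h).
        specialize (hN n hn). assert (h' := Rabs_triang (x n) (- (x n - c))).
        rewrite Rabs_Ropp in h'. replace (x n + - (x n - c)) with c in h' by ring. lra. }
      apply Rabs_le_between in hab; lra.
    + intros hc eps he N. destruct (hsmall (eps / 2) ltac:(lra)) as [m hm].
      assert (hS : 0 < INR (S m)) by (apply lt_0_INR; lia).
      destruct (nfloor_ex ((c + 1) * INR (S m))) as [i [hi1 hi2]]; [apply Rmult_le_pos; lra|].
      destruct (hL i m N) as (n & hn & h). exists n; split; auto.
      assert (k1 : INR i / INR (S m) <= c + 1).
      { apply Rmult_le_reg_r with (INR (S m)); auto. unfold Rdiv; rewrite Rmult_assoc, Rinv_l by lra. lra. }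
      assert (k2 : c + 1 <= INR i / INR (S m) + / INR (S m)).
      { apply Rmult_le_reg_r with (INR (S m)); auto. replace ((INR i / INR (S m) + / INR (S m)) * INR (S m)) with (INR i + 1) by (field; lra). lra. }
      rewrite Rmin_right in h by lra. apply Rabs_le_between in h. apply Rabs_lt_between. lra.
Qed.

Section Lower.
Context {Omega : Type} {F : (Omega -> Prop) -> Prop}
  {H : (Omega -> R) -> Prop} {E : (Omega -> R) -> Rbar}
  {X0 : Omega -> R} {X : nat -> Omega -> R} (ST : setting F H E X0 X).
Local Notation V := (Vcap H E).
Local Notation EE := (Eseq (E:=E) (X:=X)).
Local Notation E0 := (Eone (E:=E) (X0:=X0)).
Local Notation as_ := (almost_surely (F:=F) (H:=H) (E:=E)).
Let SL := set_sl _ _ _ _ _ ST.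
Let CV := set_cont _ _ _ _ _ ST.
Context (a : R) (ha : 0 < a) (hG : G_normal E a a X0).

(* The second term makes the bump negative away from [z], so that it minorizes the indicator of a window. *)
Definition bump (d z kap : R) (s : R) : R := laplace d (- z + s) - kap * laplace (4 * d) (- z + s).

Lemma laplace_shift_bl d z : 0 < d -> bdd_lip1 (fun s => laplace d (- z + s)).
Proof.
  intros hd. assert (h := bl_affine (laplace d) (- z) 1 (laplace_bl d hd)).
  replace (fun s => laplace d (- z + s)) with (fun s => laplace d (- z + 1 * s)); auto.
  apply functional_extensionality; intros; f_equal; ring.
Qed.

Lemma bump_bl d z kap : 0 < d -> bdd_lip1 (bump d z kap).
Proof.
  intros hd. unfold bump. apply (bl_plus (fun s => laplace d (- z + s)) (fun s => - (kap * laplace (4 * d) (- z + s)))).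
  - apply laplace_shift_bl; auto.
  - apply (bl_opp (fun s => kap * laplace (4 * d) (- z + s))). apply bl_mult; [apply bl_const|apply laplace_shift_bl; lra].
Qed.

Lemma laplace_le1 d x : 0 < d -> 0 < laplace d x <= 1.
Proof.
  intros hd. rewrite laplace_eq. split; [apply exp_pos|]. rewrite <- exp_0. apply exp_le.
  assert (0 <= x ^ 2 / (2 * d)); [|lra]. apply Rmult_le_pos; [nra|left; apply Rinv_0_lt_compat; lra].
Qed.

Lemma bump_le1 d z kap s : 0 < d -> 0 <= kap -> bump d z kap s <= 1.
Proof.
  intros hd hk. unfold bump. assert (h1 := laplace_le1 d (- z + s) hd). assert (h2 := laplace_le1 (4 * d) (- z + s) ltac:(lra)). nra.
Qed.

(** The Gaussian exponents of variances [d] and [4 d] differ by [3 (s - z)^2 / (8 d)], which has to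
    reach [2 l]. *)
Lemma bump_nonpos d z l s : 0 < d -> 16 * d * l <= 3 * (s - z) ^ 2 -> bump d z (exp (- (2 * l))) s <= 0.
Proof.
  intros hd h. unfold bump. rewrite !laplace_eq, <- exp_plus.
  assert (h' : exp (- ((- z + s) ^ 2 / (2 * d))) <= exp (- (2 * l) + - ((- z + s) ^ 2 / (2 * (4 * d))))); [|lra].
  apply exp_le. replace (- z + s) with (s - z) by ring. set (y := (s - z) ^ 2) in *.
  apply Rmult_le_reg_r with (8 * d); [lra|].
  replace (- (y / (2 * d)) * (8 * d)) with (- 4 * y) by (field; lra).
  replace ((- (2 * l) + - (y / (2 * (4 * d)))) * (8 * d)) with (- 16 * d * l - y) by (field; lra). lra.
Qed.

Lemma EE_laplace d z n : 0 < d ->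
  EE (fun x => laplace d (- z + psum x n)) = exp (ln d / 2 - ln (d + INR n * a) / 2 - z ^ 2 / (2 * (d + INR n * a))).
Proof.
  intros hd. unfold laplace. rewrite (EE_scal ST n); [| |left; apply exp_pos].
  - rewrite (EE_gauss ST a) by (auto; lra). unfold gauss. rewrite <- exp_plus. f_equal.
    replace ((- z) ^ 2) with (z ^ 2) by ring. lra.
  - apply (BL_psum (fun s => gauss d (- z + s))).
    assert (h := bl_affine (gauss d) (- z) 1 (gauss_bl d hd)).
    replace (fun s => gauss d (- z + s)) with (fun s => gauss d (- z + 1 * s)); auto.
    apply functional_extensionality; intros; f_equal; ring.
Qed.

(** The block has [n] variables, slightly fewer than [p]; the smoothing variance [tau p a] makes up
    for the missing ones. The total variance is thus at least [p a], and the exponent at most [l]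
    since [c^2 <= 1]. The correction costs at most its weight, of the order of the square of the
    main term. *)
Lemma EE_bump_ge tau p c l n : 0 < tau -> 0 < p -> -1 <= c <= 1 -> 0 <= l ->
  p * (1 - tau) <= INR n -> INR n <= p ->
  exp (ln (tau / (1 + tau)) / 2) * exp (- l) - exp (- (2 * l)) <=
  EE (fun x => bump (tau * (p * a)) (c * sqrt (2 * a * (p * l))) (exp (- (2 * l))) (psum x n)).
Proof.
  intros ht hp hc hl hn1 hn2. set (d := tau * (p * a)). set (z := c * sqrt (2 * a * (p * l))).
  assert (hpa : 0 < p * a) by (apply Rmult_lt_0_compat; auto).
  assert (hd : 0 < d) by (apply Rmult_lt_0_compat; auto).
  assert (hna : 0 <= INR n * a) by (apply Rmult_le_pos; [apply pos_INR|lra]).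
  assert (hv1 : p * a <= d + INR n * a) by (unfold d; nra).
  assert (hv2 : d + INR n * a <= (1 + tau) * (p * a)) by (unfold d; nra).
  assert (hL1 : BL n (fun x => laplace d (- z + psum x n))) by (apply (BL_psum (fun s => laplace d (- z + s))), laplace_shift_bl; auto).
  assert (hL2 : BL n (fun x => laplace (4 * d) (- z + psum x n))) by (apply (BL_psum (fun s => laplace (4 * d) (- z + s))), laplace_shift_bl; lra).
  assert (e : EE (fun x => bump d z (exp (- (2 * l))) (psum x n)) =
     EE (fun x => laplace d (- z + psum x n)) - exp (- (2 * l)) * EE (fun x => laplace (4 * d) (- z + psum x n))).
  { unfold bump. rewrite <- (EE_scal ST n) by (auto; left; apply exp_pos).
    unfold Rminus. rewrite <- (EE_opp ST n) by (apply BL_scal; auto).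
    apply (EE_plus ST n); auto. apply BL_opp, BL_scal; auto. }
  rewrite e, !EE_laplace by lra.
  assert (hz : z ^ 2 <= 2 * (p * a) * l).
  { unfold z. rewrite Rpow_mult_distr, pow2_sqrt by (repeat apply Rmult_le_pos; lra).
    assert (hpal : 0 <= 2 * (p * a) * l) by (apply Rmult_le_pos; lra). assert (hc2 : c ^ 2 <= 1) by nra.
    replace (2 * a * (p * l)) with (2 * (p * a) * l) by ring. rewrite <- (Rmult_1_l (2 * (p * a) * l)) at 2.
    apply Rmult_le_compat_r; auto. }
  assert (b1 : exp (ln (tau / (1 + tau)) / 2) * exp (- l) <= exp (ln d / 2 - ln (d + INR n * a) / 2 - z ^ 2 / (2 * (d + INR n * a)))).
  { rewrite <- exp_plus. apply exp_le.
    assert (k1 : ln (tau / (1 + tau)) <= ln d - ln (d + INR n * a)).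
    { assert (k2 : ln (d + INR n * a) <= ln ((1 + tau) * (p * a))) by (apply ln_le; lra).
      rewrite ln_mult in k2 by lra. unfold Rdiv. rewrite ln_mult, ln_Rinv by (try apply Rinv_0_lt_compat; lra).
      unfold d at 1. rewrite ln_mult by lra. lra. }
    assert (k3 : z ^ 2 / (2 * (d + INR n * a)) <= l); [|lra].
    apply Rmult_le_reg_r with (2 * (d + INR n * a)); [lra|]. unfold Rdiv; rewrite Rmult_assoc, Rinv_l by lra.
    assert (l * (p * a) <= l * (d + INR n * a)) by (apply Rmult_le_compat_l; auto). lra. }
  assert (b2 : exp (ln (4 * d) / 2 - ln (4 * d + INR n * a) / 2 - z ^ 2 / (2 * (4 * d + INR n * a))) <= 1).
  { rewrite <- exp_0. apply exp_le.
    assert (ln (4 * d) <= ln (4 * d + INR n * a)) by (apply ln_le; lra).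
    assert (0 <= z ^ 2 / (2 * (4 * d + INR n * a))) by (apply Rmult_le_pos; [apply pow2_ge_0|left; apply Rinv_0_lt_compat; lra]). lra. }
  assert (hk := exp_pos (- (2 * l))). nra.
Qed.

Definition lil_scale (n : nat) : R := sqrt (2 * a * (INR n * ln (ln (INR n)))).

(** The divergent half of Borel-Cantelli. Since [exp (- l k)] is [1 / ((k + 1) ln y)], each bump has
    mean at least of order [1 / (k + 1)]. The product of the factors [1 - g k] over independent
    blocks dominates the indicator of missing every window, and its mean tends to 0. *)
Proposition lil_blocks B c eps : (2 <= B)%nat -> -1 <= c <= 1 -> 0 < eps -> / INR B <= 3 * eps ^ 2 / 8 ->
  as_ (fun w => forall m, exists k, (m <= k)%nat /\
    Rabs (Sn X (B ^ S k) w - Sn X (B ^ k) w - c * lil_scale (B ^ S k)) <= eps * lil_scale (B ^ S k)).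
Proof.
  (* This [tau] makes the condition of [bump_nonpos] an equality at distance [eps] times the scale;
     [/ INR B <= tau] is the block length condition of [EE_bump_ge]. *)
  intros hB hc he htau. set (tau := 3 * eps ^ 2 / 8) in *.
  assert (he2 : 0 < eps ^ 2) by (apply pow_lt; auto).
  assert (ht : 0 < tau) by (unfold tau; lra).
  set (y := INR B) in *. assert (hy : 2 <= y) by (apply (le_INR 2); auto).
  assert (hlny : 0 < ln y) by (rewrite <- ln_1; apply ln_increasing; lra).
  set (q := exp (ln (tau / (1 + tau)) / 2)). assert (hq : 0 < q) by apply exp_pos.
  set (st := fun k => (B ^ k)%nat).
  assert (hst : forall k, (st k <= st (S k))%nat) by (intros k; unfold st; simpl; nia).
  set (p := fun k => INR (st (S k))).
  assert (hpe : forall k, p k = y ^ S k) by (intros k; unfold p, st; rewrite pow_INR; auto).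
  assert (hpp : forall k, 0 < p k) by (intros k; rewrite hpe; apply pow_lt; lra).
  set (l := fun k => ln (ln (p k))).
  assert (hlp : forall k, ln (p k) = INR (S k) * ln y) by (intros k; rewrite hpe, ln_pow by lra; auto).
  set (nb := fun k => (st (S k) - st k)%nat).
  assert (hnb : forall k, INR (nb k) = p k * (1 - / y)).
  { intros k. unfold nb. rewrite minus_INR by auto. fold (p k). unfold st. rewrite pow_INR. fold y.
    rewrite hpe. simpl. field. lra. }
  (* From [k0] on the iterated logarithm is positive and [exp (- l k) <= q / 2], so the correction
     takes at most half of the main term. *)
  destruct (INR_unbounded (/ ln y + 2 / (q * ln y))) as [k0 hk0].
  assert (hql : 0 < q * ln y) by (apply Rmult_lt_0_compat; auto).
  assert (hk : forall k, (k0 <= k)%nat -> 0 < l k /\ exp (- l k) = / (INR (S k) * ln y) /\ / (INR (S k) * ln y) <= q / 2).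
  { intros k hk. apply le_INR in hk. assert (hS := S_INR k).
    assert (i1 : 0 < / ln y) by (apply Rinv_0_lt_compat; auto).
    assert (i2 : 0 < 2 / (q * ln y)) by (apply Rdiv_lt_0_compat; lra).
    assert (h1 : 1 < INR (S k) * ln y).
    { apply Rle_lt_trans with (/ ln y * ln y); [rewrite Rinv_l; lra|]. apply Rmult_lt_compat_r; lra. }
    split; [|split].
    - unfold l. rewrite hlp, <- ln_1. apply ln_increasing; lra.
    - unfold l. rewrite hlp, exp_Ropp, exp_ln; lra.
    - apply Rle_trans with (/ (2 / q)); [|right; field; lra].
      apply Rinv_le_contravar; [apply Rdiv_lt_0_compat; lra|].
      replace (2 / q) with (2 / (q * ln y) * ln y) by (field; lra). apply Rmult_le_compat_r; lra. }
  set (d := fun k => tau * (p k * a)).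
  assert (hd : forall k, 0 < d k) by (intros k; apply Rmult_lt_0_compat; [|apply Rmult_lt_0_compat]; auto).
  set (z := fun k => c * sqrt (2 * a * (p k * l k))).
  set (g := fun k x => bump (d k) (z k) (exp (- (2 * l k))) (psum x (nb k))).
  assert (hgBL : forall k, BL (nb k) (g k)) by (intros k; apply (BL_psum (bump (d k) (z k) (exp (- (2 * l k))))), bump_bl; auto).
  set (th := q / (2 * ln y)). assert (hth : 0 < th) by (apply Rdiv_lt_0_compat; lra).
  assert (hgE : forall k, (k0 <= k)%nat -> th / INR (S k) <= EE (g k)).
  { intros k hkk. destruct (hk k hkk) as (h1 & h2 & h3).
    assert (h := EE_bump_ge tau (p k) c (l k) (nb k) ht (hpp k) hc (Rlt_le _ _ h1)).
    rewrite hnb in h. fold q (d k) (z k) in h. fold (g k) in h.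
    assert (hiy : 0 < / y) by (apply Rinv_0_lt_compat; lra). specialize (hpp k).
    eapply Rle_trans; [|apply h; [apply Rmult_le_compat_l; lra|nra]].
    replace (exp (- (2 * l k))) with (exp (- l k) * exp (- l k)) by (rewrite <- exp_plus; f_equal; ring).
    rewrite h2. set (t := / (INR (S k) * ln y)) in *.
    assert (hSp : 0 < INR (S k)) by (apply lt_0_INR; lia).
    assert (htp : 0 < t) by (apply Rinv_0_lt_compat, Rmult_lt_0_compat; auto).
    replace (th / INR (S k)) with (q / 2 * t) by (unfold th, t; field; lra). nra. }
  set (near := fun k w => Rabs (Sn X (st (S k)) w - Sn X (st k) w - z k) <= eps * sqrt (2 * a * (p k * l k))).
  assert (Hinc : forall k, H (fun w => Sn X (st (S k)) w - Sn X (st k) w)).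
  { intros k. apply (H_ext (fun w => Sn X (st (S k)) w + -1 * Sn X (st k) w)); [intros; ring|].
    apply (sl_add _ _ _ SL); [apply (H_Sn ST)|apply (sl_scal _ _ _ SL), (H_Sn ST)]. }
  assert (Fnear : forall k, F (near k)).
  { intros k. apply (F_ext (fun w => z k - eps * sqrt (2 * a * (p k * l k)) <= Sn X (st (S k)) w - Sn X (st k) w /\
      Sn X (st (S k)) w - Sn X (st k) w <= z k + eps * sqrt (2 * a * (p k * l k)))).
    - intros w. unfold near. rewrite Rabs_le_between. split; intros; lra.
    - apply (F_and SL); [apply (F_ge SL (fun w => Sn X (st (S k)) w - Sn X (st k) w))|apply (F_le SL (fun w => Sn X (st (S k)) w - Sn X (st k) w))]; auto. }
  apply (as_mono (fun w => forall m, exists k, (m <= k)%nat /\ near k w)).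
  2:{ intros w hw. exact hw. }
  apply (as_forall SL CV). intros m0. set (m := max m0 k0).
  exists (fun w => forall k, (m <= k)%nat -> ~ near k w). split; [|split].
  - apply (F_forall SL); intros k. apply (F_impl SL), (F_not SL); auto.
  - intros w hn k hkm hnear. apply hn. exists k; split; auto. unfold m in hkm; lia.
  - apply Rle_antisym; [|apply (V_bounds SL)]. apply le_epsilon. intros eta heta. rewrite Rplus_0_l.
    (* The weighted harmonic sum from [m] to [K] reaches [/ eta], whence the bound
       [exp (- / eta) <= eta]. *)
    destruct (INR_unbounded (exp (/ eta / th + ln (INR (S m))))) as [K hK].
    set (h := fun k => if (k <? m)%nat then (fun _ : nat -> R => 1) else (fun x => 1 - g k x)).
    assert (hb : forall k, BL (st (S k) - st k) (h k)).
    { intros k. unfold h. destruct (k <? m)%nat; [apply BL_const|]. apply BL_minus; [apply BL_const|apply hgBL]. }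
    assert (hh0 : forall k x, 0 <= h k x).
    { intros k x. unfold h. destruct (k <? m)%nat; [lra|].
      assert (hl := bump_le1 (d k) (z k) (exp (- (2 * l k))) (psum x (nb k)) (hd k) (Rlt_le _ _ (exp_pos _))). unfold g; lra. }
    apply Rle_trans with (EE (blockprod st h K)).
    + apply (V_le_EE ST (st K)); [apply BL_blockprod; auto|intros; apply blockprod_nonneg; auto|].
      intros w hw. clear hK. induction K; simpl; [lra|].
      rewrite <- (Rmult_1_r 1). apply Rmult_le_compat; try lra; auto.
      unfold h. destruct (Nat.ltb_spec K m); [lra|].
      assert (hg : g K (shift (st K) (Xp (X:=X) w)) <= 0); [|lra].
      destruct (hk K) as (hlpos & _ & _); [unfold m in *; lia|].
      apply bump_nonpos; auto.
      assert (hs : psum (shift (st K) (Xp (X:=X) w)) (nb K) = Sn X (st (S K)) w - Sn X (st K) w).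
      { unfold Sn. replace (st (S K)) with (st K + nb K)%nat by (unfold nb; specialize (hst K); lia).
        rewrite psum_split. unfold shift, Xp. ring. }
      rewrite hs. specialize (hw K ltac:(auto)). unfold near in hw. apply Rnot_le_lt in hw.
      set (D := Sn X (st (S K)) w - Sn X (st K) w - z K) in *.
      rewrite <- pow2_abs.
      assert (hsq : (eps * sqrt (2 * a * (p K * l K))) ^ 2 <= Rabs D ^ 2).
      { apply pow_incr. split; [|lra]. apply Rmult_le_pos; [lra|apply sqrt_pos]. }
      assert (hpl : 0 < p K * l K) by (apply Rmult_lt_0_compat; auto).
      rewrite Rpow_mult_distr, pow2_sqrt in hsq by nra.
      unfold d, tau. lra.
    + rewrite (EE_blockprod ST) by auto.
      eapply Rle_trans; [apply (rprod_le_exp _ (fun k => if (k <? m)%nat then 0 else th / INR (S k)))|].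
      * intros k. rewrite <- (EE_const ST 0). apply (EE_mono ST 0 (st (S k) - st k)); auto using BL_const.
      * intros k. unfold h. destruct (Nat.ltb_spec k m); [rewrite (EE_const ST), Ropp_0, exp_0; lra|].
        assert (h1 := hgE k ltac:(unfold m in *; lia)).
        assert (h2 := exp_ineq1_le (- (th / INR (S k)))).
        assert (h3 : EE (fun x => 1 + - g k x) = 1 - EE (g k)).
        { rewrite (EE_plus ST (nb k)); auto using BL_const, BL_opp. rewrite (EE_const ST), (EE_opp ST (nb k)); auto. }
        change (EE (fun x => 1 - g k x) <= exp (- (th / INR (S k)))). unfold Rminus. rewrite h3. lra.
      * apply Rle_trans with (exp (- / eta)).
        -- apply exp_le. apply Ropp_le_contravar. eapply Rle_trans; [|apply harmonic_tail_ge; lra].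
           assert (hln : / eta / th + ln (INR (S m)) <= ln (INR (S K))).
           { rewrite <- (ln_exp (/ eta / th + ln (INR (S m)))). apply ln_le; [apply exp_pos|]. rewrite (S_INR K); lra. }
           apply Rle_trans with (th * (/ eta / th)); [right; field; lra|]. apply Rmult_le_compat_l; lra.
        -- eapply Rle_trans; [apply exp_neg_le_inv, Rinv_0_lt_compat; auto|]. rewrite Rinv_inv; lra.
Qed.

Definition snorm (n : nat) (w : Omega) : R := Sn X n w / (Vn X n w * sqrt (2 * ln (ln (INR n)))).

Lemma snorm_eq n w : 0 < INR n -> 0 < ln (ln (INR n)) -> 0 < psum (fun i => X i w ^ 2) n ->
  snorm n w = Sn X n w / lil_scale n * / sqrt (psum (fun i => X i w ^ 2) n / (INR n * a)).
Proof.
  intros hn hl hq. unfold snorm, Vn, lil_scale.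
  rewrite (self_normalized_eq _ _ (INR n * a)) by (auto; apply Rmult_lt_0_compat; auto).
  do 3 f_equal. ring.
Qed.

(** For small [n] the iterated logarithm is negative or comes from default values of [ln]; the
    estimates on [snorm] start beyond. *)
Lemma lnln_eventually_pos : exists N, forall n, (N <= n)%nat -> 0 < INR n /\ 0 < ln (INR n) /\ 0 < ln (ln (INR n)).
Proof.
  destruct (INR_unbounded (exp 1)) as [N hN]. exists N. intros n hn. apply le_INR in hn.
  assert (h0 := exp_pos 1). assert (h1 : 1 < ln (INR n)) by (rewrite <- (ln_exp 1) at 1; apply ln_increasing; lra).
  repeat split; try lra. rewrite <- ln_1. apply ln_increasing; lra.
Qed.

Lemma lil_scale_pos n : 0 < INR n -> 0 < ln (ln (INR n)) -> 0 < lil_scale n.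
Proof. intros h1 h2. apply sqrt_lt_R0. repeat apply Rmult_lt_0_compat; lra. Qed.

Lemma lil_upper_abs eps : 0 < eps ->
  as_ (fun w => exists N, forall n, (N <= n)%nat -> Rabs (Sn X n w) <= (1 + eps) * lil_scale n).
Proof.
  intros he. assert (h1 := lil_upper ST a ha hG 1 eps (or_introl eq_refl) he).
  assert (h2 := lil_upper ST a ha hG (-1) eps (or_intror eq_refl) he).
  apply (as_mono _ _ (as_and SL CV _ _ h1 h2)). intros w [[N1 k1] [N2 k2]].
  exists (max N1 N2). intros n hn. specialize (k1 n ltac:(lia)). specialize (k2 n ltac:(lia)).
  apply Rabs_le. unfold lil_scale. lra.
Qed.

Lemma snorm_bounded eps : 0 < eps <= / 2 ->
  as_ (fun w => exists N, forall n, (N <= n)%nat -> Rabs (snorm n w) <= 1 + 5 * eps).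
Proof.
  intros he. assert (h1 := lil_upper_abs eps ltac:(lra)). assert (h2 := sumsq_lower ST a ha hG eps ltac:(lra)).
  destruct lnln_eventually_pos as [N0 hN0].
  apply (as_mono _ _ (as_and SL CV _ _ h1 h2)). intros w [[N1 k1] [N2 k2]].
  exists (max N0 (max N1 N2)). intros n hn. specialize (k1 n ltac:(lia)). specialize (k2 n ltac:(lia)).
  destruct (hN0 n ltac:(lia)) as (g0 & g1 & g2). set (Q := psum (fun i => X i w ^ 2) n) in *.
  assert (hna : 0 < INR n * a) by (apply Rmult_lt_0_compat; auto).
  assert (hQ : 0 < Q) by nra.
  rewrite snorm_eq by auto. fold Q.
  destruct (inv_sqrt_near (Q / (INR n * a)) eps he) as (i1 & i2 & _).
  { apply Rmult_le_reg_r with (INR n * a); auto. unfold Rdiv; rewrite Rmult_assoc, Rinv_l by lra. lra. }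
  assert (hL := lil_scale_pos n g0 g2).
  rewrite Rabs_mult, (Rabs_right (/ _)) by (apply Rle_ge; left; apply Rinv_0_lt_compat; auto).
  assert (hs : Rabs (Sn X n w / lil_scale n) <= 1 + eps).
  { unfold Rdiv. rewrite Rabs_mult, (Rabs_right (/ _)) by (apply Rle_ge; left; apply Rinv_0_lt_compat; auto).
    apply Rmult_le_reg_r with (lil_scale n); auto. rewrite Rmult_assoc, Rinv_l by lra. lra. }
  apply Rle_trans with ((1 + eps) * (1 + 2 * eps)); [|nra].
  apply Rmult_le_compat; auto using Rabs_pos. left; apply Rinv_0_lt_compat; auto.
Qed.

(** At the times [B ^ S k] the last block dominates: its sum is near [c] times the scale infinitely
    often, the earlier sum is negligible by the upper law, and both bounds on the squares are
    available. *)
Lemma snorm_recurrent c eps : -1 <= c <= 1 -> 0 < eps <= / 2 ->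
  as_ (fun w => forall N, exists n, (N <= n)%nat /\ Rabs (snorm n w - c) <= 6 * eps).
Proof.
  intros hc he. assert (he2 : 0 < eps ^ 2) by (apply pow_lt; lra).
  (* This gives [/ B <= eps^2 / 4], which is below the [3 eps^2 / 8] of [lil_blocks] and makes the
     scale at [B ^ k] at most [eps / 2] times the scale at [B ^ S k]. *)
  destruct (INR_unbounded (2 + / (eps ^ 2 / 4))) as [b hb].
  assert (hi : 0 < / (eps ^ 2 / 4)) by (apply Rinv_0_lt_compat; lra).
  assert (hb2 : (2 <= b)%nat) by (apply INR_le; simpl; lra).
  (* An eighth power, so that the times of [lil_blocks] are also those of [sumsq_upper]. *)
  set (B := (b ^ 8)%nat).
  assert (hbB : (b <= B)%nat).
  { unfold B. rewrite <- (Nat.pow_1_r b) at 1. apply Nat.pow_le_mono_r; lia. }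
  assert (hBinv : / INR B <= eps ^ 2 / 4).
  { rewrite <- (Rinv_inv (eps ^ 2 / 4)). apply Rinv_le_contravar; auto. apply le_INR in hbB; lra. }
  assert (hBp : 0 < INR B) by (apply lt_0_INR; lia).
  assert (h1 := lil_upper_abs 1 Rlt_0_1). assert (h2 := sumsq_lower ST a ha hG eps ltac:(lra)).
  assert (h3 := sumsq_upper ST a ha hG b eps hb2 ltac:(lra)). fold B in h3.
  assert (h4 := lil_blocks B c eps ltac:(lia) hc ltac:(lra) ltac:(lra)).
  destruct lnln_eventually_pos as [N0 hN0].
  apply (as_mono _ _ (as_and SL CV _ _ (as_and SL CV _ _ h1 h2) (as_and SL CV _ _ h3 h4))).
  intros w [[[N1 k1] [N2 k2]] [[N3 k3] k4]] N.
  destruct (k4 (max N (max (max N0 N1) (max N2 N3)))) as (k & hk & hnear).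
  assert (hkB : forall j, (j < B ^ j)%nat) by (intros j; apply Nat.pow_gt_lin_r; lia).
  set (n := (B ^ S k)%nat) in *. assert (hnk : (k < n)%nat) by (assert (h := hkB (S k)); unfold n; lia).
  assert (hmk := hkB k). set (n' := (B ^ k)%nat) in *.
  assert (hnn : INR n' = INR n * / INR B).
  { unfold n, n'. rewrite !pow_INR. simpl pow. field; lra. }
  exists n. split; [lia|].
  specialize (k1 n' ltac:(lia)). specialize (k2 n ltac:(lia)). specialize (k3 (S k) ltac:(lia)). fold n in k3.
  destruct (hN0 n ltac:(lia)) as (g0 & g1 & g2). destruct (hN0 n' ltac:(lia)) as (g0' & g1' & g2').
  set (Q := psum (fun i => X i w ^ 2) n) in *.
  assert (hna : 0 < INR n * a) by (apply Rmult_lt_0_compat; auto).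
  assert (hQ : 0 < Q) by nra.
  assert (hL := lil_scale_pos n g0 g2).
  assert (hpast : lil_scale n' <= eps / 2 * lil_scale n).
  { unfold lil_scale. rewrite <- (sqrt_pow2 (eps / 2)) by lra. rewrite <- sqrt_mult_alt by nra. apply sqrt_le_1_alt.
    assert (hll : ln (ln (INR n')) <= ln (ln (INR n))).
    { apply ln_le; auto. apply ln_le; auto. apply le_INR. unfold n, n'. apply Nat.pow_le_mono_r; lia. }
    assert (hBi : 0 < / INR B) by (apply Rinv_0_lt_compat; auto).
    set (L := ln (ln (INR n))) in *. set (L' := ln (ln (INR n'))) in *.
    assert (hBL : / INR B * L' <= eps ^ 2 / 4 * L) by (apply Rmult_le_compat; lra).
    rewrite hnn.
    replace (2 * a * (INR n * / INR B * L')) with (2 * a * INR n * (/ INR B * L')) by ring.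
    replace ((eps / 2) ^ 2 * (2 * a * (INR n * L))) with (2 * a * INR n * (eps ^ 2 / 4 * L)) by field.
    apply Rmult_le_compat_l; auto. apply Rmult_le_pos; lra. }
  (* One [eps] is the window of the last block; the other is the past, bounded by twice the scale at
     [n']. *)
  assert (hs : Rabs (Sn X n w / lil_scale n - c) <= 2 * eps).
  { replace (Sn X n w / lil_scale n - c) with ((Sn X n w - c * lil_scale n) * / lil_scale n) by (field; lra).
    rewrite Rabs_mult, (Rabs_right (/ _)) by (apply Rle_ge; left; apply Rinv_0_lt_compat; auto).
    apply Rmult_le_reg_r with (lil_scale n); auto. rewrite Rmult_assoc, Rinv_l, Rmult_1_r by lra.
    assert (ht := Rabs_triang (Sn X n w - Sn X n' w - c * lil_scale n) (Sn X n' w)).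
    replace (Sn X n w - Sn X n' w - c * lil_scale n + Sn X n' w) with (Sn X n w - c * lil_scale n) in ht by ring. lra. }
  rewrite snorm_eq by auto. fold Q.
  destruct (inv_sqrt_near (Q / (INR n * a)) eps he) as (i1 & i2 & i3).
  { apply Rmult_le_reg_r with (INR n * a); auto. unfold Rdiv; rewrite Rmult_assoc, Rinv_l by lra. lra. }
  specialize (i3 ltac:(apply Rmult_le_reg_r with (INR n * a); auto; unfold Rdiv; rewrite Rmult_assoc, Rinv_l by lra; lra)).
  set (u := Sn X n w / lil_scale n) in *. set (v := / sqrt (Q / (INR n * a))) in *.
  replace (u * v - c) with ((u - c) + u * (v - 1)) by ring.
  assert (hu : Rabs u <= 1 + 2 * eps).
  { apply Rabs_le_between in hs. apply Rabs_le. lra. }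
  assert (hv : Rabs (v - 1) <= 2 * eps) by (apply Rabs_le; lra).
  eapply Rle_trans; [apply Rabs_triang|]. rewrite Rabs_mult.
  assert (Rabs u * Rabs (v - 1) <= (1 + 2 * eps) * (2 * eps)) by (apply Rmult_le_compat; auto using Rabs_pos). nra.
Qed.

Proposition snorm_cluster : as_ (fun w => cluster_to (fun n => snorm n w) (-1) 1).
Proof.
  assert (hm : forall m, 0 < / INR (S m) <= 1).
  { intros m. split; [apply Rinv_0_lt_compat, lt_0_INR; lia|]. rewrite <- Rinv_1. apply Rinv_le_contravar; [lra|].
    apply (le_INR 1); lia. }
  assert (hU : as_ (fun w => forall m, exists N, forall n, (N <= n)%nat -> Rabs (snorm n w) <= 1 + / INR (S m))).
  { apply (as_forall SL CV). intros m. specialize (hm m).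
    apply (as_mono _ _ (snorm_bounded (/ INR (S m) / 5) ltac:(lra))).
    intros w [N hN]. exists N. intros n hn. specialize (hN n hn). lra. }
  assert (hL : as_ (fun w => forall i m N, exists n, (N <= n)%nat /\
      Rabs (snorm n w - Rmin 1 (-1 + INR i / INR (S m))) <= / INR (S m))).
  { apply (as_forall SL CV); intros i. apply (as_forall SL CV); intros m. specialize (hm m).
    assert (hc : -1 <= Rmin 1 (-1 + INR i / INR (S m)) <= 1).
    { split; [apply Rmin_glb; [lra|]|apply Rmin_l].
      assert (0 <= INR i / INR (S m)) by (apply Rmult_le_pos; [apply pos_INR|lra]). lra. }
    apply (as_mono _ _ (snorm_recurrent _ (/ INR (S m) / 6) hc ltac:(lra))).
    intros w h N. destruct (h N) as (n & hn & h'). exists n; split; auto. lra. }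
  apply (as_mono _ _ (as_and SL CV _ _ hU hL)). intros w [h1 h2]. apply cluster_of_dense; auto.
Qed.

End Lower.

Theorem theorem5p1 (Omega : Type) (F : (Omega -> Prop) -> Prop)
    (H : (Omega -> R) -> Prop) (E : (Omega -> R) -> Rbar)
    (sl su : R) (X0 : Omega -> R) (X : nat -> Omega -> R) :
  sublinear_space F H E ->
  0 < sl -> sl <= su ->
  H X0 -> (forall n, H (X n)) ->
  indep_seq E X ->
  (forall n, same_dist E (X n) X0) ->
  G_normal E (sl ^ 2) (su ^ 2) X0 ->
  Vcap_continuous F H E ->
  lVcap H E (fun w =>
    cluster_to (fun n => Sn X n w / (Vn X n w * sqrt (2 * ln (ln (INR n))))) (-1) 1) = 1.
Proof.
  intros hSL hsl hsu h0 hX hind hdist hG hcont.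
  assert (ST : setting F H E X0 X) by (constructor; auto).
  assert (hs : su ^ 2 <= sl ^ 2) by (apply (variance_certain ST); auto).
  assert (e : su ^ 2 = sl ^ 2) by (apply Rle_antisym; auto; apply pow_incr; lra).
  rewrite e in hG.
  apply (as_lV (F:=F) hSL). apply (snorm_cluster ST (sl ^ 2)); auto. apply pow_lt; auto.
Qed.
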